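(* Let $a,b,c,d,x_0,x_1$ be real numbers such that $a,c<0$, $b,d>0$ and $x_0,x_1>\sqrt3$. Then each of the following two piecewise systems has a limit cycle: $$\begin{cases}\dot w=\left(\frac{b-ai}{2}\right)(w-1)\bigl(-2i+(w-1)(-i+x_1)\bigr), & w\in\Sigma_+^E,\\ \dot w=\frac{4i}{w-1}, & w\in\Sigma_c^E,\\ \dot w=\left(\frac{d-ci}{2}\right)(w-1)\bigl(-2i+(w-1)(i-x_0)\bigr), & w\in\Sigma_-^E,\end{cases}$$ and $$\begin{cases}\dot w=\left(\frac{b-ai}{2}\right)(w-1)\bigl(-2iw+(w-1)(-i+x_1)\bigr), & w\in\Sigma_+^I,\\ \dot w=\frac{4iw^3}{w-1}, & w\in\Sigma_c^I,\\ \dot w=\left(\frac{d-ci}{2}\right)(w-1)\bigl(-2iw+(w-1)(i-x_0)\bigr), & w\in\Sigma_-^I.\end{cases}$$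
   Context: The zones are $\Sigma_+^E=\{|w|<1\}$, $\Sigma_c^E=\{|w|>1,\ |w-2|>1\}$, $\Sigma_-^E=\{|w-2|<1\}$ (externally tangent circles) and $\Sigma_+^I=\{|w-\tfrac23|<\tfrac13\}$, $\Sigma_c^I=\{|w-\tfrac23|>\tfrac13,\ |w|<1\}$, $\Sigma_-^I=\{|w|>1\}$ (internally tangent circles). The dynamics on the discontinuity circles follows Filippov's convention (where both adjacent vector fields cross the curve in the same direction, trajectories are obtained by concatenation). A limit cycle is an isolated periodic orbit.
   Formalization: For the second system the limit cycle is taken on the sphere (trajectories may pass through w=∞) and is shown to lie in the plane unless an explicit equation in a,b,c,d,x_0,x_1 holds; when it holds, the only closed orbit passes through infinity and the planar claim fails. *)

(* Defs.v *)
(* MathComp-Analysis *)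
From HB Require Import structures.
From mathcomp Require Import all_boot all_order all_algebra.
From mathcomp Require Import complex.
From mathcomp Require Import all_classical all_reals all_analysis.

Set Implicit Arguments.
Unset Strict Implicit.
Unset Printing Implicit Defensive.

Import Order.TTheory GRing.Theory Num.Theory numFieldNormedType.Exports.

Local Open Scope classical_set_scope.
Local Open Scope ring_scope.
Local Open Scope complex_scope.

(* [None] is the point at infinity; [R[i]^o] is [R[i]] with its norm topology. *)
Notation riemann_sphere R := (one_point_compactification (R[i])^o).

(* Each vector field is given by a formula which is continuous on the closure
   of its zone, except at the common tangency point w = 1, where the middle
   field has a pole. *)
Record pw_system (R : realType) := PWSystem {
  zone_p : set R[i]; field_p : R[i] -> R[i];
  zone_c : set R[i]; field_c : R[i] -> R[i];
  zone_m : set R[i]; field_m : R[i] -> R[i] }.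

(* Filippov's set-valued field at w <> 1: the convex hull of the limits at w of
   the fields of the zones adherent to w.  It is a singleton inside a zone and
   a segment on a discontinuity circle. *)
Definition filippov (R : realType) (S : pw_system R) (w : R[i]) : set R[i] :=
  [set v | exists l : R * R * R,
    let: (lp, lc, lm) := l in
    [/\ [/\ 0 <= lp, 0 <= lc & 0 <= lm], lp + lc + lm = 1,
        [/\ lp != 0 -> closure (zone_p S : set (R[i])^o) w,
            lc != 0 -> closure (zone_c S : set (R[i])^o) w
          & lm != 0 -> closure (zone_m S : set (R[i])^o) w]
      & v = lp%:C * field_p S w + lc%:C * field_c S w + lm%:C * field_m S w]].

Definition absolutely_continuous (R : realType) (a b : R) (f : R -> R) : Prop :=
  forall e : R, 0 < e -> exists2 d : R, 0 < d &
    forall (n : nat) (u v : 'I_n -> R),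
      (forall k, [/\ a <= u k, u k <= v k & v k <= b]) ->
      (forall j k : 'I_n, (j < k)%N -> v j <= u k) ->
      \sum_(k < n) (v k - u k) < d ->
      \sum_(k < n) `|f (v k) - f (u k)| < e.

(* Affine coordinates of a curve on the sphere; the value 0 at times when the
   curve is at infinity is never used. *)
Definition re_curve (R : realType) (g : R -> riemann_sphere R) (t : R) : R :=
  complex.Re (odflt 0 (g t)).
Definition im_curve (R : realType) (g : R -> riemann_sphere R) (t : R) : R :=
  complex.Im (odflt 0 (g t)).

(* Filippov solutions defined for all times: curves that are absolutely
   continuous and satisfy g'(t) \in filippov S (g t) for almost every t.  The
   singular point w = 1 is not part of the phase space.  A solution that blows
   up at an isolated time is continued through infinity, which is a regular
   point for a quadratic field; a curve that stays in the plane is a trajectory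
   in this sense exactly when it is a Filippov solution in the plane. *)
Definition trajectory (R : realType) (S : pw_system R)
    (g : R -> riemann_sphere R) : Prop :=
  [/\ continuous g,
      (forall t, \forall s \near t^', g s <> None),
      (forall t, g t <> Some 1),
      (forall s t, (forall r, s <= r <= t -> g r <> None) ->
         absolutely_continuous s t (re_curve g) /\
         absolutely_continuous s t (im_curve g))
    & {ae (@lebesgue_measure R), forall t, exists w v : R[i],
         [/\ g t = Some w, filippov S w v,
             is_derive t 1 (re_curve g) (complex.Re v)
           & is_derive t 1 (im_curve g) (complex.Im v)]}].

Definition periodic_orbit (R : realType) (S : pw_system R)
    (C : set (riemann_sphere R)) : Prop :=
  exists (g : R -> riemann_sphere R) (T : R),
    [/\ trajectory S g, 0 < T, (forall t, g (t + T) = g t),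
        (exists t, g t <> g 0) & C = range g].

Definition limit_cycle (R : realType) (S : pw_system R)
    (C : set (riemann_sphere R)) : Prop :=
  periodic_orbit S C /\
  exists U : set (riemann_sphere R), [/\ open U, C `<=` U &
    forall C', periodic_orbit S C' -> C' `<=` U -> C' = C].

Definition external_system (R : realType) (a b c d x0 x1 : R) : pw_system R :=
  PWSystem
    [set w : R[i] | `|w| < 1]
    (fun w => (b%:C - a%:C * 'i%C) / 2 * (w - 1) *
              (- 2 * 'i%C + (w - 1) * (- 'i%C + x1%:C)))
    [set w : R[i] | 1 < `|w| /\ 1 < `|w - 2| ]
    (fun w => 4 * 'i%C / (w - 1))
    [set w : R[i] | `|w - 2| < 1]
    (fun w => (d%:C - c%:C * 'i%C) / 2 * (w - 1) *
              (- 2 * 'i%C + (w - 1) * ('i%C - x0%:C))).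

Definition internal_system (R : realType) (a b c d x0 x1 : R) : pw_system R :=
  PWSystem
    [set w : R[i] | `|w - 2 / 3| < 1 / 3]
    (fun w => (b%:C - a%:C * 'i%C) / 2 * (w - 1) *
              (- 2 * 'i%C * w + (w - 1) * (- 'i%C + x1%:C)))
    [set w : R[i] | 1 / 3 < `|w - 2 / 3| /\ `|w| < 1]
    (fun w => 4 * 'i%C * w ^+ 3 / (w - 1))
    [set w : R[i] | 1 < `|w| ]
    (fun w => (d%:C - c%:C * 'i%C) / 2 * (w - 1) *
              (- 2 * 'i%C * w + (w - 1) * ('i%C - x0%:C))).

(* In the coordinate W = w / (w - 1) the outer field of the internal system is
   W' = (c + d i) (W - q) with q = (1 + i x0) / 2, and w = oo is W = 1.  The
   cycle crosses Re W = 1/2 below q at distance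
   (x0 + x1) / 2 * (1 + A) / (1 - A B) from q, where A = exp (pi a / b) and
   B = exp (pi c / d), and spirals around q.  It passes through W = 1, reached
   after a rotation of angle atan (1 / x0), exactly when the relation below
   holds.  For such parameters the cycle is unbounded in the w-plane. *)
Definition cycle_meets_infinity (R : realType) (a b c d x0 x1 : R) : Prop :=
  (x0 + x1) * (1 + expR (pi * a / b)) / (1 - expR (pi * a / b + pi * c / d))
    * expR (c / d * atan (1 / x0)) = Num.sqrt (1 + x0 ^+ 2).

(* Main.v *)
(* The substitution w = 1 + 1 / z for the external system, w = 1 + 1 / (z - 1)
   for the internal one, turns both into the same system: linear foci in
   Re z < -1/2 and Re z > 1/2, separated by a strip where z' = - 4 i z^3.  A half
   turn around a focus multiplies the distance to it by exp (pi a / b) or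
   exp (pi c / d), and the strip is crossed at constant height because
   Re (1 / z^2) is conserved there and the field is reversible.  The return map
   to the line Re z = -1/2 is therefore an affine contraction, whose fixed point
   gives the cycle.  The cycle avoids the rectangle spanned by the two foci.  A
   Filippov orbit that avoids it crosses the lines transversally, hence coincides
   with the explicit flow and meets the section; if it is periodic, its
   successive heights converge to the fixed point, so by compactness it passes
   through the fixed point and is the cycle. *)

Require Import Defs.
From mathcomp Require Import all_boot all_order all_algebra.
From mathcomp Require Import complex.
From mathcomp Require Import all_classical all_reals all_analysis.
From mathcomp Require Import ring lra.
Import Order.TTheory GRing.Theory Num.Theory numFieldNormedType.Exports.
Local Open Scope classical_set_scope.
Local Open Scope ring_scope.
Local Open Scope complex_scope.

(** * Monotonicity from almost everywhere derivatives *)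

(** A competing orbit is only an absolutely continuous curve obeying an inclusion almost everywhere,
    so uniqueness for smooth fields does not apply to it. Each zone has instead an explicit complex
    first integral: the displacement from the focus times [exp(- (a + i b) t)], and
    [1 / z^2 - 8 i t] in the strip. Its derivative vanishes almost everywhere, so it is constant and
    the orbit is given by a formula; hence the calculus of absolutely continuous functions.

    The constant sqrt 3 comes from the middle field, whose horizontal component on the two lines is
    [4 y (3/4 - y^2)]. Above [x0 / 2] and below [- x1 / 2] its sign is opposite to that of [y], and
    so is that of the linear fields there: the lines are crossed and no sliding occurs.

    The point w = oo becomes z = 0, inside the rectangle, for the external system, and z = 1, where
    the cycle may pass, for the internal one. Absolute continuity is known only away from such
    passages, so every estimate must tolerate isolated exceptional times, bridged by continuity. *)

Lemma cousin_ind {R : realType} (H : R -> Prop) (s T : R) :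
  s <= T -> H s ->
  (forall t, s <= t <= T -> exists2 d : R, 0 < d &
    forall u v, s <= u -> u <= t -> t <= v -> v <= T -> t - d < u -> v < t + d ->
    H u -> H v) ->
  H T.
Proof.
move=> sT Hs step.
(* This is Cousin's covering lemma as an induction: a step may cross [t] from left to right, with a
   width depending on [t]. The supremum [m] of the points reached is crossed by its own step, so it
   can only be [T]. *)
pose A := [set t : R | s <= t <= T /\ H t].
have As : A s by split => //; rewrite lexx.
have supA : has_sup A by split; [exists s | exists T => x [/andP[]]].
pose m := sup A.
have leM x : A x -> x <= m by exact: sup_upper_bound.
have sm : s <= m by exact: leM.
have mT : m <= T by apply: ge_sup; [exists s | move=> x [/andP[]]].
have [d d0 stp] := step m (introT andP (conj sm mT)).
have [u [/andP[su uT] Hu] mdu] := sup_adherent d0 supA.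
have um : u <= m by apply: leM; split => //; rewrite su.
have Hm : H m by apply: (stp u m) => //; rewrite ltrDl.
case: (ltP m T) => [mltT|Tm]; last by have -> : T = m by apply/eqP; rewrite eq_le Tm mT.
pose v := Num.min T (m + d / 2).
have vm : m < v by rewrite lt_min mltT ltrDl divr_gt0.
have vT : v <= T by rewrite ge_min lexx.
have Hv : H v.
  apply: (stp m v) => //; first exact: ltW.
    by rewrite ltrBlDr ltrDl.
  rewrite gt_min; apply/orP; right.
  by rewrite ltrD2l ltr_pdivrMr// ltr_pMr// ltr1n.
suff : v <= m by rewrite leNgt vm.
apply: leM.
by split=> //; rewrite vT (le_trans sm (ltW vm)).
Qed.

Lemma is_derive_slope {R : realType} (f : R -> R) (t df : R) :
  is_derive t 1 f df -> forall e : R, 0 < e -> exists2 d : R, 0 < d &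
  forall r, `|r - t| < d -> `|f r - f t - df * (r - t)| <= e * `|r - t|.
Proof.
move=> fdf e e0.
have /cvgrPdist_lt/(_ e e0) : h^-1 *: (f (h + t) - f t) @[h --> (0:R)^'] --> df.
  have [+ <-] := fdf.
  by move=> /cvg_ex[l Hl]; rewrite /derive (cvg_lim _ Hl)//; move: Hl;
     under eq_fun do rewrite scaler1.
rewrite near_withinE => /nbhs_ballP[d /= d0 dP].
exists d => // r rt.
have [->|neq] := eqVneq r t; first by rewrite !subrr mulr0 subr0 normr0 mulr0.
have := dP (r - t); rewrite /ball/= sub0r normrN => /(_ rt).
rewrite subr_eq0 neq subrK => /(_ isT) lte.
have rt0 : r - t != 0 by rewrite subr_eq0.
have -> : f r - f t - df * (r - t) = - (df - (r - t)^-1 *: (f r - f t)) * (r - t).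
  by rewrite /GRing.scale/=; field.
by rewrite normrM normrN ler_wpM2r// ltW.
Qed.

Lemma ae_open_cover {R : realType} (P : R -> Prop) (d : R) : 0 < d ->
  {ae (@lebesgue_measure R), forall t, P t} ->
  exists O : set R, [/\ open O, (forall t, ~ P t -> O t) &
    (lebesgue_measure O < d%:E)%E].
Proof.
move=> d0 [N [mN N0 subN]].
have [|O [oO NO lt]] := @lebesgue_regularity_outer R N d mN _ d0.
  by rewrite [X in (X < _)%E]N0.
exists O; split => //; first by move=> t nPt; apply/NO/subN.
have mO : measurable O by exact: measurable_realfun.open_measurable.
rewrite (_ : O = (O `\` N) `|` N); last by rewrite setUC setDUK.
rewrite measureU//; last first.
- by rewrite setDE -setIA setICl setI0.
- exact: measurableD.
by rewrite [X in (_ + X)%E]N0 adde0.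
Qed.

(* Cover the exceptional null set by an open set O of small measure and use a
   gauge: around a point of O take an interval inside O, elsewhere one on which
   the difference quotient exceeds - e.  Absolute continuity controls the pieces
   of the first kind. *)
Lemma ae_mono_AC {R : realType} (f : R -> R) (s t : R) : s <= t ->
  absolutely_continuous s t f ->
  {ae (@lebesgue_measure R), forall r, s < r < t ->
     exists df, is_derive r 1 f df /\ 0 <= df} ->
  f s <= f t.
Proof.
move=> st acf aef.
rewrite leNgt; apply/negP => ltf.
(* With this [e] the term [e * (t - s)] is at most a third of the supposed drop [f s - f t], and
   [e1] is another third. The summand 1 keeps the denominator positive when [s = t]. *)
pose e := (f s - f t) / (3 * (1 + (t - s))).
have ts1 : 0 < 1 + (t - s) by rewrite ltr_wpDr ?subr_ge0.
have e0 : 0 < e by rewrite divr_gt0 ?subr_gt0 ?mulr_gt0.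
pose e1 := (f s - f t) / 3.
have e10 : 0 < e1 by rewrite divr_gt0 ?subr_gt0.
have [d d0 acd] := acf e1 e10.
(* The open cover O also swallows the end points. *)
have aef' : {ae (@lebesgue_measure R), forall r,
     r != s /\ r != t /\ (s < r < t -> exists df, is_derive r 1 f df /\ 0 <= df)}.
  have aes x : {ae (@lebesgue_measure R), forall r, r != x}.
    exists [set x]; split => //; first exact: lebesgue_measure_set1.
    by move=> r /= /negP; rewrite negbK => /eqP.
  by apply: filterS3 (aes s) (aes t) aef => r A B C.
have [ O [oO PO muO]] := ae_open_cover _ _ d0 aef'.
have mO : measurable O by exact: measurable_realfun.open_measurable.
(* Up to [r] the drop is paid for by the slope [e] and by the variation over finitely many ordered
   intervals. Their total length is bounded by the measure of [O] before [r], hence by [d] at the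
   end; half-open intervals make this measure additive. *)
pose H (r : R) := exists (n : nat) (u v : nat -> R),
  [/\ (forall k, (k < n)%N -> [/\ s <= u k, u k <= v k & v k <= r]),
      (forall j k, (j < k)%N -> (k < n)%N -> v j <= u k),
      ((\sum_(k < n) (v k - u k))%:E <= lebesgue_measure (O `&` `]s, r]))%E
    & f s - f r <= e * (r - s) + \sum_(k < n) `|f (v k) - f (u k)| ].
suff : H t.
  move=> [n [u [v [uv dis]]]] mle fle.
  have sl : \sum_(k < n) (v k - u k) < d.
    rewrite -lte_fin; apply: le_lt_trans mle _; apply: le_lt_trans muO.
    by apply: le_measure; rewrite ?inE//; apply: measurableI.
  have A1 (k : 'I_n) : [/\ s <= u k, u k <= v k & v k <= t] by exact: uv.
  have A2 (j k : 'I_n) : (j < k)%N -> v j <= u k by move=> jk; exact: dis.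
  have sl2 := acd n (fun k => u k) (fun k => v k) A1 A2 sl.
  have : f s - f t < e * (t - s) + e1 by apply: le_lt_trans fle _; rewrite ltrD2l.
  have : e * (t - s) <= e1.
    rewrite /e /e1 -mulrA ler_pM2l ?subr_gt0// invfM -mulrA ler_piMr//.
    by rewrite mulrC ler_pdivrMr// mul1r lerDr.
  by rewrite /e1; lra.
apply: (@cousin_ind R H s t) => //.
  exists 0%N, (fun=> 0), (fun=> 0); split => //; last by rewrite big_ord0 !subrr mulr0 addr0.
  by rewrite big_ord0 measure_ge0.
move=> r /andP[sr rt].
have [Or|nOr] := pselect (O r).
  have /nbhs_ballP[d1 /= d10 dO] := open_nbhs_nbhs (conj oO Or).
  exists d1 => // u v su ur rv vt du dv [n [U [V [uv dis mle fle]]]].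
  exists n.+1, (fun k => if k == n then u else U k), (fun k => if k == n then v else V k).
  have uvO : `]u, v] `<=` O.
    move=> x /=; rewrite in_itv/= => /andP[ux xv]; apply: dO; rewrite /ball/=.
    by rewrite ltr_norml; apply/andP; split; lra.
  split.
  - move=> k; case: eqP => [_ _|/eqP kn kn1]; first by split => //; apply: le_trans rv.
    have [|? ? Vu] := uv k; first by rewrite ltn_neqAle kn -ltnS.
    by split => //; apply: le_trans Vu _; apply: le_trans rv.
  - move=> j k jk kn1; rewrite (_ : (j == n) = false); last first.
      by apply: ltn_eqF; rewrite (leq_trans jk)// -ltnS.
    case: eqP => [kn|/eqP kn].
      by have [|] := uv j; rewrite -?kn.
    by apply: dis => //; rewrite ltn_neqAle kn -ltnS.
  - rewrite big_ord_recr/= eqxx.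
    under eq_bigr => k _ do rewrite (ltn_eqF (ltn_ord k)).
    have -> : O `&` `]s, v] = (O `&` `]s, u]) `|` `]u, v].
      apply/seteqP; split => x /=; rewrite !in_itv/=.
        move=> [Ox /andP[sx xv]]; case: (leP x u) => xu; [left|right].
          by rewrite sx.
        by rewrite xv.
      case=> [[Ox /andP[sx xu]]|/andP[ux xv]].
        by split => //; rewrite sx (le_trans xu)// (le_trans ur).
      split; first by apply: uvO; rewrite /= in_itv/= ux.
      by rewrite xv (le_lt_trans su).
    rewrite measureU//; last first.
    + apply/seteqP; split => x //=; rewrite !in_itv/= => -[[_ /andP[_ xu]] /andP[ux _]].
      by move: (lt_le_trans ux xu); rewrite ltxx.
    + by apply: measurableI.
    have uv1 : u <= v by apply: le_trans rv.
    have E : (lebesgue_measure `]u, v]%classic = (v - u)%:E)%E.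
      rewrite lebesgue_measure_itv/= lte_fin; case: ltP => // vu.
      have -> : v = u by apply/eqP; rewrite eq_le vu uv1.
      by rewrite subrr.
    by rewrite EFinD; apply: leeD => //; rewrite -E.
  - rewrite big_ord_recr/= eqxx.
    under eq_bigr => k _ do rewrite (ltn_eqF (ltn_ord k)).
    have : f u - f v <= `|f v - f u| by rewrite distrC ler_norm.
    have : e * (u - s) <= e * (v - s) by rewrite ler_pM2l// lerD2r (le_trans ur).
    lra.
have : r != s /\ r != t /\ (s < r < t -> exists df, is_derive r 1 f df /\ 0 <= df).
  by apply: contrapT => /PO.
move=> [rns [rnt]] [|df [fdf df0]]; first by rewrite !lt_neqAle sr rt rnt eq_sym rns.
have [d1 d10 dP] := is_derive_slope _ _ _ fdf _ e0.
exists d1 => // u v su ur rv vt du dv [n [U [V [uv dis mle fle]]]].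
exists n, U, V; split => //.
- by move=> k kn; have [? ? Vu] := uv k kn; split => //; lra.
- apply: le_trans mle _; apply: le_measure; rewrite ?inE//; try by apply: measurableI.
  move=> x /=; rewrite !in_itv/= => -[Ox /andP[sx xu]]; split => //.
  by rewrite sx (le_trans xu)// (le_trans ur).
(* The slope estimate at [r] is used on its left for [u] and on its right for [v]; with [0 <= df]
   the two add up to [f u - f v <= e * (v - u)]. *)
have := dP u; rewrite (ler0_norm (x := u - r)) ?subr_le0// => /(_ _)/ler_normlP[|_ A]; first lra.
have := dP v; rewrite (ger0_norm (x := v - r)) ?subr_ge0// => /(_ _)/ler_normlP[|B _]; first lra.
have : 0 <= df * (v - r) by rewrite mulr_ge0// subr_ge0.
have : 0 <= df * (r - u) by rewrite mulr_ge0// subr_ge0.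
lra.
Qed.

Lemma ae_imp {R : realType} (P Q : R -> Prop) : (forall t, P t -> Q t) ->
  {ae (@lebesgue_measure R), forall t, P t} -> {ae (@lebesgue_measure R), forall t, Q t}.
Proof.
move=> PQ [N [mN N0 PN]]; exists N; split => // t nQ.
by apply: PN => /PQ.
Qed.

(** * Closure properties of absolute continuity *)

Lemma AC_unif {R : realType} (f : R -> R) (s t : R) : absolutely_continuous s t f ->
  forall e : R, 0 < e -> exists2 d : R, 0 < d & forall p q, s <= p <= t -> s <= q <= t ->
  `|p - q| < d -> `|f p - f q| < e.
Proof.
move=> acf e e0; have [d d0 acd] := acf e e0; exists d => //.
have le p q : s <= p <= t -> s <= q <= t -> p <= q -> q - p < d -> `|f q - f p| < e.
  move=> /andP[sp pt] /andP[sq qt] pq qpd.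
  have := acd 1%N (fun=> p) (fun=> q); rewrite !big_ord1; apply => //.
  by move=> j k; rewrite !ord1 ltnn.
move=> p q sp sq; case: (leP p q) => pq.
  by rewrite distrC ger0_norm ?subr_ge0// distrC => ?; exact: le.
by rewrite ger0_norm ?subr_ge0 ?ltW// => ?; apply: le => //; exact: ltW.
Qed.

Lemma AC_bounded {R : realType} (f : R -> R) (s t : R) : absolutely_continuous s t f ->
  exists2 M : R, 0 < M & forall p, s <= p <= t -> `|f p| <= M.
Proof.
move=> acf; case: (leP s t) => [st|ts]; last first.
  by exists 1 => // p /andP[sp /(le_trans sp)]; rewrite leNgt ts.
have [d d0 dP] := AC_unif _ _ _ acf _ ltr01.
pose H r := exists2 M : R, 0 < M & forall p, s <= p <= r -> `|f p| <= M.
apply: (@cousin_ind R H s t) => //.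
  exists (`|f s| + 1); first by rewrite ltr_wpDl.
  move=> p /andP[sp ps]; have -> : p = s by apply/eqP; rewrite eq_le ps sp.
  by rewrite lerDl.
move=> r /andP[sr rt]; exists (d / 2); first by rewrite divr_gt0.
move=> u v su ur rv vt du dv [M M0 HM]; exists (M + 1); first by rewrite addr_gt0.
move=> p /andP[sp pv]; case: (leP p u) => pu.
  by rewrite (le_trans (HM p _)) ?sp// lerDl.
have : `|f p - f u| < 1.
  apply: dP; first by rewrite sp (le_trans pv).
    by rewrite su (le_trans ur).
  by rewrite ger0_norm ?subr_ge0 ?ltW//; lra.
have := HM u; rewrite su lexx => /(_ isT) fu fpu.
rewrite -[f p](subrK (f u)) (le_trans (ler_normD _ _))// addrC lerD//; exact: ltW.
Qed.

(** For [AC_V]: a uniform lower bound makes inversion Lipschitz on the values taken by [f]. *)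
Lemma AC_away0 {R : realType} (f : R -> R) (s t : R) : absolutely_continuous s t f ->
  (forall p, s <= p <= t -> f p != 0) ->
  exists2 m : R, 0 < m & forall p, s <= p <= t -> m <= `|f p|.
Proof.
move=> acf f0; case: (leP s t) => [st|ts]; last first.
  by exists 1 => // p /andP[sp /(le_trans sp)]; rewrite leNgt ts.
pose H r := exists2 m : R, 0 < m & forall p, s <= p <= r -> m <= `|f p|.
apply: (@cousin_ind R H s t) => //.
  exists (`|f s|); first by rewrite normr_gt0 f0// lexx.
  by move=> p /andP[sp ps]; have -> : p = s by apply/eqP; rewrite eq_le ps sp.
move=> r /andP[sr rt].
have fr0 : 0 < `|f r| / 2 by rewrite divr_gt0// normr_gt0 f0// sr.
have [d d0 dP] := AC_unif _ _ _ acf _ fr0.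
exists d => // u v su ur rv vt du dv [m m0 Hm].
exists (Num.min m (`|f r| / 2)); first by rewrite lt_min m0.
move=> p /andP[sp pv]; rewrite ge_min; case: (leP p u) => pu.
  by rewrite Hm ?sp.
apply/orP; right.
have : `|f p - f r| < `|f r| / 2.
  apply: dP; [by rewrite sp (le_trans pv)|by rewrite sr|].
  by rewrite ltr_norml; apply/andP; split; lra.
have : `|f r| <= `|f p| + `|f p - f r|.
  by rewrite (distrC (f p)) -{1}[f r](subrKC (f p)) ler_normD.
lra.
Qed.

(** The closure properties below all reduce to this domination of the increments of [h]. Passing to
    the positive constant [C] allows [L] and [K] of any sign. *)
Lemma AC_comb {R : realType} (f g h : R -> R) (s t L K : R) :
  absolutely_continuous s t f -> absolutely_continuous s t g ->
  (forall u v, s <= u -> u <= v -> v <= t ->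
     `|h v - h u| <= L * `|f v - f u| + K * `|g v - g u|) ->
  absolutely_continuous s t h.
Proof.
move=> acf acg hfg e e0.
pose C := `|L| + `|K| + 1.
have C0 : 0 < C by rewrite ltr_wpDl// addr_ge0.
have eC : 0 < e / (2 * C) by rewrite divr_gt0// mulr_gt0.
have [d1 d10 acd1] := acf _ eC; have [d2 d20 acd2] := acg _ eC.
exists (Num.min d1 d2); first by rewrite lt_min d10.
move=> n u v uv dis; rewrite lt_min => /andP[l1 l2].
have A := acd1 n u v uv dis l1; have B := acd2 n u v uv dis l2.
apply: (@le_lt_trans _ _ (C * (\sum_(k < n) `|f (v k) - f (u k)|) +
   C * (\sum_(k < n) `|g (v k) - g (u k)|))).
  rewrite !mulr_sumr -big_split/=; apply: ler_sum => k _.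
  have [su uvk vt] := uv k; apply: le_trans (hfg _ _ su uvk vt) _.
  apply: lerD; apply: ler_wpM2r => //; rewrite /C.
    by apply: le_trans (ler_norm _) _; rewrite -addrA lerDl addr_ge0.
  by apply: le_trans (ler_norm _) _; rewrite -addrA addrCA lerDl addr_ge0.
have -> : e = C * (e / (2 * C)) + C * (e / (2 * C)) by field; rewrite gt_eqF.
by apply: ltrD; rewrite ltr_pM2l.
Qed.

Lemma AC_lip {R : realType} (h : R -> R) (s t L : R) :
  (forall u v, s <= u -> u <= v -> v <= t -> `|h v - h u| <= L * (v - u)) ->
  absolutely_continuous s t h.
Proof.
have acid : absolutely_continuous s t (fun x => x).
  move=> e e0; exists e => // n u v uv _; apply: le_lt_trans.
  apply: ler_sum => k _; have [_ uvk _] := uv k; by rewrite ger0_norm ?subr_ge0.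
move=> hL; apply: (@AC_comb R _ _ h s t L 0 acid acid) => u v su uv vt; have vu := hL u v su uv vt.
by rewrite mul0r addr0 [X in _ * X]ger0_norm ?subr_ge0.
Qed.

Lemma AC_cst {R : realType} (c s t : R) : absolutely_continuous s t (fun=> c).
Proof. by apply: (@AC_lip R _ s t 0) => u v _ _ _; rewrite subrr normr0 mul0r. Qed.

Lemma AC_id {R : realType} (s t : R) : absolutely_continuous s t (fun x => x).
Proof.
by apply: (@AC_lip R _ s t 1) => u v _ uv _; rewrite mul1r ger0_norm// subr_ge0.
Qed.

Lemma AC_D {R : realType} (f g : R -> R) (s t : R) :
  absolutely_continuous s t f -> absolutely_continuous s t g ->
  absolutely_continuous s t (fun x => f x + g x).
Proof.
move=> acf acg; apply: (@AC_comb R _ _ _ s t 1 1 acf acg) => u v _ _ _.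
rewrite !mul1r; apply: le_trans (ler_normD _ _).
by rewrite le_eqVlt; apply/orP; left; apply/eqP; congr `|_|; ring.
Qed.

Lemma AC_M {R : realType} (f g : R -> R) (s t : R) :
  absolutely_continuous s t f -> absolutely_continuous s t g ->
  absolutely_continuous s t (fun x => f x * g x).
Proof.
move=> acf acg.
have [M M0 fM] := AC_bounded _ _ _ acf; have [K K0 gK] := AC_bounded _ _ _ acg.
apply: (@AC_comb R _ _ _ s t K M acf acg) => u v su uv vt.
have -> : f v * g v - f u * g u = g v * (f v - f u) + f u * (g v - g u) by ring.
rewrite (le_trans (ler_normD _ _))// !normrM lerD// ler_wpM2r//.
  by rewrite gK// vt andbT (le_trans su).
by rewrite fM// su (le_trans uv).
Qed.

Lemma AC_V {R : realType} (f : R -> R) (s t : R) :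
  absolutely_continuous s t f -> (forall p, s <= p <= t -> f p != 0) ->
  absolutely_continuous s t (fun x => (f x)^-1).
Proof.
move=> acf f0; have [m m0 fm] := AC_away0 _ _ _ acf f0.
apply: (@AC_comb R f f _ s t (m ^- 2) 0 acf acf) => u v su uv vt.
have ust : s <= u <= t by rewrite su (le_trans uv).
have vst : s <= v <= t by rewrite vt (le_trans su).
have fu := f0 u ust; have fv := f0 v vst.
have -> : (f v)^-1 - (f u)^-1 = - ((f v)^-1 * (f u)^-1) * (f v - f u).
  by field; rewrite fu.
rewrite mul0r addr0 normrM normrN normrM !normfV ler_wpM2r//.
rewrite expr2 invfM ler_pM ?invr_ge0//.
  by rewrite lef_pV2 ?posrE ?normr_gt0// fm.
by rewrite lef_pV2 ?posrE ?normr_gt0// fm.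
Qed.

Lemma AC_eq {R : realType} (f g : R -> R) (s t : R) :
  (forall p, s <= p <= t -> f p = g p) ->
  absolutely_continuous s t f -> absolutely_continuous s t g.
Proof.
move=> fg acf; apply: (@AC_comb R f f _ s t 1 0 acf acf) => u v su uv vt.
by rewrite mul1r mul0r addr0 !fg ?su ?vt ?(le_trans su)// (le_trans uv).
Qed.

Lemma AC_N {R : realType} (f : R -> R) (s t : R) :
  absolutely_continuous s t f -> absolutely_continuous s t (fun x => - f x).
Proof.
move=> acf; apply: AC_eq (AC_M _ _ _ _ (AC_cst (-1) s t) acf) => p _.
by rewrite mulN1r.
Qed.

(** * Estimates across isolated exceptional times *)

Definition isolated {R : realType} (bad : R -> Prop) :=
  forall t : R, \forall r \near t^', ~ bad r.

(** Only intervals free of exceptional times are constrained: at a passage through infinity nothing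
    is known of the coordinates beyond continuity. *)
Definition AC_off {R : realType} (bad : R -> Prop) (s t : R) (f : R -> R) :=
  forall u v, s <= u -> v <= t -> (forall r, u <= r <= v -> ~ bad r) ->
  absolutely_continuous u v f.

Lemma near_dnbhs {R : realType} (P : R -> Prop) (t : R) : (\forall r \near t^', P r) ->
  exists2 d : R, 0 < d & forall r, r != t -> `|r - t| < d -> P r.
Proof.
rewrite near_withinE => /nbhs_ballP[d /= d0 dP]; exists d => // r rt rd.
by apply: dP => //; rewrite /ball/= distrC.
Qed.

Lemma near_nbhs {R : realType} (P : R -> Prop) (t : R) : (\forall r \near t, P r) ->
  exists2 d : R, 0 < d & forall r, `|r - t| < d -> P r.
Proof.
move=> /nbhs_ballP[d /= d0 dP]; exists d => // r rd.
by apply: dP => //; rewrite /ball/= distrC.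
Qed.

(** Near [r] the only possible exceptional time is [r] itself. On either side the inequality holds
    up to points arbitrarily close to [r], continuity carries it to [r], and a chain of such steps
    covers the interval. *)
Lemma ae_mono {R : realType} (bad : R -> Prop) (f : R -> R) (s t : R) : s <= t ->
  isolated bad -> AC_off bad s t f ->
  (forall r, s <= r <= t -> {for r, continuous f}) ->
  {ae (@lebesgue_measure R), forall r, s < r < t ->
     exists df, is_derive r 1 f df /\ 0 <= df} ->
  f s <= f t.
Proof.
move=> st bad0 acf cf aef.
apply: (@cousin_ind R (fun r => f s <= f r) s t) => // r /andP[sr rt].
have [d d0 dP] := near_dnbhs _ _ (bad0 r).
have sub u v : s <= u -> u <= v -> v <= t -> (forall r, u <= r <= v -> ~ bad r) -> f u <= f v.
  move=> su uv vt nb; apply: ae_mono_AC => //; first exact: acf.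
  apply: ae_imp aef => q qP /andP[uq qv]; apply: qP.
  by rewrite (le_lt_trans su)// (lt_le_trans qv).
have cfr : forall e, 0 < e -> exists2 d : R, 0 < d & forall q, `|q - r| < d -> `|f r - f q| < e.
  move=> e e0; apply: near_nbhs.
  by have /cvgrPdist_lt/(_ e e0) := cf r (introT andP (conj sr rt)).
exists d => // u v su ur rv vt du dv /le_trans; apply; apply: (@le_trans _ _ (f r)).
  rewrite leNgt; apply/negP => fru.
  have ultr : u < r by rewrite lt_neqAle ur andbT; apply: contraTneq fru => ->; rewrite ltxx.
  have [d1 d10 d1P] := cfr _ (eq_ind_r is_true fru (subr_gt0 (f r) (f u))).
  (* At [q], before [r] but within [d1] of it, [f] would already be below [f u], although no
     exceptional time lies between [u] and [q]. *)
  pose q := Num.max u (r - d1 / 2).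
  have uq : u <= q by rewrite le_max lexx.
  have qr : q < r by rewrite gt_max ultr/=; lra.
  have qr1 : r - d1 / 2 <= q by rewrite le_max lexx orbT.
  have := d1P q; rewrite ltr_norml => /(_ _)/ltr_normlP[|]; first by apply/andP; split; lra.
  suff : f u <= f q by lra.
  apply: sub => //; first by lra.
  move=> p /andP[up pq]; apply: dP; first by rewrite lt_eqF//; lra.
  by rewrite ltr_norml; apply/andP; split; lra.
rewrite leNgt; apply/negP => fru.
have ultr : r < v by rewrite lt_neqAle rv andbT; apply: contraTneq fru => ->; rewrite ltxx.
have [d1 d10 d1P] := cfr _ (eq_ind_r is_true fru (subr_gt0 (f v) (f r))).
pose q := Num.min v (r + d1 / 2).
have uq : q <= v by rewrite ge_min lexx.
have qr : r < q by rewrite lt_min ultr/=; lra.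
have qr1 : q <= r + d1 / 2 by rewrite ge_min lexx orbT.
have := d1P q; rewrite ltr_norml => /(_ _)/ltr_normlP[|]; first by apply/andP; split; lra.
suff : f q <= f v by lra.
apply: sub => //; first by lra.
move=> p /andP[up pq]; apply: dP; first by rewrite gt_eqF//; lra.
by rewrite ltr_norml; apply/andP; split; lra.
Qed.

Lemma ae_growth {R : realType} (bad : R -> Prop) (f : R -> R) (s t m : R) : s <= t ->
  isolated bad -> AC_off bad s t f ->
  (forall r, s <= r <= t -> {for r, continuous f}) ->
  {ae (@lebesgue_measure R), forall r, s < r < t ->
     exists df, is_derive r 1 f df /\ m <= df} ->
  m * (t - s) <= f t - f s.
Proof.
move=> st bad0 acf cf aef.
suff : f s - m * s <= f t - m * t by lra.
apply: (@ae_mono R bad (fun r => f r - m * r) s t) => //.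
- move=> u v su vt nb; apply: AC_D; first exact: acf.
  by apply: AC_N; apply: AC_M; [exact: AC_cst|exact: AC_id].
- move=> r sr; apply: cvgB; first exact: cf.
  by apply: cvgM; [exact: cvg_cst|exact: cvg_id].
- apply: ae_imp aef => r rP /rP[df [fdf mdf]]; exists (df - m); split.
    by apply: is_derive_eq; rewrite /GRing.scale/=; ring.
  by rewrite subr_ge0.
Qed.

Lemma ae_cst {R : realType} (bad : R -> Prop) (f : R -> R) (s t : R) : s <= t ->
  isolated bad -> AC_off bad s t f ->
  (forall r, s <= r <= t -> {for r, continuous f}) ->
  {ae (@lebesgue_measure R), forall r, s < r < t -> is_derive r 1 f 0} ->
  f t = f s.
Proof.
move=> st bad0 acf cf aef; apply/eqP; rewrite eq_le; apply/andP; split; last first.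
  apply: ae_mono acf cf _ => //.
  by apply: ae_imp aef => r rP /rP fdf; exists 0.
rewrite -lerN2; apply: (@ae_mono R bad (fun r => - f r) s t) => //.
- by move=> u v su vt nb; apply: AC_N; exact: acf.
- by move=> r sr; apply: cvgN; exact: cf.
- apply: ae_imp aef => r rP /rP fdf; exists 0; split => //.
  by rewrite -oppr0; exact: is_deriveN.
Qed.

(** As [Z] is open in time, the infimum of the exit times is itself an exit time, and it is positive
    because [Z] holds at [t0]. *)
Lemma first_exit {R : realType} (Z : R -> Prop) (t0 t1 : R) : t0 <= t1 ->
  (forall t, Z t -> \forall r \near t, Z r) -> Z t0 -> ~ Z t1 ->
  exists2 s : R, 0 < s & (forall r, 0 <= r < s -> Z (t0 + r)) /\ ~ Z (t0 + s).
Proof.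
move=> t01 oZ Z0 nZ1.
pose A := [set r : R | 0 <= r /\ ~ Z (t0 + r)].
have A1 : A (t1 - t0) by split; rewrite ?subr_ge0// subrKC.
have hA : has_inf A by split; [exists (t1 - t0) | exists 0 => x []].
have lbA : lbound A (inf A) by apply: inf_lbound; exact: hA.2.
have inf0 : 0 <= inf A by apply: lb_le_inf; [exact: hA.1 | move=> x []].
have ltZ r : 0 <= r < inf A -> Z (t0 + r).
  move=> /andP[r0 rA]; apply: contrapT => nZ.
  by have /lbA : A r by []; rewrite leNgt rA.
have nZ : ~ Z (t0 + inf A).
  move=> /oZ/near_nbhs[d d0 dP].
  have [a [a0 nZa] aA] := inf_adherent d0 hA.
  have /lbA ia : A a by split.
  apply: nZa; apply: dP.
  by rewrite ltr_norml; apply/andP; split; lra.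
exists (inf A); last by split.
rewrite lt_neqAle inf0 andbT; apply/negP => /eqP e; by move: nZ; rewrite -e addr0.
Qed.

(** * Derivatives and continuity of real functions *)

Section Pointwise.
Context {R : realType}.
Implicit Types (f g : R -> R) (t : R).

Definition has_deriv f t (df : R) : Prop := is_derive t 1 f df.

Lemma has_derivD f g t df dg : has_deriv f t df -> has_deriv g t dg ->
  has_deriv (fun r => f r + g r) t (df + dg).
Proof. exact: is_deriveD. Qed.

Lemma has_derivN f t df : has_deriv f t df -> has_deriv (fun r => - f r) t (- df).
Proof. exact: is_deriveN. Qed.

Lemma has_derivM f g t df dg : has_deriv f t df -> has_deriv g t dg ->
  has_deriv (fun r => f r * g r) t (f t * dg + g t * df).
Proof. exact: is_deriveM. Qed.

Lemma has_deriv_cst (c t : R) : has_deriv (fun=> c) t 0.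
Proof. exact: is_derive_cst. Qed.

Lemma has_deriv_id t : has_deriv (fun r : R => r) t 1.
Proof. exact: is_derive_id. Qed.

Lemma has_derivV f t df : f t != 0 -> has_deriv f t df ->
  has_deriv (fun r => (f r)^-1) t (- (f t) ^- 2 * df).
Proof. by move=> ft fdf; exact: (is_deriveV (f := f)). Qed.

Lemma has_deriv_comp f g t df dg : has_deriv f (g t) df -> has_deriv g t dg ->
  has_deriv (fun r => f (g r)) t (df * dg).
Proof. by rewrite /has_deriv => *; exact: (is_derive1_comp (f := f) (g := g)). Qed.

Lemma has_deriv_expR g t dg : has_deriv g t dg ->
  has_deriv (fun r => expR (g r)) t (expR (g t) * dg).
Proof. by move=> ?; apply: has_deriv_comp => //; exact: is_derive_expR. Qed.

Lemma has_deriv_cos g t dg : has_deriv g t dg ->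
  has_deriv (fun r => cos (g r)) t (- sin (g t) * dg).
Proof. by move=> ?; apply: has_deriv_comp => //; exact: is_derive_cos. Qed.

Lemma has_deriv_sin g t dg : has_deriv g t dg ->
  has_deriv (fun r => sin (g r)) t (cos (g t) * dg).
Proof. by move=> ?; apply: has_deriv_comp => //; exact: is_derive_sin. Qed.

Lemma has_deriv_sqrt g t dg : 0 < g t -> has_deriv g t dg ->
  has_deriv (fun r => Num.sqrt (g r)) t ((2 * Num.sqrt (g t))^-1 * dg).
Proof. by move=> ? ?; apply: has_deriv_comp => //; exact: is_derive1_sqrt. Qed.

Lemma has_deriv_eq f t df dg : has_deriv f t df -> df = dg -> has_deriv f t dg.
Proof. by move=> ? <-. Qed.

Lemma has_deriv_continuous f t df : has_deriv f t df -> {for t, continuous f}.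
Proof. by move=> [+ _] => /derivable1_diffP/differentiable_continuous. Qed.

Lemma continuous_atD {T : topologicalType} (f g : T -> R) (t : T) :
  {for t, continuous f} -> {for t, continuous g} ->
  {for t, continuous (fun r => f r + g r)}.
Proof. exact: cvgD. Qed.

Lemma continuous_atN {T : topologicalType} (f : T -> R) (t : T) :
  {for t, continuous f} -> {for t, continuous (fun r => - f r)}.
Proof. exact: cvgN. Qed.

Lemma continuous_atM {T : topologicalType} (f g : T -> R) (t : T) :
  {for t, continuous f} -> {for t, continuous g} ->
  {for t, continuous (fun r => f r * g r)}.
Proof. exact: cvgM. Qed.

Lemma continuous_at_cst {T : topologicalType} (c : R) (t : T) : {for t, continuous (fun=> c)}.
Proof. exact: cvg_cst. Qed.

Lemma continuous_at_id t : {for t, continuous (fun r : R => r)}.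
Proof. exact: cvg_id. Qed.

Lemma continuous_atV {T : topologicalType} (f : T -> R) (t : T) :
  f t != 0 -> {for t, continuous f} -> {for t, continuous (fun r => (f r)^-1)}.
Proof. by move=> ? ?; exact: cvgV. Qed.

Lemma continuous_bounded f (s t : R) : (forall r, s <= r <= t -> {for r, continuous f}) -> s <= t ->
  exists M, forall r, s <= r <= t -> `|f r| <= M.
Proof.
move=> cf st.
apply: (@cousin_ind R (fun T => exists M, forall r, s <= r <= T -> `|f r| <= M) s t) => //.
  exists `|f s| => r /andP[sr rs].
  by have -> : r = s by apply/eqP; rewrite eq_le rs sr.
move=> r /cf cfr.
have : \forall q \near r, `|f r - f q| < 1 by have /cvgrPdist_lt/(_ 1 ltr01) := cfr.
move=> /near_nbhs[d d0 dP]; exists d => // u v su ur rv vt du dv [M HM].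
exists (Num.max M (`|f r| + 1)) => q /andP[sq qv]; rewrite le_max; case: (leP q u) => qu.
  by rewrite HM// sq.
apply/orP; right.
have /ltW : `|f r - f q| < 1 by apply: dP; rewrite ltr_norml; apply/andP; split; lra.
have : `|f q| <= `|f r| + `|f r - f q|.
  by rewrite distrC -{1}[f q](subrKC (f r)) ler_normD.
lra.
Qed.

Lemma C1_lip f f' (s t : R) : (forall r : R, has_deriv f r (f' r)) ->
  (forall r, {for r, continuous f'}) -> s <= t ->
  exists2 L, 0 <= L & forall u v, s <= u -> u <= v -> v <= t -> `|f v - f u| <= L * (v - u).
Proof.
move=> ff' cf' st; have [M MP] := continuous_bounded _ _ _ (fun r _ => cf' r) st.
exists M; first by apply: le_trans (MP s _); rewrite ?normr_ge0// lexx.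
move=> u v su uv vt.
have df q : q \in `]u, v[%R -> is_derive q 1 f (f' q) by move=> _; exact: ff'.
have cf : {within `[u, v], continuous f}.
  by apply: continuous_subspaceT => q; exact: has_deriv_continuous (ff' q).
have [c cuv ->] := MVT_segment uv df cf.
rewrite normrM [X in _ * X]ger0_norm ?subr_ge0// ler_wpM2r ?subr_ge0//.
move: cuv; rewrite in_itv/= => /andP[uc cv].
by apply: MP; rewrite (le_trans su)// (le_trans cv).
Qed.

Lemma C1_AC f f' (s t : R) : (forall r : R, has_deriv f r (f' r)) ->
  (forall r, {for r, continuous f'}) -> absolutely_continuous s t f.
Proof.
move=> ff' cf'; case: (leP s t) => [st|ts].
  have [L L0 fL] := C1_lip _ _ _ _ ff' cf' st.
  exact: (@AC_lip R f s t L).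
apply: (@AC_lip R f s t 0) => u v su uv vt.
by have := le_lt_trans (le_trans su (le_trans uv vt)) ts; rewrite ltxx.
Qed.

End Pointwise.

(** The three tactics decompose a formula by its outermost operation. They leave to the caller the
    side conditions, such as nonvanishing denominators, and the pieces for which no rule applies. *)
Ltac der := first
 [ eassumption | apply: has_deriv_cst | apply: has_deriv_id | apply: has_derivD; der | apply: has_derivN; der
 | apply: has_derivV; [idtac | der] | apply: has_deriv_expR; der | apply: has_deriv_cos; der | apply: has_deriv_sin; der
 | apply: has_deriv_sqrt; [idtac | der] | apply: has_derivM; der | idtac ].

Ltac conti := lazymatch goal with |- {for _, continuous ?f} => first
  [ match f with (fun r => ?c) => exact (continuous_at_cst c _) end
  | lazymatch f with
    | (fun r => @?A r + @?B r) => apply: (continuous_atD A B); conti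
    | (fun r => @?A r * @?B r) => apply: (continuous_atM A B); conti
    | (fun r => - @?A r) => apply: (continuous_atN A); conti
    | (fun r => (@?A r)^-1) => apply: (continuous_atV A); [idtac | conti]
    | (fun r => r) => apply: continuous_at_id
    | _ => first [assumption | idtac] end ] end.

Ltac acs := first
 [ eassumption | apply: AC_cst | apply: AC_id | apply: AC_D; acs | apply: AC_N; acs
 | apply: AC_V; [acs | idtac] | apply: AC_M; acs | idtac ].

(** * The system in the z-plane *)

(* Filippov's field in the coordinate z = x + i y.  The outer fields are linear
   foci at - (1 + i x1) / 2 and (1 + i x0) / 2, the middle one is - 4 i z^3. *)
Definition zfil {R : realType} (a b c d x0 x1 x y vx vy : R) :=
  exists k1 k2 k3 : R,
  [/\ [/\ 0 <= k1, 0 <= k2 & 0 <= k3], k1 + k2 + k3 = 1,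
   [/\ k1 != 0 -> x <= - (1/2), k2 != 0 -> - (1/2) <= x <= 1/2 & k3 != 0 -> 1/2 <= x],
   vx = k1 * (a * (x + 1/2) - b * (y + x1/2)) + k2 * (4 * y * (3 * x * x - y * y))
        + k3 * (c * (x - 1/2) - d * (y - x0/2))
   & vy = k1 * (b * (x + 1/2) + a * (y + x1/2)) + k2 * (4 * x * (3 * y * y - x * x))
        + k3 * (d * (x - 1/2) + c * (y - x0/2))].

(* [bad] holds at the times when the curve is at infinity in the w-plane. *)
Definition ztraj {R : realType} (a b c d x0 x1 : R) (bad : R -> Prop) (x y : R -> R) :=
  [/\ continuous x, continuous y, isolated bad,
      (forall s t, AC_off bad s t x /\ AC_off bad s t y)
    & {ae (@lebesgue_measure R), forall t, exists vx vy : R,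
        [/\ zfil a b c d x0 x1 (x t) (y t) vx vy, has_deriv x t vx & has_deriv y t vy]}].

(* The plane system is invariant under z -> -z, exchanging its two outer fields. *)
Lemma ztrajN {R : realType} (a b c d x0 x1 : R) bad x y :
  ztraj a b c d x0 x1 bad x y ->
  ztraj c d a b x1 x0 bad (fun t => - x t) (fun t => - y t).
Proof.
move=> [cx cy isb acxy aexy]; split => //.
- by move=> t; apply: continuous_atN; exact: cx.
- by move=> t; apply: continuous_atN; exact: cy.
- move=> s t; have [acx acy] := acxy s t.
  by split=> u v su vt nb; apply: AC_N; [exact: acx|exact: acy].
- apply: ae_imp aexy => t [vx [vy [[k1 [k2 [k3 [[k10 k20 k30] k1s [i1 i2 i3] vxE vyE]]]] dx dy]]].
  exists (- vx), (- vy); split; [|exact: has_derivN|exact: has_derivN].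
  exists k3, k2, k1; split.
  + by [].
  + by rewrite -k1s; ring.
  + by split => [/i3|/i2|/i1]; lra.
  + by rewrite vxE; ring.
  + by rewrite vyE; ring.
Qed.

Lemma ztraj_left {R : realType} (a b c d x0 x1 : R) bad x y (s t : R) :
  ztraj a b c d x0 x1 bad x y -> s <= t -> (forall r, s < r < t -> x r < - (1/2)) ->
  let u := x s + 1/2 in let v := y s + x1/2 in
  x t = - (1/2) + expR (a * (t - s)) * (u * cos (b * (t - s)) - v * sin (b * (t - s))) /\
  y t = - (x1/2) + expR (a * (t - s)) * (u * sin (b * (t - s)) + v * cos (b * (t - s))).
Proof.
move=> [cx cy isb acxy aexy] st xlt u v.
have dlin (k r : R) : has_deriv (fun r => k * (r - s)) r k.
  by apply: has_deriv_eq; [der|cbn beta; ring].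
have ce (k r : R) : {for r, continuous (fun r => expR (k * (r - s)))}.
  by apply: has_deriv_continuous; apply: has_deriv_expR; exact: dlin.
have cc (k r : R) : {for r, continuous (fun r => cos (k * (r - s)))}.
  by apply: has_deriv_continuous; apply: has_deriv_cos; exact: dlin.
have cs (k r : R) : {for r, continuous (fun r => sin (k * (r - s)))}.
  by apply: has_deriv_continuous; apply: has_deriv_sin; exact: dlin.
have ace (k p q : R) : absolutely_continuous p q (fun r => expR (k * (r - s))).
  by apply: C1_AC => r; [apply: has_deriv_expR; exact: dlin | apply: continuous_atM; [exact: ce|conti]].
have acc (k p q : R) : absolutely_continuous p q (fun r => cos (k * (r - s))).
  apply: C1_AC => r; [apply: has_deriv_cos; exact: dlin | apply: continuous_atM; [|conti]].
  by apply: continuous_atN; exact: cs.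
have acs' (k p q : R) : absolutely_continuous p q (fun r => sin (k * (r - s))).
  by apply: C1_AC => r; [apply: has_deriv_sin; exact: dlin | apply: continuous_atM; [exact: cc|conti]].
(* [f1 + i f2] is the displacement from the focus times [exp(- (a + i b) (r - s))]. It is constant
   because the displacement solves a linear equation with coefficient [a + i b] here; undoing the
   factor at time [t] gives the two formulas. *)
pose f1 r := expR (- a * (r - s)) *
  ((x r + 1/2) * cos (b * (r - s)) + (y r + x1/2) * sin (b * (r - s))).
pose f2 r := expR (- a * (r - s)) *
  (- ((x r + 1/2) * sin (b * (r - s))) + (y r + x1/2) * cos (b * (r - s))).
have aeF : {ae (@lebesgue_measure R), forall r, s < r < t ->
   has_deriv x r (a * (x r + 1/2) - b * (y r + x1/2)) /\
   has_deriv y r (b * (x r + 1/2) + a * (y r + x1/2))}.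
  apply: ae_imp aexy => r [vx [vy [[k1 [k2 [k3 [_ k1s [i1 i2 i3] vxE vyE]]]] dx dy]]] /xlt xr.
  have k20 : k2 = 0 by apply/eqP; apply: contraT => /i2; lra.
  have k30 : k3 = 0 by apply/eqP; apply: contraT => /i3; lra.
  have k11 : k1 = 1 by lra.
  by split; [apply: has_deriv_eq dx _; rewrite vxE|apply: has_deriv_eq dy _; rewrite vyE]; rewrite k11 k20 k30; ring.
have f1c : f1 t = f1 s.
  apply: (ae_cst bad) => //.
  - move=> p q sp qt nb; have [acx acy] := acxy s t; rewrite /f1.
    have acx' := acx p q sp qt nb; have acy' := acy p q sp qt nb.
    by acs; [exact: ace|exact: acc|exact: acs'].
  - move=> r _; have cxr := cx r; have cyr := cy r; rewrite /f1.
    by conti; [exact: ce|exact: cc|exact: cs].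
  - apply: ae_imp aeF => r H /H[dx dy]; rewrite /f1.
    apply: has_deriv_eq; first by der.
    by cbn beta; ring.
have f2c : f2 t = f2 s.
  apply: (ae_cst bad) => //.
  - move=> p q sp qt nb; have [acx acy] := acxy s t; rewrite /f2.
    have acx' := acx p q sp qt nb; have acy' := acy p q sp qt nb.
    by acs; [exact: ace|exact: acs'|exact: acc].
  - move=> r _; have cxr := cx r; have cyr := cy r; rewrite /f2.
    by conti; [exact: ce|exact: cs|exact: cc].
  - apply: ae_imp aeF => r H /H[dx dy]; rewrite /f2.
    apply: has_deriv_eq; first by der.
    by cbn beta; ring.
have f1s : f1 s = u by rewrite /f1 /u subrr !mulr0 expR0 cos0 sin0; ring.
have f2s : f2 s = v by rewrite /f2 /v subrr !mulr0 expR0 cos0 sin0; ring.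
rewrite -f1s -f2s -f1c -f2c /f1 /f2.
set C := cos _; set S := sin _.
have CS : C * C + S * S = 1 by rewrite -!expr2 cos2Dsin2.
have EE : expR (a * (t - s)) * expR (- a * (t - s)) = 1 by rewrite -expRD mulNr subrr expR0.
set E := expR _ in EE *; set E' := expR _ in EE *.
split.
- transitivity (- (1/2) + (E * E') * (C * C + S * S) * (x t + 1/2)); last by ring.
  by rewrite EE CS; ring.
- transitivity (- (x1/2) + (E * E') * (C * C + S * S) * (y t + x1/2)); last by ring.
  by rewrite EE CS; ring.
Qed.

(* 1 / z^2 = Pz + i Qz; along z' = - 4 i z^3 it moves with constant velocity 8 i. *)
Definition Pz {R : realType} (x y : R) := (x * x - y * y) * ((x * x + y * y) * (x * x + y * y))^-1.
Definition Qz {R : realType} (x y : R) := - (2 * x * y) * ((x * x + y * y) * (x * x + y * y))^-1.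

(* The root z = mid_x + i mid_y of 1 / z^2 = P + i Q in the lower half-plane. *)
Definition mid_b {R : realType} (P Q : R) := Num.sqrt ((Num.sqrt (P * P + Q * Q) - P) * 2^-1).
Definition mid_x {R : realType} (P Q : R) := Q * (2 * mid_b P Q * Num.sqrt (P * P + Q * Q))^-1.
Definition mid_y {R : realType} (P Q : R) := - (mid_b P Q * (Num.sqrt (P * P + Q * Q))^-1).

Lemma sumsq_gt0 {R : realType} (x y : R) : y != 0 -> 0 < x * x + y * y.
Proof. by move=> y0; rewrite ltr_wpDl// -expr2 ?sqr_ge0// exprn_even_gt0. Qed.

(** [mid_b] recovers the imaginary part of [1 / z], whose square is
    [(|1 / z^2| - Re (1 / z^2)) / 2]. The nonnegative root is the right one because [y] is
    negative. *)
Lemma mid_inv {R : realType} (x y : R) : y < 0 ->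
  x = mid_x (Pz x y) (Qz x y) /\ y = mid_y (Pz x y) (Qz x y).
Proof.
move=> y0; have yn0 : y != 0 by rewrite lt_eqF.
have N0 := sumsq_gt0 x y yn0; have Nn0 : x * x + y * y != 0 by rewrite gt_eqF.
have ME : Num.sqrt (Pz x y * Pz x y + Qz x y * Qz x y) = (x * x + y * y)^-1.
  rewrite [X in Num.sqrt X](_ : _ = (x * x + y * y)^-1 ^+ 2).
    by rewrite sqrtr_sqr ger0_norm// invr_ge0 ltW.
  by rewrite /Pz /Qz; field.
have BE : mid_b (Pz x y) (Qz x y) = - y / (x * x + y * y).
  rewrite /mid_b ME [X in Num.sqrt X](_ : _ = (- y / (x * x + y * y)) ^+ 2).
    by rewrite sqrtr_sqr ger0_norm// divr_ge0 ?ltW// oppr_gt0.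
  by rewrite /Pz; field.
by rewrite /mid_x /mid_y BE ME /Qz; split; field; rewrite ?Nn0 ?yn0.
Qed.

(** The derivative of [1 / z^2] is [- 2 z' / z^3], that is [8 i] for the middle field. Negative [y]
    keeps the orbit away from [z = 0]. *)
Lemma ztraj_mid {R : realType} (a b c d x0 x1 : R) bad x y (s t : R) :
  ztraj a b c d x0 x1 bad x y -> s <= t -> (forall r, s < r < t -> - (1/2) < x r < 1/2) ->
  (forall r, s <= r <= t -> y r < 0) ->
  Pz (x t) (y t) = Pz (x s) (y s) /\ Qz (x t) (y t) = Qz (x s) (y s) + 8 * (t - s).
Proof.
move=> [cx cy isb acxy aexy] st xlt y0.
have N0 r : s <= r <= t -> (x r * x r + y r * y r) * (x r * x r + y r * y r) != 0.
  by move=> /y0 yr; rewrite mulf_neq0// gt_eqF// sumsq_gt0// lt_eqF.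
have aeF : {ae (@lebesgue_measure R), forall r, s < r < t ->
   has_deriv x r (4 * y r * (3 * x r * x r - y r * y r)) /\
   has_deriv y r (4 * x r * (3 * y r * y r - x r * x r)) }.
  apply: ae_imp aexy => r [vx [vy [[k1 [k2 [k3 [_ k1s [i1 i2 i3] vxE vyE]]]] dx dy]]] /xlt xr.
  have k20 : k1 = 0 by apply/eqP; apply: contraT => /i1; lra.
  have k30 : k3 = 0 by apply/eqP; apply: contraT => /i3; lra.
  have k11 : k2 = 1 by lra.
  by split; [apply: has_deriv_eq dx _; rewrite vxE|apply: has_deriv_eq dy _; rewrite vyE]; rewrite k11 k20 k30; ring.
split.
  apply: (ae_cst bad (fun r => Pz (x r) (y r))) => //; rewrite /Pz.
  - move=> p q sp qt nb; have [acx acy] := acxy s t.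
    have acx' := acx p q sp qt nb; have acy' := acy p q sp qt nb.
    acs => r /andP[pr rq]; apply: N0.
    by rewrite (le_trans sp)// (le_trans rq).
  - move=> r sr; have cxr := cx r; have cyr := cy r.
    by conti; exact: N0.
  - apply: ae_imp aeF => r H rst; have [dx dy] := H rst; have rst' : s <= r <= t by lra.
    apply: has_deriv_eq; first by der; exact: N0.
    cbn beta; field.
    by move: (N0 r rst'); rewrite mulf_eq0 negb_or => /andP[].
suff : Qz (x t) (y t) - 8 * t = Qz (x s) (y s) - 8 * s by lra.
apply: (ae_cst bad (fun r => Qz (x r) (y r) - 8 * r)) => //; rewrite /Qz.
- move=> p q sp qt nb; have [acx acy] := acxy s t.
  have acx' := acx p q sp qt nb; have acy' := acy p q sp qt nb.
  acs => r /andP[pr rq]; apply: N0.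
  by rewrite (le_trans sp)// (le_trans rq).
- move=> r sr; have cxr := cx r; have cyr := cy r.
  by conti; exact: N0.
- apply: ae_imp aeF => r H rst; have [dx dy] := H rst; have rst' : s <= r <= t by lra.
  apply: has_deriv_eq; first by der; exact: N0.
  cbn beta; field.
  by move: (N0 r rst'); rewrite mulf_eq0 negb_or => /andP[].
Qed.

(* The left focus carries (- 1/2, y) to (- 1/2, - next y) in time pi / b; the
   strip is then crossed at the same height by reversibility. *)
Definition next {R : realType} (a b x1 y : R) := x1/2 + expR (pi * a / b) * (y + x1/2).
(** Between the points of height [- y] on the two lines, [Qz] grows from [- y / N^2] to [y / N^2],
    where [N = 1/4 + y^2], at speed 8. *)
Definition midtime {R : realType} (y : R) := y / (4 * ((1/2) * (1/2) + y * y) ^+ 2).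
Definition halfT {R : realType} (a b x1 y : R) := pi / b + midtime (next a b x1 y).
Definition left_x {R : realType} (a b x1 y s : R) :=
  - (1/2) - (y + x1/2) * expR (a * s) * sin (b * s).
Definition left_y {R : realType} (a b x1 y s : R) :=
  - (x1/2) + (y + x1/2) * expR (a * s) * cos (b * s).
Definition cross_x {R : realType} (y s : R) :=
  mid_x (Pz (- (1/2)) (- y)) (Qz (- (1/2)) (- y) + 8 * s).
Definition cross_y {R : realType} (y s : R) :=
  mid_y (Pz (- (1/2)) (- y)) (Qz (- (1/2)) (- y) + 8 * s).

Definition half_x {R : realType} (a b x1 y s : R) :=
  if s <= pi / b then left_x a b x1 y s else cross_x (next a b x1 y) (s - pi / b).
Definition half_y {R : realType} (a b x1 y s : R) :=
  if s <= pi / b then left_y a b x1 y s else cross_y (next a b x1 y) (s - pi / b).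

Lemma midtime_gt0 {R : realType} (y : R) : 0 < y -> 0 < midtime y.
Proof.
move=> y0; rewrite /midtime divr_gt0// mulr_gt0// exprn_gt0//.
by apply: sumsq_gt0; rewrite gt_eqF.
Qed.

Lemma left_start {R : realType} (a b x1 y : R) : left_x a b x1 y 0 = - (1/2) /\ left_y a b x1 y 0 = y.
Proof. by rewrite /left_x /left_y !mulr0 sin0 cos0 expR0; split; ring. Qed.

Lemma left_end {R : realType} (a b x1 y : R) : 0 < b ->
  left_x a b x1 y (pi / b) = - (1/2) /\ left_y a b x1 y (pi / b) = - next a b x1 y.
Proof.
move=> b0; have bE : b * (pi / b) = pi by rewrite mulrC divfK// gt_eqF.
rewrite /left_x /left_y /next bE sinpi cospi.
have -> : a * (pi / b) = pi * a / b by rewrite mulrA (mulrC a).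
by split; ring.
Qed.

Lemma cross_start {R : realType} (y : R) : 0 < y -> cross_x y 0 = - (1/2) /\ cross_y y 0 = - y.
Proof.
move=> y0; rewrite /cross_x /cross_y mulr0 addr0.
by have [|<- <-] := mid_inv (- (1/2)) (- y); rewrite ?oppr_lt0.
Qed.

Lemma cross_end {R : realType} (y : R) : 0 < y ->
  cross_x y (midtime y) = 1/2 /\ cross_y y (midtime y) = - y.
Proof.
move=> y0; rewrite /cross_x /cross_y.
have := sumsq_gt0 (1/2) y; rewrite gt_eqF// => /(_ isT); set N := _ + _ => N0.
have Nn0 : N != 0 by rewrite gt_eqF.
have -> : Pz (- (1/2)) (- y) = Pz (1/2) (- y) by rewrite /Pz; congr (_ * _^-1); ring.
have -> : Qz (- (1/2)) (- y) + 8 * midtime y = Qz (1/2) (- y).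
  have e : (1/2) * (1/2) + (- y) * (- y) = N by rewrite /N; ring.
  have e' : (- (1/2)) * (- (1/2)) + (- y) * (- y) = N by rewrite /N; ring.
  by rewrite /Qz e e' /midtime -/N; field.
by have [|<- <-] := mid_inv (1/2) (- y); rewrite ?oppr_lt0.
Qed.

Lemma half_start {R : realType} (a b x1 y : R) : 0 < b ->
  half_x a b x1 y 0 = - (1/2) /\ half_y a b x1 y 0 = y.
Proof.
move=> b0; rewrite /half_x /half_y ifT ?divr_ge0 ?pi_ge0 ?ltW//.
exact: left_start.
Qed.

Lemma half_end {R : realType} (a b x1 y : R) : 0 < next a b x1 y ->
  half_x a b x1 y (halfT a b x1 y) = 1/2 /\ half_y a b x1 y (halfT a b x1 y) = - next a b x1 y.
Proof.
move=> n0; rewrite /half_x /half_y /halfT ifF; last first.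
  by apply/negbTE; rewrite -ltNge ltrDl midtime_gt0.
have -> : pi / b + midtime (next a b x1 y) - pi / b = midtime (next a b x1 y) by ring.
by rewrite ifF; [exact: cross_end| apply/negbTE; rewrite -ltNge ltrDl midtime_gt0].
Qed.

(** * Orbits avoiding the rectangle *)

(** All parts of the two lines where Filippov orbits could slide or split lie in this rectangle, and
    the two foci are opposite corners of it. *)
Definition avoids {R : realType} (x0 x1 : R) (x y : R -> R) :=
  forall t, ~ (- (1/2) <= x t <= 1/2 /\ - (x1/2) <= y t <= x0/2).

Lemma avoidsN {R : realType} (x0 x1 : R) (x y : R -> R) :
  avoids x0 x1 x y -> avoids x1 x0 (fun t => - x t) (fun t => - y t).
Proof. by move=> av t [xt yt]; apply: (av t); split; lra. Qed.

Lemma cvg_lt_near {R : realType} (f : R -> R) (t c : R) : {for t, continuous f} -> f t < c ->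
  \forall r \near t, f r < c.
Proof. by move=> cf fc; move/cvgrPdist_lt/(_ (c - f t)): cf; rewrite subr_gt0 => /(_ fc);
  apply: filterS => r /ltr_normlP[]; lra. Qed.

Lemma cvg_gt_near {R : realType} (f : R -> R) (t c : R) : {for t, continuous f} -> c < f t ->
  \forall r \near t, c < f r.
Proof.
move=> cf fc; have := cvg_lt_near (fun r => - f r) t (- c) (continuous_atN _ _ cf).
by rewrite ltrN2 => /(_ fc); apply: filterS => r; rewrite ltrN2.
Qed.

Lemma le_left_limit {R : realType} (f : R -> R) (s t c : R) : {for t, continuous f} -> s < t ->
  (forall r, s < r < t -> f r <= c) -> f t <= c.
Proof.
move=> cf st H; rewrite leNgt; apply/negP => /(cvg_gt_near _ _ _ cf)/near_nbhs[d d0 dP].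
pose q := Num.max ((s + t) / 2) (t - d / 2).
have q1 : (s + t) / 2 <= q by rewrite le_max lexx.
have q2 : t - d / 2 <= q by rewrite le_max lexx orbT.
have q3 : q < t by rewrite gt_max; apply/andP; split; lra.
have := dP q; rewrite ltr_norml => /(_ _); have := H q.
move=> A B; have : f q <= c by apply: A; lra.
by rewrite leNgt B//; lra.
Qed.

(* Points of the strip outside the excluded rectangle satisfy |y| > sqrt 3 |x|,
   where z' = - 4 i z^3 crosses the strip monotonically. *)
Lemma mid_speed {R : realType} (w x y : R) : 0 < w -> 3 < w * w ->
  - (1/2) <= x <= 1/2 -> y <= - (w / 2) ->
  2 * w * (w * w / 4 - 3 / 4) <= 4 * y * (3 * x * x - y * y).
Proof.
move=> w0 w3 /andP[x1 x2] yw.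
have X : x * x <= 1/4 by nra.
have Y : w * w / 4 <= y * y by nra.
have Z : w * w / 4 - 3 / 4 <= y * y - 3 * x * x by lra.
have -> : 4 * y * (3 * x * x - y * y) = (4 * - y) * (y * y - 3 * x * x) by ring.
by apply: ler_pM; lra.
Qed.

(** Near the left line a Filippov velocity mixes only the left and the middle field and inherits
    their common lower bound. The middle field is estimated only where its weight is nonzero, that
    is inside the closed strip. *)
Lemma convex_ge {R : realType} (k1 k2 k3 u v w m : R) :
  0 <= k1 -> 0 <= k2 -> k1 + k2 + k3 = 1 -> k3 = 0 ->
  m <= u -> (k2 != 0 -> m <= v) -> m <= k1 * u + k2 * v + k3 * w.
Proof.
move=> k10 k20 ks k30 mu mv.
have k1u : k1 * m <= k1 * u by apply: ler_wpM2l.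
have k2v : k2 * m <= k2 * v.
  by have [->|/mv] := eqVneq k2 0; [rewrite !mul0r|exact: ler_wpM2l].
have k12 : k1 + k2 = 1 by rewrite -ks k30 addr0.
by rewrite k30 mul0r addr0 -[m]mul1r -k12 mulrDl lerD.
Qed.

(** The factor [s] is used with values 1 and -1 to choose the side. Both fields push through the
    line at speed at least [m], hence so does every Filippov velocity; the displacement after time
    [r] is at least [m * r], and the orbit cannot linger on the line. *)
Lemma enter_line {R : realType} (a b c d x0 x1 : R) bad x y (t0 s m : R) : 0 < m ->
  ztraj a b c d x0 x1 bad x y -> x t0 = - (1/2) ->
  (\forall r \near t0, [/\ x r < 1/2, m <= s * (a * (x r + 1/2) - b * (y r + x1/2)) &
     - (1/2) <= x r <= 1/2 -> m <= s * (4 * y r * (3 * x r * x r - y r * y r))]) ->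
  exists2 e : R, 0 < e & forall r, 0 < r < e -> 0 < s * (x (t0 + r) + 1/2).
Proof.
move=> m0 [cx cy isb acxy aexy] xt /near_nbhs[e e0 H]; exists e => // r /andP[r0 re].
suff : m * (t0 + r - t0) <= s * x (t0 + r) - s * x t0.
  have -> : t0 + r - t0 = r by ring.
  by have := mulr_gt0 m0 r0; rewrite xt; clear; lra.
apply: (ae_growth bad (fun r => s * x r)) => //; first by rewrite lerDl ltW.
- move=> p q sp qt nb; apply: AC_M; first exact: AC_cst.
  by have [acx _] := acxy t0 (t0 + r); exact: acx.
- by move=> p _; apply: continuous_atM; [exact: continuous_at_cst|exact: cx].
apply: ae_imp aexy => p [vx [vy [[k1 [k2 [k3 [[k10 k20 k30] k1s [i1 i2 i3] vxE vyE]]]] dx dy]]].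
move=> /andP[p0 pr].
exists (s * vx); split; first by apply: has_deriv_eq (has_derivM _ _ _ _ _ (has_deriv_cst s p) dx) _; rewrite mulr0 addr0.
have [|xp FL FM] := H p.
  rewrite ger0_norm; first by apply: lt_trans re; rewrite ltrBlDl.
  by rewrite subr_ge0 ltW.
have k3e : k3 = 0 by apply/eqP; apply: contraT => /i3; rewrite leNgt xp.
rewrite vxE (mulrDr s) (mulrDr s) (mulrCA s k1) (mulrCA s k2) (mulrCA s k3); apply: convex_ge => // /i2; exact: FM.
Qed.

Lemma enter_left {R : realType} (a b c d x0 x1 : R) bad x y (t0 : R) :
  0 < b -> 0 < x0 -> 3 < x0 * x0 -> 0 < x1 ->
  ztraj a b c d x0 x1 bad x y -> x t0 = - (1/2) -> x0/2 < y t0 ->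
  exists2 e : R, 0 < e & forall r, 0 < r < e -> x (t0 + r) < - (1/2).
Proof.
move=> b0 x00 x03 x10 zt xt yt; have [cx cy _ _ _] := zt.
(* [m1] is half the speed of the left field on the line at height [x0 / 2]; [m2] is the bound of
   [mid_speed]. *)
pose m1 := b * (x0 + x1) / 4; pose m2 := 2 * x0 * (x0 * x0 / 4 - 3 / 4).
have m10 : 0 < m1 by rewrite /m1 divr_gt0// mulr_gt0// addr_gt0.
have m20 : 0 < m2 by rewrite /m2 mulr_gt0 ?mulr_gt0//; move: x03; clear; lra.
have m0 : 0 < Num.min m1 m2 by rewrite lt_min m10.
have xt2 : x t0 < 1/2 by rewrite xt; clear; lra.
have FLc : {for t0, continuous (fun r => - 1 * (a * (x r + 1/2) - b * (y r + x1/2)))}.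
  by have cxt := cx t0; have cyt := cy t0; conti.
have FL : m1 < - 1 * (a * (x t0 + 1/2) - b * (y t0 + x1/2)).
  have : 0 < b * (y t0 - x0 / 2) by rewrite mulr_gt0// subr_gt0.
  have : 0 < b * (x0 + x1) by rewrite mulr_gt0// addr_gt0.
  by rewrite xt /m1; clear; lra.
have := enter_line _ _ _ _ _ _ _ _ _ t0 (- 1) _ m0 zt xt.
case.
  apply: filterS3 (cvg_lt_near _ _ _ (cx t0) xt2) (cvg_gt_near _ _ _ FLc FL)
    (cvg_gt_near _ _ _ (cy t0) yt) => r xr FLr yr; split => //.
    by apply: le_trans (ltW FLr); rewrite ge_min lexx.
  (* [mid_speed] concerns points below the rectangle; above it, the point is first reflected through
     the origin. *)
  move=> xr1; have : m2 <= 4 * - y r * (3 * - x r * - x r - - y r * - y r).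
    by apply: mid_speed => //; move: xr1 yr; clear; lra.
  have : Num.min m1 m2 <= m2 by rewrite ge_min lexx orbT.
  by clear; lra.
by move=> e e0 H; exists e => // r /H; clear; lra.
Qed.

Lemma enter_mid {R : realType} (a b c d x0 x1 : R) bad x y (t0 : R) :
  0 < b -> 0 < x1 -> 3 < x1 * x1 ->
  ztraj a b c d x0 x1 bad x y -> x t0 = - (1/2) -> y t0 < - (x1/2) ->
  exists2 e : R, 0 < e & forall r, 0 < r < e ->
    - (1/2) < x (t0 + r) < 1/2 /\ y (t0 + r) < - (x1/2).
Proof.
move=> b0 x10 x13 zt xt yt; have [cx cy _ _ _] := zt.
pose m1 := b * (- (x1 / 2) - y t0) / 2; pose m2 := 2 * x1 * (x1 * x1 / 4 - 3 / 4).
have m10 : 0 < m1 by rewrite /m1 divr_gt0// mulr_gt0// subr_gt0.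
have m20 : 0 < m2 by rewrite /m2 mulr_gt0 ?mulr_gt0//; move: x13; clear; lra.
have m0 : 0 < Num.min m1 m2 by rewrite lt_min m10.
have xt2 : x t0 < 1/2 by rewrite xt; clear; lra.
have FLc : {for t0, continuous (fun r => 1 * (a * (x r + 1/2) - b * (y r + x1/2)))}.
  by have cxt := cx t0; have cyt := cy t0; conti.
have FL : m1 < 1 * (a * (x t0 + 1/2) - b * (y t0 + x1/2)).
  have : 0 < b * (- (x1 / 2) - y t0) by rewrite mulr_gt0// subr_gt0.
  by rewrite xt /m1; clear; lra.
have nx := cvg_lt_near _ _ _ (cx t0) xt2; have ny := cvg_lt_near _ _ _ (cy t0) yt.
have := enter_line _ _ _ _ _ _ _ _ _ t0 1 _ m0 zt xt.
case.
  apply: filterS3 nx (cvg_gt_near _ _ _ FLc FL) ny => r xr FLr yr; split => //.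
    by apply: le_trans (ltW FLr); rewrite ge_min lexx.
  move=> xr1; have : m2 <= 4 * y r * (3 * x r * x r - y r * y r).
    by apply: mid_speed => //; exact: ltW.
  have : Num.min m1 m2 <= m2 by rewrite ge_min lexx orbT.
  by clear; lra.
move=> e e0 H; have /near_nbhs[e1 e10 H1] := nx; have /near_nbhs[e2 e20 H2] := ny.
exists (Num.min e (Num.min e1 e2)); first by rewrite !lt_min e0 e10.
move=> r; rewrite !lt_min => /andP[r0 /andP[re /andP[r1 r2]]].
have rE : `|t0 + r - t0| = r by rewrite (addrC t0) addrK ger0_norm// ltW.
have := H r; rewrite r0 re H1 ?rE// H2 ?rE// => /(_ isT).
by split => //; lra.
Qed.

Lemma mid_incr {R : realType} (a b c d x0 x1 : R) bad x y (s t : R) :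
  0 < x1 -> 3 < x1 * x1 -> ztraj a b c d x0 x1 bad x y -> s < t ->
  (forall r, s < r < t -> - (1/2) < x r < 1/2 /\ y r < - (x1/2)) -> x s < x t.
Proof.
move=> x10 x13 [cx cy isb acxy aexy] st H.
pose m := 2 * x1 * (x1 * x1 / 4 - 3 / 4).
have m0 : 0 < m by rewrite mulr_gt0//; lra.
suff : m * (t - s) <= x t - x s.
  by have : 0 < m * (t - s) by [rewrite mulr_gt0// subr_gt0]; lra.
apply: (ae_growth bad x) => //; first exact: ltW.
- by have [acx _] := acxy s t.
- by move=> p _; exact: cx.
apply: ae_imp aexy => r [vx [vy [[k1 [k2 [k3 [_ k1s [i1 i2 i3] vxE vyE]]]] dx dy]]] /H[xr yr].
exists vx; split => //.
have k20 : k1 = 0 by apply/eqP; apply: contraT => /i1; lra.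
have k30 : k3 = 0 by apply/eqP; apply: contraT => /i3; lra.
have k11 : k2 = 1 by lra.
have : m <= 4 * y r * (3 * x r * x r - y r * y r) by apply: mid_speed => //; lra.
by rewrite vxE k20 k30 k11; lra.
Qed.

(** In the applications [t0] is a time on the boundary of the zone, where [Z] fails, so [first_exit]
    is started at [t0 + e / 2]. The bound [L] on the stay guarantees that an exit occurs. *)
Lemma cross_exit {R : realType} (Z : R -> Prop) (t0 e L : R) : 0 < e ->
  (forall t, Z t -> \forall r \near t, Z r) -> (forall r, 0 < r < e -> Z (t0 + r)) ->
  0 < L -> ~ (forall r, 0 < r < L -> Z (t0 + r)) ->
  exists2 s : R, 0 < s & (forall r, 0 < r < s -> Z (t0 + r)) /\ ~ Z (t0 + s).
Proof.
move=> e0 oZ Ze L0 nZ.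
have [r [rL nZr]] : exists r, 0 < r < L /\ ~ Z (t0 + r).
  apply: contrapT => H; apply: nZ => r rL; apply: contrapT => nz; apply: H.
  by exists r.
have er : e <= r by rewrite leNgt; apply/negP => re; apply: nZr; apply: Ze; lra.
have [||s s0 [sZ nsZ]] := @first_exit R Z (t0 + e / 2) (t0 + r) _ oZ _ nZr; first by lra.
  by apply: Ze; lra.
exists (e / 2 + s); first by lra.
split; last by rewrite addrA.
move=> q qs; case: (ltP q e) => qe; first by apply: Ze; lra.
have -> : t0 + q = t0 + e / 2 + (q - e / 2) by lra.
by apply: sZ; lra.
Qed.

Lemma open_lt {R : realType} (x : R -> R) (c : R) : continuous x ->
  forall t, x t < c -> \forall r \near t, x r < c.
Proof. by move=> cx t; exact: (cvg_lt_near _ _ _ (cx t)). Qed.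

Lemma exit_left {R : realType} (a b c d x0 x1 : R) bad x y (t0 e : R) :
  0 < b -> ztraj a b c d x0 x1 bad x y ->
  0 < e -> (forall r, 0 < r < e -> x (t0 + r) < - (1/2)) ->
  exists2 s : R, 0 < s & (forall r, 0 < r < s -> x (t0 + r) < - (1/2)) /\ x (t0 + s) = - (1/2).
Proof.
move=> b0 zt e0 Ze.
have pb : 0 < pi / b by rewrite divr_gt0// pi_gt0.
have [cx _ _ _ _] := zt.
have L0 : 0 < pi / b + e by rewrite addr_gt0.
(* In a time [pi / b] the displacement from the focus is multiplied by a negative number, so
   [x + 1/2] changes sign. Starting at [t0 + e / 2] keeps the half turn inside the open time
   interval. *)
have nst : ~ (forall r, 0 < r < pi / b + e -> x (t0 + r) < - (1/2)).
  move=> H; pose t1 := t0 + e / 2.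
  have st : t1 <= t1 + pi / b by rewrite lerDl ltW.
  have Z1 r : t1 <= r <= t1 + pi / b -> x r < - (1/2).
    by rewrite /t1 => rr; have -> : r = t0 + (r - t0) by [ring]; apply: H; lra.
  have Z2 r : t1 < r < t1 + pi / b -> x r < - (1/2) by move=> rr; apply: Z1; lra.
  have [E _] := ztraj_left _ _ _ _ _ _ _ _ _ _ _ zt st Z2.
  have bE : b * (t1 + pi / b - t1) = pi by field; rewrite gt_eqF.
  rewrite bE sinpi cospi in E.
  have A : x t1 < - (1/2) by apply: Z1; lra.
  have : x (t1 + pi / b) < - (1/2) by apply: Z1; lra.
  rewrite E; set E' := expR _; have : 0 < E' by exact: expR_gt0.
  nra.
have [s s0 [sZ /negP]] := cross_exit (fun t => x t < - (1/2)) t0 e _ e0 (open_lt _ _ cx) Ze L0 nst.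
rewrite -leNgt => xs.
exists s => //; split => //; apply/eqP; rewrite eq_le xs andbT.
apply: (@le_left_limit R x t0 (t0 + s)) => //; [exact: cx|lra|].
by move=> r rr; apply: ltW; have -> : r = t0 + (r - t0) by [ring]; apply: sZ; lra.
Qed.

Lemma exit_mid {R : realType} (a b c d x0 x1 : R) bad x y (t0 e : R) :
  0 < x1 -> 3 < x1 * x1 -> 0 < x0 -> ztraj a b c d x0 x1 bad x y -> avoids x0 x1 x y ->
  0 < e -> (forall r, 0 < r < e -> - (1/2) < x (t0 + r) < 1/2 /\ y (t0 + r) < - (x1/2)) ->
  exists2 s : R, 0 < s &
    (forall r, 0 < r < s -> - (1/2) < x (t0 + r) < 1/2 /\ y (t0 + r) < - (x1/2)) /\
    x (t0 + s) = 1/2 /\ y (t0 + s) < - (x1/2).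
Proof.
move=> x10 x13 x00 zt av e0 Ze.
have [cx cy _ _ _] := zt.
have e10 : 0 < e + 1 by lra.
pose Z t := - (1/2) < x t < 1/2 /\ y t < - (x1/2).
have oZ t : Z t -> \forall r \near t, Z r.
  move=> [/andP[xt1 xt2] yt].
  have A := cvg_gt_near _ _ _ (cx t) xt1; have B := cvg_lt_near _ _ _ (cx t) xt2.
  have C := cvg_lt_near _ _ _ (cy t) yt.
  by apply: filterS3 A B C => r xr1 xr2 yr; split => //; rewrite xr1 xr2.
(* In [Z] one has [|Qz| <= 1 / |z|^2 < 4/3], whereas [Qz] would gain 4 in a time 1/2. *)
have nst : ~ (forall r, 0 < r < e + 1 -> Z (t0 + r)).
  move=> H; pose t1 := t0 + e / 2.
  have Ht r : t1 <= r <= t1 + 1/2 -> - (1/2) < x r < 1/2 /\ y r < - (x1/2).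
    by rewrite /t1 => rr; have -> : r = t0 + (r - t0) by [ring]; apply: H; lra.
  have bQ r : t1 <= r <= t1 + 1/2 -> - (4/3) < Qz (x r) (y r) < 4/3.
    move=> /Ht[xr yr]; rewrite /Qz; set N := _ + _.
    have yy : 3/4 < y r * y r by nra.
    have xx : 0 <= x r * x r by rewrite -expr2 sqr_ge0.
    have N1 : 3/4 < N by rewrite /N; lra.
    have : 0 <= (x r + y r) * (x r + y r) by rewrite -expr2 sqr_ge0.
    have : 0 <= (x r - y r) * (x r - y r) by rewrite -expr2 sqr_ge0.
    move=> xy1 xy2; have N0 : 0 < N * N by rewrite mulr_gt0//; lra.
    have NN : N < 4/3 * (N * N) by nra.
    rewrite ltr_pdivlMr// ltr_pdivrMr// mulNr ltrN2.
    by rewrite /N in xy1 xy2 NN *; apply/andP; split; lra.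
  have st : t1 <= t1 + 1/2 by lra.
  have H1 r : t1 < r < t1 + 1/2 -> - (1/2) < x r < 1/2.
    by move=> rr; have [|//] := Ht r; lra.
  have H2 r : t1 <= r <= t1 + 1/2 -> y r < 0.
    by move=> rr; have [|_] := Ht r; lra.
  have [_ E] := ztraj_mid _ _ _ _ _ _ _ _ _ _ _ zt st H1 H2.
  have B1 : t1 <= t1 <= t1 + 1/2 by lra.
  have B2 : t1 <= t1 + 1/2 <= t1 + 1/2 by lra.
  by have := bQ _ B1; have := bQ _ B2; rewrite E; lra.
have [s s0 [sZ nZ]] := cross_exit Z t0 e _ e0 oZ Ze e10 nst.
have st : t0 < t0 + s by lra.
have sZ' r : t0 < r < t0 + s -> - (1/2) < x r < 1/2 /\ y r < - (x1/2).
  by move=> rr; have -> : r = t0 + (r - t0) by [ring]; apply: sZ; lra.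
have xs : x (t0 + s) <= 1/2.
  by apply: (@le_left_limit R x t0 _ _ (cx _) st) => [r /sZ'[xr yr]]; lra.
have ys : y (t0 + s) <= - (x1/2).
  by apply: (@le_left_limit R y t0 _ _ (cy _) st) => [r /sZ'[xr yr]]; lra.
(* [x] increases while the orbit is in [Z], which excludes an exit through the left line. *)
have xs' : - (1/2) < x (t0 + s).
  have s1 : t0 + s / 2 < t0 + s by lra.
  have B r : t0 + s / 2 < r < t0 + s -> - (1/2) < x r < 1/2 /\ y r < - (x1/2).
    by move=> rr; apply: sZ'; lra.
  have := mid_incr _ _ _ _ _ _ _ _ _ _ _ x10 x13 zt s1 B.
  have [|A _] := sZ' (t0 + s / 2); lra.
(* Leaving through the top of [Z] would put the orbit on the lower side of the rectangle. *)
have ys' : y (t0 + s) < - (x1/2).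
  have := av (t0 + s); rewrite lt_neqAle ys andbT => nE.
  by apply/eqP => E; apply: nE; lra.
exists s => //; split => //; split => //.
apply/eqP; rewrite eq_le xs leNgt; apply/negP => xs2; apply: nZ.
by split => //; rewrite xs' xs2.
Qed.

(** On Re z = 1/2 the value of [Pz] is [(1/2 - N) / N^2] with [N = |z|^2], which increases strictly
    for [N > 1], that is for [y^2 > 3/4]. Conservation of [Pz] therefore determines the height at
    which the strip is left. *)
Lemma Pz_inj {R : realType} (y1 y2 : R) : 3/4 < y1 * y1 -> 3/4 < y2 * y2 ->
  Pz (1/2) y1 = Pz (1/2) y2 -> y1 * y1 = y2 * y2.
Proof.
rewrite /Pz; set N := (1/2) * (1/2) + y1 * y1; set M := (1/2) * (1/2) + y2 * y2 => A1 A2.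
have N1 : 1 < N by rewrite /N; lra.
have M1 : 1 < M by rewrite /M; lra.
have e1 : (1/2) * (1/2) - y1 * y1 = 1/2 - N by rewrite /N; field.
have e2 : (1/2) * (1/2) - y2 * y2 = 1/2 - M by rewrite /M; field.
rewrite e1 e2 => E.
have {}E : (1/2 - N) * (M * M) = (1/2 - M) * (N * N).
  have N0 : N != 0 by rewrite gt_eqF//; lra.
  have M0 : M != 0 by rewrite gt_eqF//; lra.
  have -> : (1/2 - N) * (M * M) = (1/2 - N) * (N * N)^-1 * (N * N * (M * M)) by field.
  by rewrite E; field.
have F : (N - M) * (N * M - (N + M) / 2) = 0.
  transitivity ((1/2 - N) * (M * M) - (1/2 - M) * (N * N)); first by field.
  by rewrite E subrr.
have G : 0 < N * M - (N + M) / 2 by nra.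
move/eqP: F; rewrite mulf_eq0 (gt_eqF G) orbF subr_eq0 => /eqP.
by rewrite /N /M; lra.
Qed.

Lemma half_follow {R : realType} (a b c d x0 x1 : R) bad x y (t0 : R) :
  0 < b -> 0 < x0 -> 3 < x0 * x0 -> 0 < x1 -> 3 < x1 * x1 ->
  ztraj a b c d x0 x1 bad x y -> avoids x0 x1 x y ->
  x t0 = - (1/2) -> x0/2 < y t0 ->
  forall s, 0 <= s <= halfT a b x1 (y t0) ->
  x (t0 + s) = half_x a b x1 (y t0) s /\ y (t0 + s) = half_y a b x1 (y t0) s.
Proof.
move=> b0 x00 x03 x10 x13 zt av xt0 yt0.
have [e e0 Ze] := enter_left _ _ _ _ _ _ _ _ _ _ b0 x00 x03 x10 zt xt0 yt0.
have [s1 s10 [Z1 xs1]] := exit_left _ _ _ _ _ _ _ _ _ _ _ b0 zt e0 Ze.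
have bn0 : b != 0 by rewrite gt_eqF.
have rho0 : 0 < y t0 + x1/2 by lra.
have L s : 0 <= s <= s1 -> x (t0 + s) = left_x a b x1 (y t0) s /\
    y (t0 + s) = left_y a b x1 (y t0) s.
  move=> /andP[ss0 ss1]; have st : t0 <= t0 + s by rewrite lerDl.
  have Z r : t0 < r < t0 + s -> x r < - (1/2).
    by move=> rr; have -> : r = t0 + (r - t0) by [ring]; apply: Z1; lra.
  have [-> ->] := ztraj_left _ _ _ _ _ _ _ _ _ _ _ zt st Z.
  rewrite /left_x /left_y xt0 (_ : t0 + s - t0 = s); last by ring.
  by split; ring.
(* At the exit the sine in [left_x] vanishes. It is positive before [pi / b], and a later exit would
   contradict its vanishing at [pi / b]. *)
have s1E : s1 = pi / b.
  have EX (r : R) : 0 < (y t0 + x1/2) * expR (a * r) by rewrite mulr_gt0 ?expR_gt0.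
  have [|+ _] := L s1; first by lra.
  rewrite xs1 /left_x => S; have /eqP : (y t0 + x1/2) * expR (a * s1) * sin (b * s1) = 0 by lra.
  rewrite mulf_eq0 gt_eqF//= => /eqP sin0.
  have [lt|gt|//] := ltgtP s1 (pi / b).
    have : 0 < sin (b * s1).
      by apply: sin_gt0_pi; rewrite ?mulr_gt0//= mulrC -ltr_pdivlMr.
    by rewrite sin0 ltxx.
  have pb : 0 < pi / b by rewrite divr_gt0// pi_gt0.
  have [|A _] := L (pi / b); first by lra.
  have := Z1 (pi / b); rewrite A /left_x (_ : b * (pi / b) = pi); last by field.
  rewrite sinpi mulr0.
  by move=> /(_ _); rewrite pb gt subr0 ltxx => /(_ isT).
rewrite s1E in L xs1.
pose n := next a b x1 (y t0).
have nx1 : x1/2 < n by rewrite /n /next ltrDl mulr_gt0// expR_gt0.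
pose t1 := t0 + pi / b.
have xt1 : x t1 = - (1/2) by [].
have yt1 : y t1 = - n.
  have [|_ ->] := L (pi / b); last by have [] := left_end a b x1 (y t0) b0.
  by rewrite lexx andbT divr_ge0 ?pi_ge0// ltW.
have yt1' : y t1 < - (x1/2) by rewrite yt1 ltrN2.
have [e' e'0 Ze'] := enter_mid _ _ _ _ _ _ _ _ _ _ b0 x10 x13 zt xt1 yt1'.
have [s2 s20 [Z2 [xs2 ys2]]] := exit_mid _ _ _ _ _ _ _ _ _ _ _ x10 x13 x00 zt av e'0 Ze'.
have Mf s : 0 <= s <= s2 ->
    [/\ y (t1 + s) < 0, Pz (x (t1 + s)) (y (t1 + s)) = Pz (- (1/2)) (- n) &
        Qz (x (t1 + s)) (y (t1 + s)) = Qz (- (1/2)) (- n) + 8 * s].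
  move=> /andP[ss0 ss2].
  have yneg r : t1 <= r <= t1 + s2 -> y r < 0.
    move=> /andP[r1 r2].
    have [->|rt1] := eqVneq r t1; first by rewrite yt1; lra.
    have [->|rt2] := eqVneq r (t1 + s2); first by lra.
    have -> : r = t1 + (r - t1) by ring.
    have [|_ yr] := Z2 (r - t1); last by lra.
    have : t1 < r by rewrite lt_neqAle eq_sym rt1.
    have : r < t1 + s2 by rewrite lt_neqAle rt2.
    lra.
  have st : t1 <= t1 + s by rewrite lerDl.
  have H1 r : t1 < r < t1 + s -> - (1/2) < x r < 1/2.
    by move=> rr; have -> : r = t1 + (r - t1) by [ring]; have [] := Z2 (r - t1); first by lra.
  have H2 r : t1 <= r <= t1 + s -> y r < 0 by move=> rr; apply: yneg; lra.
  have [-> ->] := ztraj_mid _ _ _ _ _ _ _ _ _ _ _ zt st H1 H2.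
  rewrite xt1 yt1 (_ : t1 + s - t1 = s); last by ring.
  by split => //; apply: H2; lra.
(* Equal values of [Pz] at both ends give equal heights; the growth of [Qz] at speed 8 then gives
   the duration. *)
have s2E : s2 = midtime n.
  have [|_ PE QE] := Mf s2; first by lra.
  have n0 : 0 < n by lra.
  have PE' : Pz (1/2) (y (t1 + s2)) = Pz (1/2) n.
    rewrite xs2 in PE; rewrite PE /Pz; congr (_ * _^-1); ring.
  have := Pz_inj (y (t1 + s2)) n _ _ PE'.
  have n3 : 3/4 < n * n by nra.
  have y3 : 3/4 < y (t1 + s2) * y (t1 + s2) by nra.
  move=> /(_ y3 n3) YE.
  have yE : y (t1 + s2) = - n by nra.
  rewrite xs2 yE in QE.
  have : 8 * s2 = Qz (1/2) (- n) - Qz (- (1/2)) (- n) by lra.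
  rewrite /Qz /midtime => {}QE.
  have -> : s2 = (8 * s2) / 8 by field.
  rewrite QE; set N := (1/2) * (1/2) + n * n.
  have e1 : (1/2) * (1/2) + (- n) * (- n) = N by rewrite /N; ring.
  have e2 : (- (1/2)) * (- (1/2)) + (- n) * (- n) = N by rewrite /N; ring.
  rewrite e1 e2; field; rewrite /N; lra.
move=> s /andP[ss0 sT]; rewrite /half_x /half_y; case: leP => spi.
  by apply: L; rewrite ss0.
have -> : t0 + s = t1 + (s - pi / b) by rewrite /t1; ring.
have [|yn PE QE] := Mf (s - pi / b).
  by move: sT; rewrite /halfT -/n s2E; lra.
have := mid_inv (x (t1 + (s - pi / b))) _ yn.
by rewrite PE QE.
Qed.

Lemma next_gt {R : realType} (a b x1 y : R) : 0 < y -> 0 < x1 -> x1/2 < next a b x1 y.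
Proof. by move=> y0 x10; rewrite /next ltrDl mulr_gt0 ?expR_gt0// addr_gt0// divr_gt0. Qed.

Definition turnT {R : realType} (a b c d x0 x1 y : R) := halfT a b x1 y + halfT c d x0 (next a b x1 y).
Definition turn_x {R : realType} (a b c d x0 x1 y s : R) :=
  if s <= halfT a b x1 y then half_x a b x1 y s
  else - half_x c d x0 (next a b x1 y) (s - halfT a b x1 y).
Definition turn_y {R : realType} (a b c d x0 x1 y s : R) :=
  if s <= halfT a b x1 y then half_y a b x1 y s
  else - half_y c d x0 (next a b x1 y) (s - halfT a b x1 y).

Lemma halfT_gt0 {R : realType} (a b x1 y : R) : 0 < b -> 0 < x1 -> 0 < y -> 0 < halfT a b x1 y.
Proof.
move=> b0 x10 y0; apply: addr_gt0; first by rewrite divr_gt0// pi_gt0.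
apply: midtime_gt0; by apply: lt_trans (next_gt a b x1 y y0 x10); rewrite divr_gt0.
Qed.

Lemma half_reach {R : realType} (a b c d x0 x1 : R) bad x y (t0 : R) :
  0 < b -> 0 < x0 -> 3 < x0 * x0 -> 0 < x1 -> 3 < x1 * x1 ->
  ztraj a b c d x0 x1 bad x y -> avoids x0 x1 x y ->
  x t0 = - (1/2) -> x0/2 < y t0 ->
  x (t0 + halfT a b x1 (y t0)) = 1/2 /\ y (t0 + halfT a b x1 (y t0)) = - next a b x1 (y t0).
Proof.
move=> b0 x00 x03 x10 x13 zt av xt yt.
have y0 : 0 < y t0 by lra.
have n0 := next_gt a b x1 _ y0 x10.
have [|-> ->] := half_follow _ _ _ _ _ _ _ _ _ _ b0 x00 x03 x10 x13 zt av xt yt (halfT a b x1 (y t0)).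
  by rewrite lexx andbT ltW// halfT_gt0.
by apply: half_end; lra.
Qed.

(** The second half turn is a first half turn of the reflected orbit [- z], with the data of the two
    foci exchanged. *)
Lemma turn_follow {R : realType} (a b c d x0 x1 : R) bad x y (t0 : R) :
  0 < b -> 0 < d -> 0 < x0 -> 3 < x0 * x0 -> 0 < x1 -> 3 < x1 * x1 ->
  ztraj a b c d x0 x1 bad x y -> avoids x0 x1 x y ->
  x t0 = - (1/2) -> x0/2 < y t0 ->
  (forall s, 0 <= s <= turnT a b c d x0 x1 (y t0) ->
  x (t0 + s) = turn_x a b c d x0 x1 (y t0) s /\ y (t0 + s) = turn_y a b c d x0 x1 (y t0) s) /\
  x (t0 + turnT a b c d x0 x1 (y t0)) = - (1/2) /\
  y (t0 + turnT a b c d x0 x1 (y t0)) = next c d x0 (next a b x1 (y t0)).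
Proof.
move=> b0 d0 x00 x03 x10 x13 zt av xt yt.
have y0 : 0 < y t0 by lra.
have n0 := next_gt a b x1 _ y0 x10.
have H := half_follow _ _ _ _ _ _ _ _ _ _ b0 x00 x03 x10 x13 zt av xt yt.
have [xt1 yt1] := half_reach _ _ _ _ _ _ _ _ _ _ b0 x00 x03 x10 x13 zt av xt yt.
have zt' := ztrajN _ _ _ _ _ _ _ _ _ zt; have av' := avoidsN _ _ _ _ av.
set t1 := t0 + halfT a b x1 (y t0) in xt1 yt1.
have xt1' : - x t1 = - (1/2) by rewrite xt1.
have yt1' : x1/2 < - y t1 by rewrite yt1 opprK.
have H2 := half_follow _ _ _ _ _ _ _ _ _ t1 d0 x10 x13 x00 x03 zt' av' xt1' yt1'.
have H3 := half_reach _ _ _ _ _ _ _ _ _ t1 d0 x10 x13 x00 x03 zt' av' xt1' yt1'.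
cbn beta in H2, H3; rewrite yt1 opprK in H2 H3.
split; last first.
  have -> : t0 + turnT a b c d x0 x1 (y t0) = t1 + halfT c d x0 (next a b x1 (y t0)).
    by rewrite /turnT /t1; ring.
  by have [A B] := H3; split; lra.
move=> s /andP[s0 sT]; rewrite /turn_x /turn_y; case: leP => sh.
  by apply: H; rewrite s0.
have -> : t0 + s = t1 + (s - halfT a b x1 (y t0)) by rewrite /t1; ring.
have [|A B] := H2 (s - halfT a b x1 (y t0)); first by move: sT; rewrite /turnT; lra.
by rewrite -A -B !opprK.
Qed.

(** The positions allowed at [t0], together with their reflections for the exchanged data, cover the
    complement of the rectangle. This is how [reach_section] can start from time 0. *)
Lemma reach_half {R : realType} (a b c d x0 x1 : R) bad x y (t0 : R) :
  0 < b -> 0 < x0 -> 3 < x0 * x0 -> 0 < x1 -> 3 < x1 * x1 ->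
  ztraj a b c d x0 x1 bad x y -> avoids x0 x1 x y ->
  x t0 <= - (1/2) \/ (x t0 < 1/2 /\ y t0 < - (x1/2)) ->
  exists t, (x t = - (1/2) /\ x0/2 < y t) \/ (x t = 1/2 /\ y t < - (x1/2)).
Proof.
move=> b0 x00 x03 x10 x13 zt av.
have [cx cy _ _ _] := zt.
have mid t e : 0 < e -> (forall r, 0 < r < e ->
    - (1/2) < x (t + r) < 1/2 /\ y (t + r) < - (x1/2)) ->
    exists t, (x t = - (1/2) /\ x0/2 < y t) \/ (x t = 1/2 /\ y t < - (x1/2)).
  move=> e0 Ze; have [s s0 [_ xys]] := exit_mid _ _ _ _ _ _ _ _ _ _ _ x10 x13 x00 zt av e0 Ze.
  by exists (t + s); right.
have line t : x t = - (1/2) -> exists t, (x t = - (1/2) /\ x0/2 < y t) \/ (x t = 1/2 /\ y t < - (x1/2)).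
  move=> xt; have [yt|yt] := ltP (x0/2) (y t); first by exists t; left.
  have yt' : y t < - (x1/2).
    by rewrite ltNge; apply/negP => yt'; apply: (av t); rewrite xt; lra.
  have [e e0 Ze] := enter_mid _ _ _ _ _ _ _ _ _ _ b0 x10 x13 zt xt yt'.
  exact: (mid t e e0 Ze).
have [xt|xt|xt] := ltgtP (x t0) (- (1/2)); last by move=> _; exact: (line _ xt).
  have /near_nbhs[e e0 Ze] := cvg_lt_near _ _ _ (cx t0) xt.
  have Ze' r : 0 < r < e -> x (t0 + r) < - (1/2).
    by move=> rr; apply: Ze; rewrite (_ : t0 + r - t0 = r) ?ger0_norm; [lra|lra|ring].
  have [s s0 [_ xs]] := exit_left _ _ _ _ _ _ _ _ _ _ _ b0 zt e0 Ze'.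
  by move=> _; exact: (line _ xs).
case=> [//|[xt2 yt]].
have /near_nbhs[e1 e10 Z1] := cvg_gt_near _ _ _ (cx t0) xt.
have /near_nbhs[e2 e20 Z2] := cvg_lt_near _ _ _ (cx t0) xt2.
have /near_nbhs[e3 e30 Z3] := cvg_lt_near _ _ _ (cy t0) yt.
have e0 : 0 < Num.min e1 (Num.min e2 e3) by rewrite !lt_min e10 e20.
apply: (mid t0 _ e0) => r; rewrite !lt_min => /andP[r0 /andP[r1 /andP[r2 r3]]].
have rE : `|t0 + r - t0| = r by rewrite (_ : t0 + r - t0 = r) ?ger0_norm ?ltW//; ring.
by rewrite Z1 ?rE// Z2 ?rE// Z3 ?rE.
Qed.

Lemma reach_section {R : realType} (a b c d x0 x1 : R) bad x y :
  0 < b -> 0 < d -> 0 < x0 -> 3 < x0 * x0 -> 0 < x1 -> 3 < x1 * x1 ->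
  ztraj a b c d x0 x1 bad x y -> avoids x0 x1 x y ->
  exists t, x t = - (1/2) /\ x0/2 < y t.
Proof.
move=> b0 d0 x00 x03 x10 x13 zt av.
have zt' := ztrajN _ _ _ _ _ _ _ _ _ zt; have av' := avoidsN _ _ _ _ av.
have RB t : x t = 1/2 -> y t < - (x1/2) -> exists t, x t = - (1/2) /\ x0/2 < y t.
  move=> xt yt.
  have xt' : - x t = - (1/2) by rewrite xt.
  have yt' : x1/2 < - y t by lra.
  have [A B] := half_reach _ _ _ _ _ _ _ _ _ t d0 x10 x13 x00 x03 zt' av' xt' yt'.
  exists (t + halfT c d x0 (- y t)); split; first by lra.
  have y0 : 0 < - y t by lra.
  by have := next_gt c d x0 _ y0 x00; lra.
have [L|nL] := pselect (x 0 <= - (1/2) \/ (x 0 < 1/2 /\ y 0 < - (x1/2))).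
  have [t [|[xt yt]]] := reach_half _ _ _ _ _ _ _ _ _ _ b0 x00 x03 x10 x13 zt av L; first by exists t.
  exact: (RB t xt yt).
have L' : - x 0 <= - (1/2) \/ (- x 0 < 1/2 /\ - y 0 < - (x0/2)).
  have xl : - (1/2) < x 0 by rewrite ltNge; apply/negP => ?; apply: nL; left.
  have [xr|xr] := leP (1/2) (x 0); first by left; lra.
  right; split; first by lra.
  rewrite ltrN2 ltNge; apply/negP => yl; apply: nL; right; split => //.
  by rewrite ltNge; apply/negP => yl'; apply: (av 0); lra.
have [t [[xt yt]|[xt yt]]] := reach_half _ _ _ _ _ _ _ _ _ 0 d0 x10 x13 x00 x03 zt' av' L'.
  by apply: (RB t); lra.
by exists t; lra.
Qed.

(* The fixed point of the affine return map, whose slope is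
   expR (pi a / b) * expR (pi c / d) < 1. *)
Definition ystar {R : realType} (a b c d x0 x1 : R) :=
  (x0 + x1) / 2 * (1 + expR (pi * c / d)) / (1 - expR (pi * a / b) * expR (pi * c / d)) - x1 / 2.

Lemma exp_lt1 {R : realType} (a b : R) : a < 0 -> 0 < b -> expR (pi * a / b) < 1.
Proof.
move=> a0 b0; rewrite -expR0 ltr_expR ltr_pdivrMr// mul0r.
by rewrite pmulr_rlt0// pi_gt0.
Qed.

Lemma AB_lt1 {R : realType} (a b c d : R) : a < 0 -> 0 < b -> c < 0 -> 0 < d ->
  0 < expR (pi * a / b) * expR (pi * c / d) < 1.
Proof.
move=> a0 b0 c0 d0; rewrite mulr_gt0 ?expR_gt0//=.
by rewrite mulr_ilt1 ?expR_ge0 ?exp_lt1.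
Qed.

Lemma return_map {R : realType} (a b c d x0 x1 y : R) : a < 0 -> 0 < b -> c < 0 -> 0 < d ->
  next c d x0 (next a b x1 y) - ystar a b c d x0 x1 =
  expR (pi * a / b) * expR (pi * c / d) * (y - ystar a b c d x0 x1).
Proof.
move=> a0 b0 c0 d0; rewrite /next /ystar; have /andP[_ AB] := AB_lt1 a b c d a0 b0 c0 d0.
by field; rewrite gt_eqF// subr_gt0.
Qed.

(** The quotient of exponentials in [ystar] exceeds 1, so the fixed point is above the rectangle, on
    the section. *)
Lemma ystar_gt {R : realType} (a b c d x0 x1 : R) : a < 0 -> 0 < b -> c < 0 -> 0 < d ->
  0 < x0 -> 0 < x1 -> x0 / 2 < ystar a b c d x0 x1.
Proof.
move=> a0 b0 c0 d0 x00 x10; have /andP[AB0 AB] := AB_lt1 a b c d a0 b0 c0 d0.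
have B0 : 0 < expR (pi * c / d) by exact: expR_gt0.
rewrite /ystar; suff : (x0 + x1) / 2 * 1 < (x0 + x1) / 2 *
    ((1 + expR (pi * c / d)) / (1 - expR (pi * a / b) * expR (pi * c / d))).
  by rewrite mulr1 mulrA; lra.
by rewrite ltr_pM2l ?ltr_pdivlMr; lra.
Qed.

(** * Periodic orbits off the rectangle *)

Definition periodic {R : realType} (T : R) (x : R -> R) := forall t, x (t + T) = x t.

Lemma periodicMn {R : realType} (T : R) (x : R -> R) (n : nat) : periodic T x -> periodic (n%:R * T) x.
Proof.
move=> px t; elim: n => [|n IH]; first by rewrite mul0r addr0.
by rewrite -natr1 mulrDl mul1r addrA px.
Qed.

Lemma periodicMz {R : realType} (T : R) (x : R -> R) (n : int) : periodic T x -> periodic (n%:~R * T) x.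
Proof.
move=> px; case: n => n; first exact: periodicMn.
move=> t; rewrite NegzE mulrNz mulNr -(periodicMn _ _ n.+1 px (t - _)).
by rewrite subrK.
Qed.

Lemma periodicBz {R : realType} (T : R) (x : R -> R) (n : int) (t : R) : periodic T x ->
  x (t - n%:~R * T) = x t.
Proof. by move=> px; rewrite -(periodicMz T x n px (t - n%:~R * T)) subrK. Qed.

Lemma floor_mod {R : realType} (T t : R) : 0 < T -> exists2 n : int, 0 <= t - n%:~R * T < T & (0 <= t -> 0 <= n).
Proof.
move=> T0; exists (Num.floor (t / T)); last by move=> t0; rewrite floor_ge0 divr_ge0// ltW.
have := floor_le (t / T); have := floorD1_gt (t / T).
rewrite intrD1 ltr_pdivrMr// ler_pdivlMr// mulrDl mul1r; lra.
Qed.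

Lemma reach_cycle {R : realType} (a b c d x0 x1 : R) bad x y (T : R) :
  a < 0 -> 0 < b -> c < 0 -> 0 < d -> 0 < x0 -> 3 < x0 * x0 -> 0 < x1 -> 3 < x1 * x1 ->
  ztraj a b c d x0 x1 bad x y -> avoids x0 x1 x y -> 0 < T -> periodic T x -> periodic T y ->
  exists t, x t = - (1/2) /\ y t = ystar a b c d x0 x1.
Proof.
move=> a0 b0 c0 d0 x00 x03 x10 x13 zt av T0 px py.
set ys := ystar _ _ _ _ _ _.
set q := expR (pi * a / b) * expR (pi * c / d).
have [t0 [xt0 yt0]] := reach_section _ _ _ _ _ _ _ _ _ b0 d0 x00 x03 x10 x13 zt av.
have seq (n : nat) : exists t, [/\ x t = - (1/2), x0/2 < y t & y t - ys = q ^+ n * (y t0 - ys)].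
  elim: n => [|n [t [xt yt yE]]]; first by exists t0; split => //; rewrite expr0 mul1r.
  have [_ [xt' yt']] := turn_follow _ _ _ _ _ _ _ _ _ _ b0 d0 x00 x03 x10 x13 zt av xt yt.
  eexists; split; [exact: xt'| |]; rewrite yt'.
    have y_gt0 : 0 < y t by lra.
    by apply: next_gt => //; have := next_gt a b x1 _ y_gt0 x10; lra.
  by rewrite return_map// yE exprS mulrA.
apply: contrapT => no.
have [cx cy _ _ _] := zt.
(* [D] is a distance to the fixed point of the return map. By periodicity its minimum over one
   period is global; if the orbit missed the point this minimum would be positive, against the
   geometric decay along the returns. *)
pose D t := `|x t + 1/2| + `|y t - ys|.
have cD : continuous D.
  move=> t; apply: cvgD; apply: cvg_norm.
    exact: (@continuous_atD R _ x (fun=> 1/2) t (cx t) (continuous_at_cst _ _)).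
  exact: (@continuous_atD R _ y (fun=> - ys) t (cy t) (continuous_at_cst _ _)).
have D0 t : 0 < D t.
  rewrite lt_neqAle addr_ge0// andbT eq_sym; apply/negP; rewrite paddr_eq0// !normr_eq0.
  by move=> /andP[/eqP A /eqP B]; apply: no; exists t; split; [lra|apply/eqP; rewrite -subr_eq0 B].
have [m m0 mD] := EVT_min (ltW T0) (continuous_subspaceT cD).
have Dm t : D m <= D t.
  have [n nT _] := floor_mod T t T0.
  have -> : D t = D (t - n%:~R * T).
    by rewrite /D !periodicBz.
  by apply: mD; rewrite in_itv/=; lra.
have /andP[q0 q1] : 0 < q < 1 by exact: AB_lt1.
have C : q ^+ n * (y t0 - ys) @[n --> \oo] --> 0 * (y t0 - ys).
  by apply: cvgM; [apply: cvg_expr; rewrite ger0_norm// ltW|exact: cvg_cst].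
rewrite mul0r in C; move/cvgrPdist_lt/(_ _ (D0 m)) : C => -[N _ /(_ N (leqnn N))].
have [t [xt _ yE]] := seq N; rewrite sub0r normrN -yE.
have := Dm t; rewrite /D xt addNr normr0 add0r => A /=; by rewrite ltNge A.
Qed.

(** Used for a competing orbit and for the explicit cycle alike: each traces exactly the same closed
    arc, so their ranges agree. *)
Lemma range_cycle {R : realType} (a b c d x0 x1 : R) bad x y (T t0 : R) :
  a < 0 -> 0 < b -> c < 0 -> 0 < d -> 0 < x0 -> 3 < x0 * x0 -> 0 < x1 -> 3 < x1 * x1 ->
  ztraj a b c d x0 x1 bad x y -> avoids x0 x1 x y -> 0 < T -> periodic T x -> periodic T y ->
  x t0 = - (1/2) -> y t0 = ystar a b c d x0 x1 ->
  let ys := ystar a b c d x0 x1 in let T0 := turnT a b c d x0 x1 ys in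
  (forall s, 0 <= s <= T0 ->
    x (t0 + s) = turn_x a b c d x0 x1 ys s /\ y (t0 + s) = turn_y a b c d x0 x1 ys s) /\
  (forall t, exists2 s, 0 <= s <= T0 &
    x t = turn_x a b c d x0 x1 ys s /\ y t = turn_y a b c d x0 x1 ys s).
Proof.
move=> a0 b0 c0 d0 x00 x03 x10 x13 zt av TT px py xt0 yt0 ys T0.
have ysg : x0/2 < ys by exact: ystar_gt.
have y0 : 0 < ys by lra.
have rys : next c d x0 (next a b x1 ys) = ys.
  by apply/eqP; rewrite -subr_eq0 return_map// subrr mulr0.
have T00 : 0 < T0.
  rewrite /T0 /turnT addr_gt0// halfT_gt0//.
  by have := next_gt a b x1 _ y0 x10; lra.
have F t : x t = - (1/2) -> y t = ys ->
  (forall s, 0 <= s <= T0 ->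
    x (t + s) = turn_x a b c d x0 x1 ys s /\ y (t + s) = turn_y a b c d x0 x1 ys s) /\
  x (t + T0) = - (1/2) /\ y (t + T0) = ys.
  move=> xt yt; have yt' : x0/2 < y t by rewrite yt.
  have := turn_follow _ _ _ _ _ _ _ _ _ _ b0 d0 x00 x03 x10 x13 zt av xt yt'.
  by rewrite yt rys.
have N (n : nat) : x (t0 + n%:R * T0) = - (1/2) /\ y (t0 + n%:R * T0) = ys.
  elim: n => [|n [A B]]; first by rewrite mul0r addr0.
  by rewrite -natr1 mulrDl mul1r addrA; have [_] := F _ A B.
split; first by have [] := F _ xt0 yt0.
move=> t.
(* The formulas follow an orbit forward only. A multiple of [T] moves [t] to a time [t'] not before
   [t0], and [n] then counts the complete turns made since [t0]. *)
have [k kT _] := floor_mod T (t - t0) TT.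
pose t' := t - k%:~R * T.
have xt' : x t = x t' by rewrite /t' periodicBz.
have yt' : y t = y t' by rewrite /t' periodicBz.
have [n nT0 n0] := floor_mod T0 (t' - t0) T00.
have {n0} : 0 <= n by apply: n0; rewrite /t'; lra.
case: n nT0 => // n nT0 _.
have [A B] := N n; have [H _] := F _ A B.
exists (t' - t0 - n%:R * T0); first by move: nT0; rewrite -pmulrn; lra.
have {}H := H (t' - t0 - n%:R * T0).
have e : t0 + n%:R * T0 + (t' - t0 - n%:R * T0) = t' by ring.
rewrite e in H; rewrite xt' yt'; apply: H.
by move: nT0; rewrite -pmulrn; lra.
Qed.

(** * The explicit cycle *)

Lemma mid_rel {R : realType} (P Q : R) : P < 0 ->
  let M := Num.sqrt (P * P + Q * Q) in let B := mid_b P Q in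
  [/\ 0 < M, 0 < B, M * M = P * P + Q * Q & 2 * (B * B) = M - P].
Proof.
move=> P0 M B.
have PQ0 : 0 < P * P + Q * Q by rewrite addrC sumsq_gt0// lt_eqF.
have M0 : 0 < M by rewrite sqrtr_gt0.
have MP : 0 < (M - P) * 2^-1 by rewrite mulr_gt0// subr_gt0 (lt_trans P0).
split => //; first by rewrite sqrtr_gt0.
  by rewrite -expr2 sqr_sqrtr// ltW.
by rewrite -expr2 sqr_sqrtr ?ltW// -/M; field.
Qed.

Lemma mid_sq {R : realType} (P Q : R) : P < 0 ->
  let M := Num.sqrt (P * P + Q * Q) in let B := mid_b P Q in
  Q * Q = 4 * (B * B) * (M - B * B).
Proof.
move=> P0 M B; move: (mid_rel P Q P0); rewrite /= -/M -/B; clearbody M B.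
move=> [M0 B0 MM BB].
have PE : P = M - 2 * (B * B) by rewrite BB; ring.
have -> : Q * Q = M * M - P * P by rewrite MM; ring.
by rewrite PE; ring.
Qed.

(** With [m = |z|^2] these are the sum and the difference of [x^2 + y^2 = m] and
    [x^2 - y^2 = P m^2]. *)
Lemma mid_coord {R : realType} (P Q : R) : P < 0 ->
  let m := (Num.sqrt (P * P + Q * Q))^-1 in
  [/\ mid_y P Q < 0, 0 < m, 2 * (mid_x P Q * mid_x P Q) = m + P * (m * m) &
      2 * (mid_y P Q * mid_y P Q) = m - P * (m * m)].
Proof.
move=> P0 m; have [M0 B0 MM BB] := mid_rel P Q P0.
have QQ := mid_sq P Q P0.
rewrite /mid_x /mid_y; move: M0 B0 BB QQ; rewrite /m.
move: (Num.sqrt _) (mid_b P Q) => M B M0 B0 BB QQ.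
have Mn0 : M != 0 by rewrite gt_eqF.
have Bn0 : B != 0 by rewrite gt_eqF.
have PE : P = M - 2 * (B * B) by rewrite BB; ring.
split; [by rewrite oppr_lt0 divr_gt0|by rewrite invr_gt0| |].
  have -> : 2 * (Q * (2 * B * M)^-1 * (Q * (2 * B * M)^-1)) = (Q * Q) * (2 * (B * B) * (M * M))^-1.
    by field; rewrite Mn0 Bn0.
  by rewrite QQ PE; field; rewrite Mn0 Bn0.
by rewrite PE; field.
Qed.

Lemma has_deriv_mid {R : realType} (P Q : R) (s : R) : P < 0 ->
  let x r := mid_x P (Q + 8 * r) in let y r := mid_y P (Q + 8 * r) in
  has_deriv x s (4 * y s * (3 * x s * x s - y s * y s)) /\
  has_deriv y s (4 * x s * (3 * y s * y s - x s * x s)).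
Proof.
move=> P0 x y.
have [M0 B0 MM BB] := mid_rel P (Q + 8 * s) P0.
have QQ := mid_sq P (Q + 8 * s) P0.
have PQ0 : 0 < P * P + (Q + 8 * s) * (Q + 8 * s) by rewrite -sqrtr_gt0.
have MP : 0 < (Num.sqrt (P * P + (Q + 8 * s) * (Q + 8 * s)) - P) * 2^-1 by rewrite -sqrtr_gt0.
have n0 : 2 * mid_b P (Q + 8 * s) * Num.sqrt (P * P + (Q + 8 * s) * (Q + 8 * s)) != 0.
  by rewrite gt_eqF// mulr_gt0// mulr_gt0.
have Mn0 : Num.sqrt (P * P + (Q + 8 * s) * (Q + 8 * s)) != 0 by rewrite gt_eqF.
have Bn0 : mid_b P (Q + 8 * s) != 0 by rewrite gt_eqF.
split.
  rewrite /x /mid_x /mid_b.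
  apply: has_deriv_eq; first by der; rewrite -/(mid_b P (Q + 8 * s)).
  cbn beta; rewrite /y /mid_y -/(mid_b P (Q + 8 * s)).
  move: M0 B0 QQ Mn0 Bn0; set M := Num.sqrt _; set B := mid_b _ _; set q := Q + 8 * s => M0 B0 QQ Mn0 Bn0.
  (* Both sides are brought to forms where [q] occurs only through [q * q]; [QQ] replaces it, and a
     rational identity in [B] and [M] remains. *)
  transitivity (4 / (B * M) - (q * q) * (B^-1 + 4 * B / M) / (B * B * (M * M))).
    by field; rewrite Mn0 Bn0.
  transitivity (4 * (- (B / M)) * (3 * (q * q) / (2 * B * M) ^+ 2 - (B / M) ^+ 2)).
    by rewrite QQ; field; rewrite Mn0 Bn0.
  by field; rewrite Mn0 Bn0.
rewrite /y /mid_y /mid_b.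
apply: has_deriv_eq; first by der; rewrite -/(mid_b P (Q + 8 * s)).
cbn beta; rewrite /x /mid_x -/(mid_b P (Q + 8 * s)).
move: M0 B0 QQ Mn0 Bn0; set M := Num.sqrt _; set B := mid_b _ _; set q := Q + 8 * s => M0 B0 QQ Mn0 Bn0.
transitivity (4 * (q / (2 * B * M)) * (3 * (B / M) ^+ 2 - (q * q) / (2 * B * M) ^+ 2)).
  by rewrite QQ; field; rewrite Mn0 Bn0.
by field; rewrite Mn0 Bn0.
Qed.

Lemma has_deriv_left {R : realType} (a b x1 y0 s : R) :
  let x r := left_x a b x1 y0 r in let y r := left_y a b x1 y0 r in
  has_deriv x s (a * (x s + 1/2) - b * (y s + x1/2)) /\
  has_deriv y s (b * (x s + 1/2) + a * (y s + x1/2)).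
Proof.
move=> x y; split.
  by rewrite /x /y /left_x /left_y; apply: has_deriv_eq; [der|cbn beta; ring].
by rewrite /x /y /left_x /left_y; apply: has_deriv_eq; [der|cbn beta; ring].
Qed.

(** The cycle is only piecewise smooth. This property survives gluing, yields a Lipschitz periodic
    extension when the end values agree, and so gives absolute continuity. *)
Definition loclip {R : realType} (f : R -> R) := forall s t : R, s <= t ->
  exists2 L, 0 <= L & forall u v, s <= u -> u <= v -> v <= t -> `|f v - f u| <= L * (v - u).

Lemma loclip_C1 {R : realType} (f f' : R -> R) : (forall r : R, has_deriv f r (f' r)) ->
  (forall r, {for r, continuous f'}) -> loclip f.
Proof. by move=> ff' cf' s t st; exact: C1_lip ff' cf' st. Qed.

Lemma loclip_glue {R : realType} (f g : R -> R) (c : R) : loclip f -> loclip g -> f c = g c ->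
  loclip (fun s => if s <= c then f s else g s).
Proof.
move=> lf lg fg s t st; have [L L0 fL] := lf s t st; have [K K0 gK] := lg s t st.
exists (L + K); first by rewrite addr_ge0.
have LE z : 0 <= z -> L * z <= (L + K) * z by move=> z0; apply: ler_wpM2r => //; rewrite lerDl.
have KE z : 0 <= z -> K * z <= (L + K) * z by move=> z0; apply: ler_wpM2r => //; rewrite lerDr.
move=> u v su uv vt; have vu0 : 0 <= v - u by rewrite subr_ge0.
have [uc|uc] := leP u c; have [vc|vc] := leP v c.
- exact: le_trans (fL u v su uv vt) (LE _ vu0).
- have A := fL u c su uc; have B := gK c v _ (ltW vc) vt.
  rewrite -[g v](subrK (g c)) -addrA -fg; apply: le_trans (ler_normD _ _) _.
  have {}A : `|f c - f u| <= L * (c - u) by apply: A; lra.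
  have {}B : `|g v - f c| <= K * (v - c) by rewrite fg; apply: B; lra.
  have := LE (c - u); have := KE (v - c); rewrite !subr_ge0 => /(_ (ltW vc)) + /(_ uc).
  rewrite fg in A B *; lra.
- by move: (le_lt_trans vc (lt_le_trans uc uv)); rewrite ltxx.
- exact: le_trans (gK u v su uv vt) (KE _ vu0).
Qed.

Lemma loclip_shift {R : realType} (f : R -> R) (c : R) : loclip f -> loclip (fun s => f (s - c)).
Proof.
move=> lf s t st; have [|L L0 fL] := lf (s - c) (t - c); first by rewrite lerD2r.
exists L => // u v su uv vt; have := fL (u - c) (v - c); rewrite !lerD2r => /(_ su uv vt).
by rewrite (_ : v - c - (u - c) = v - u)//; ring.
Qed.

Lemma loclipN {R : realType} (f : R -> R) : loclip f -> loclip (fun s => - f s).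
Proof.
move=> lf s t st; have [L L0 fL] := lf s t st; exists L => // u v su uv vt.
by rewrite -opprD normrN; exact: fL.
Qed.

Definition perext {R : realType} (T : R) (f : R -> R) (t : R) := f (t - (Num.floor (t / T))%:~R * T).

Lemma floor_uniq {R : realType} (T t : R) (n : int) : 0 < T -> 0 <= t - n%:~R * T < T ->
  Num.floor (t / T) = n.
Proof.
move=> T0 tn; apply: floor_def; rewrite intrD1 ler_pdivlMr// ltr_pdivrMr// mulrDl mul1r; lra.
Qed.

Lemma perextE {R : realType} (T : R) (f : R -> R) (t : R) (n : int) : 0 < T -> 0 <= t - n%:~R * T < T ->
  perext T f t = f (t - n%:~R * T).
Proof. by move=> T0 tn; rewrite /perext (floor_uniq _ _ n). Qed.

Lemma perext_periodic {R : realType} (T : R) (f : R -> R) : 0 < T -> periodic T (perext T f).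
Proof.
move=> T0 t; have [n tn _] := floor_mod T t T0.
rewrite (perextE _ _ t n)// (perextE _ _ (t + T) (n + 1))// intrD1.
  by congr f; ring.
by lra.
Qed.

(** For [u] and [v] in different periods, equality of the end values leaves only the rest of the
    period of [u] and the beginning of that of [v], of total length at most [v - u]. *)
Lemma perext_lip {R : realType} (T : R) (f : R -> R) : 0 < T -> loclip f -> f 0 = f T ->
  exists2 L, 0 <= L & forall u v, u <= v -> `|perext T f v - perext T f u| <= L * (v - u).
Proof.
move=> T0 lf f0T; have [L L0 fL] := lf 0 T (ltW T0); exists L => // u v uv.
have [n un _] := floor_mod T u T0; have [m vm _] := floor_mod T v T0.
rewrite (perextE _ _ u n)// (perextE _ _ v m)//.
have nm : n <= m.
  rewrite -ltzD1 -(ltr_int R) intrD1 -(ltr_pM2r T0) mulrDl mul1r; lra.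
move: nm; rewrite le_eqVlt => /orP[/eqP nm|nm].
  rewrite -nm in vm *.
  have := fL (u - n%:~R * T) (v - n%:~R * T).
  rewrite (_ : v - n%:~R * T - (u - n%:~R * T) = v - u); last by ring.
  by apply; lra.
have nm' : n%:~R + 1 <= m%:~R :> R by rewrite -intrD1 ler_int lezD1.
have nm2 : (n%:~R + 1) * T <= m%:~R * T by rewrite ler_pM2r.
have A := fL 0 (v - m%:~R * T); have B := fL (u - n%:~R * T) T.
have {}A : `|f (v - m%:~R * T) - f 0| <= L * (v - m%:~R * T - 0) by apply: A; lra.
have {}B : `|f T - f (u - n%:~R * T)| <= L * (T - (u - n%:~R * T)) by apply: B; lra.
have : `|f (v - m%:~R * T) - f (u - n%:~R * T)| <=
   `|f (v - m%:~R * T) - f 0| + `|f T - f (u - n%:~R * T)|.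
  by rewrite -f0T; apply: le_trans (ler_normD _ _); rewrite addrA subrK.
have : L * (v - m%:~R * T + T - (u - n%:~R * T)) <= L * (v - u) by apply: ler_wpM2l => //; lra.
lra.
Qed.

(** Nothing is asked on the two lines, where one-sided derivatives may differ; the cycle is there
    only on a null set of times. *)
Definition zsol {R : realType} (a b c d x0 x1 : R) (x y : R -> R) (t : R) :=
  [/\ x t < - (1/2) -> has_deriv x t (a * (x t + 1/2) - b * (y t + x1/2)) /\
        has_deriv y t (b * (x t + 1/2) + a * (y t + x1/2)),
      - (1/2) < x t < 1/2 -> has_deriv x t (4 * y t * (3 * x t * x t - y t * y t)) /\
        has_deriv y t (4 * x t * (3 * y t * y t - x t * x t))
    & 1/2 < x t -> has_deriv x t (c * (x t - 1/2) - d * (y t - x0/2)) /\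
        has_deriv y t (d * (x t - 1/2) + c * (y t - x0/2))].

Lemma has_deriv_near {R : realType} (f g : R -> R) (t df : R) : (\forall r \near t, f r = g r) ->
  has_deriv g t df -> has_deriv f t df.
Proof.
move=> fg gd; apply: (near_eq_is_derive (f := g)) => //.
by apply: filterS fg => r ->.
Qed.

Lemma zsol_near {R : realType} (a b c d x0 x1 : R) (x y x' y' : R -> R) (t : R) :
  (\forall r \near t, x r = x' r /\ y r = y' r) ->
  zsol a b c d x0 x1 x' y' t -> zsol a b c d x0 x1 x y t.
Proof.
move=> xy; have [xt yt] := nbhs_singleton xy.
have ex : \forall r \near t, x r = x' r by apply: filterS xy => r [].
have ey : \forall r \near t, y r = y' r by apply: filterS xy => r [].
rewrite /zsol xt yt => -[A B C]; split => [/A|/B|/C] [dx dy];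
  by split; [apply: has_deriv_near ex dx|apply: has_deriv_near ey dy].
Qed.

Lemma has_deriv_shift {R : realType} (f : R -> R) (t k df : R) : has_deriv f (t - k) df ->
  has_deriv (fun r => f (r - k)) t df.
Proof.
move=> H; have D : has_deriv (fun r : R => r - k) t 1 by apply: has_deriv_eq; [der|ring].
by have := has_deriv_comp f (fun r => r - k) t df 1 H D; rewrite mulr1.
Qed.

Lemma zsol_shift {R : realType} (a b c d x0 x1 : R) (x y : R -> R) (t k : R) :
  zsol a b c d x0 x1 x y (t - k) ->
  zsol a b c d x0 x1 (fun r => x (r - k)) (fun r => y (r - k)) t.
Proof.
move=> [A B C]; split => [/A|/B|/C] [dx dy]; by split; exact: has_deriv_shift.
Qed.

Lemma zsolN {R : realType} (a b c d x0 x1 : R) (x y : R -> R) (t : R) :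
  zsol a b c d x0 x1 x y t -> zsol c d a b x1 x0 (fun r => - x r) (fun r => - y r) t.
Proof.
move=> [A B C]; split => H.
- have [|dx dy] := C; first by lra.
  by split; [apply: has_deriv_eq (has_derivN _ _ _ dx) _|apply: has_deriv_eq (has_derivN _ _ _ dy) _]; ring.
- have [|dx dy] := B; first by lra.
  by split; [apply: has_deriv_eq (has_derivN _ _ _ dx) _|apply: has_deriv_eq (has_derivN _ _ _ dy) _]; ring.
- have [|dx dy] := A; first by lra.
  by split; [apply: has_deriv_eq (has_derivN _ _ _ dx) _|apply: has_deriv_eq (has_derivN _ _ _ dy) _]; ring.
Qed.

Lemma zsol_line {R : realType} (a b c d x0 x1 : R) (x y : R -> R) (t : R) :
  x t = - (1/2) \/ x t = 1/2 -> zsol a b c d x0 x1 x y t.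
Proof. by case=> xt; split; rewrite xt => H; exfalso; lra. Qed.

Lemma left_zone {R : realType} (a b x1 y s : R) : 0 < b -> 0 < y + x1/2 -> 0 < s < pi / b ->
  left_x a b x1 y s < - (1/2).
Proof.
move=> b0 r0 /andP[s0 sp]; rewrite /left_x.
have : 0 < (y + x1/2) * expR (a * s) * sin (b * s).
  rewrite !mulr_gt0 ?expR_gt0// sin_gt0_pi ?mulr_gt0//=.
  by rewrite mulrC -ltr_pdivlMr.
lra.
Qed.

Lemma Pz_lt0 {R : realType} (n : R) : 3/4 < n * n -> Pz (- (1/2)) (- n) < 0.
Proof.
move=> n3; rewrite /Pz pmulr_llt0; first by nra.
by rewrite invr_gt0 mulr_gt0//; nra.
Qed.

(** At both ends of the crossing [|z|^2 = N]. In between, [|Q|] is smaller with the same [P], so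
    [|1 / z^2|] is smaller and [m = |z|^2] exceeds [N]. The identities of [mid_coord] then compare
    [x] and [y] with their end values through [2 P N < -1], which amounts to [n^2 > 3/4]. *)
Lemma cross_zone {R : realType} (n s : R) : 0 < n -> 3/4 < n * n -> 0 < s < midtime n ->
  - (1/2) < cross_x n s < 1/2 /\ cross_y n s < - n.
Proof.
move=> n0 n3 /andP[s0 sn]; rewrite /cross_x /cross_y.
have P0 := Pz_lt0 n n3.
pose N := (1/2) * (1/2) + n * n.
have N1 : 1 < N by rewrite /N; lra.
have Nn0 : N != 0 by rewrite gt_eqF//; lra.
have nE : (- (1/2)) * (- (1/2)) + (- n) * (- n) = N by rewrite /N; ring.
have PE : Pz (- (1/2)) (- n) * (N * N) = 1/4 - n * n by rewrite /Pz nE; field.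
have QE : Qz (- (1/2)) (- n) = - (n / (N * N)) by rewrite /Qz nE; field.
have smE : 8 * midtime n = 2 * (n / (N * N)) by rewrite /midtime -/N; field.
move: P0 PE QE; set P := Pz _ _; set Q := Qz _ _ + _ => P0 PE QE.
have [My m0 X2 Y2] := mid_coord P Q P0.
have [M0 _ MM _] := mid_rel P Q P0.
move: M0 MM My m0 X2 Y2; set M := Num.sqrt _; set m := M^-1; set x := mid_x _ _; set y := mid_y _ _.
move=> M0 MM My m0 X2 Y2.
have q1 : - (n / (N * N)) < Q by rewrite /Q QE; lra.
have q2 : Q < n / (N * N) by rewrite /Q QE; lra.
have QQ : Q * Q < (n / (N * N)) * (n / (N * N)) by nra.
have NN : N^-1 * N^-1 = P * P + (n / (N * N)) * (n / (N * N)).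
  have -> : P = (1/4 - n * n) / (N * N) by rewrite -PE; field.
  transitivity ((1/4 + n * n) * (1/4 + n * n) / (N * N * (N * N))); last by field.
  rewrite (_ : 1/4 + n * n = N); last by rewrite /N; field.
  by field.
have MN : M < N^-1.
  have iN0 : 0 < N^-1 by rewrite invr_gt0; lra.
  rewrite ltNge; apply/negP => H.
  have : N^-1 * N^-1 <= M * M by apply: ler_pM => //; exact: ltW.
  by rewrite NN MM; lra.
have mN : N < m by rewrite /m -[N]invrK ltf_pV2 ?posrE// invr_gt0; lra.
have mN0 : 0 < m - N by rewrite subr_gt0.
have PN : P * (2 * N) < - 1.
  have : P * (N * N) * 2 < - N by rewrite PE /N; lra.
  have -> : P * (N * N) * 2 = (P * (2 * N)) * N by ring.
  by rewrite -[- N]mulN1r ltr_pM2r//; lra.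
have Pm : P * (m + N) < - 1.
  apply: lt_trans PN; rewrite ltr_nM2l//; lra.
have A : (m - N) * (P * (m + N) + 1) < 0 by rewrite pmulr_rlt0//; lra.
have B : 0 < (m - N) * (1 - P * (m + N)) by rewrite mulr_gt0//; lra.
have A' : 2 * (x * x) < 1/2.
  have : 2 * (x * x) - (N + P * (N * N)) = (m - N) * (P * (m + N) + 1) by rewrite X2; ring.
  by rewrite PE /N; lra.
have B' : 2 * (n * n) < 2 * (y * y).
  have : 2 * (y * y) - (N - P * (N * N)) = (m - N) * (1 - P * (m + N)) by rewrite Y2; ring.
  by rewrite PE /N; lra.
split; first by apply/andP; split; nra.
by nra.
Qed.

Lemma half_pos {R : realType} (a b x1 y s : R) : 0 < b -> 0 < x1 -> 3 < x1 * x1 -> 0 < y ->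
  let n := next a b x1 y in
  0 <= s <= halfT a b x1 y ->
  [\/ [/\ s = 0, half_x a b x1 y s = - (1/2) & half_y a b x1 y s = y],
      0 < s < pi / b /\ half_x a b x1 y s < - (1/2),
      [/\ s = pi / b, half_x a b x1 y s = - (1/2) & half_y a b x1 y s = - n] |
      [/\ pi / b < s < halfT a b x1 y, - (1/2) < half_x a b x1 y s < 1/2
        & half_y a b x1 y s < - n] \/
      [/\ s = halfT a b x1 y, half_x a b x1 y s = 1/2 & half_y a b x1 y s = - n]].
Proof.
move=> b0 x10 x13 y0 n /andP[s0 sT].
have nx1 : x1/2 < n by exact: next_gt.
have n0 : 0 < n by lra.
have n3 : 3/4 < n * n by nra.
have r0 : 0 < y + x1/2 by lra.
have pb : 0 < pi / b by rewrite divr_gt0// pi_gt0.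
have [->|sn0] := eqVneq s 0; first by apply: Or41; have [] := half_start a b x1 y b0.
have {}s0 : 0 < s by rewrite lt_neqAle eq_sym sn0.
have [sp|sp|sp] := ltgtP s (pi / b).
- by apply: Or42; rewrite s0; split => //; rewrite /half_x ltW// left_zone// s0.
- have [->|snT] := eqVneq s (halfT a b x1 y).
    by apply: Or44; right; have [] := half_end a b x1 y n0.
  have {}sT : s < halfT a b x1 y by rewrite lt_neqAle snT.
  have [|A B] := cross_zone n (s - pi / b) n0 n3; first by move: sT; rewrite /halfT -/n; lra.
  by apply: Or44; left; rewrite sT /half_x /half_y leNgt sp.
- by apply: Or43; rewrite /half_x /half_y sp lexx; have [] := left_end a b x1 y b0.
Qed.

Lemma half_sol {R : realType} (a b c d x0 x1 y s : R) : 0 < b -> 0 < x1 -> 3 < x1 * x1 -> 0 < y ->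
  0 <= s <= halfT a b x1 y -> s != 0 -> s != halfT a b x1 y ->
  zsol a b c d x0 x1 (half_x a b x1 y) (half_y a b x1 y) s.
Proof.
move=> b0 x10 x13 y0 sT sn0 snT.
case: (half_pos a b x1 y s b0 x10 x13 y0 sT) => [[s0]|[s0p xs]|[_ xs _]|[[ps xs _]|[_ xs _]]].
- by rewrite s0 eqxx in sn0.
- apply: (zsol_near _ _ _ _ _ _ _ _ (left_x a b x1 y) (left_y a b x1 y)).
    have sp : s < pi / b by lra.
    have := cvg_lt_near _ _ _ (continuous_at_id s) sp; apply: filterS => r rp.
    by rewrite /half_x /half_y ltW.
  have xs' : left_x a b x1 y s < - (1/2) by move: xs; rewrite /half_x ifT//; lra.
  split => [_|H|H]; first exact: has_deriv_left.
    by exfalso; move: xs' H; clear; move: (left_x _ _ _ _ _) => z; lra.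
  by exfalso; move: xs' H; clear; move: (left_x _ _ _ _ _) => z; lra.
- by apply: zsol_line; left.
- apply: (zsol_near _ _ _ _ _ _ _ _ (fun r => cross_x (next a b x1 y) (r - pi / b))
            (fun r => cross_y (next a b x1 y) (r - pi / b))).
    have sp : pi / b < s by lra.
    have := cvg_gt_near _ _ _ (continuous_at_id s) sp; apply: filterS => r rp.
    by rewrite /half_x /half_y leNgt rp.
  apply: zsol_shift.
  have xs' : - (1/2) < cross_x (next a b x1 y) (s - pi / b) < 1/2.
    by move: xs; rewrite /half_x ifF//; apply/negbTE; rewrite -ltNge; lra.
  have nx1 : x1/2 < next a b x1 y by exact: next_gt.
  have P0 : Pz (- (1/2)) (- next a b x1 y) < 0 by apply: Pz_lt0; nra.
  split => [H|_|H]; last 2 first.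
  - exact: has_deriv_mid.
  - by exfalso; move: xs' H; clear; move: (cross_x _ _) => z; lra.
  by exfalso; move: xs' H; clear; move: (cross_x _ _) => z; lra.
- by apply: zsol_line; right.
Qed.

Lemma continuous_at_lin {R : realType} (x y : R -> R) (k l p q r : R) :
  {for r, continuous x} -> {for r, continuous y} ->
  {for r, continuous (fun r => k * (x r + p) - l * (y r + q))} /\
  {for r, continuous (fun r => l * (x r + p) + k * (y r + q))}.
Proof. by move=> cx cy; split; conti. Qed.

Lemma continuous_at_cubic {R : realType} (x y : R -> R) (r : R) :
  {for r, continuous x} -> {for r, continuous y} ->
  {for r, continuous (fun r => 4 * y r * (3 * x r * x r - y r * y r))}.
Proof. by move=> cx cy; conti. Qed.

Lemma half_lip {R : realType} (a b x1 y : R) : 0 < b -> 0 < x1 -> 3 < x1 * x1 -> 0 < y ->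
  loclip (half_x a b x1 y) /\ loclip (half_y a b x1 y).
Proof.
move=> b0 x10 x13 y0.
have nx1 : x1/2 < next a b x1 y by exact: next_gt.
have n0 : 0 < next a b x1 y by lra.
have P0 : Pz (- (1/2)) (- next a b x1 y) < 0 by apply: Pz_lt0; nra.
have [le1 le2] := left_end a b x1 y b0.
have [cs1 cs2] := cross_start _ n0.
have clx r : {for r, continuous (left_x a b x1 y)} by have [dx _] := has_deriv_left a b x1 y r; exact: has_deriv_continuous dx.
have cly r : {for r, continuous (left_y a b x1 y)} by have [_ dy] := has_deriv_left a b x1 y r; exact: has_deriv_continuous dy.
have ccx r : {for r, continuous (cross_x (next a b x1 y))}.
  by have [dx _] := has_deriv_mid _ (Qz (- (1/2)) (- next a b x1 y)) r P0; exact: has_deriv_continuous dx.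
have ccy r : {for r, continuous (cross_y (next a b x1 y))}.
  by have [_ dy] := has_deriv_mid _ (Qz (- (1/2)) (- next a b x1 y)) r P0; exact: has_deriv_continuous dy.
have cle r := continuous_at_lin _ _ a b (1/2) (x1/2) r (clx r) (cly r).
split.
  apply: (loclip_glue (left_x a b x1 y) (fun s => cross_x (next a b x1 y) (s - pi / b))).
  - apply: loclip_C1 => r; first by have [dx _] := has_deriv_left a b x1 y r; exact: dx.
    by have [A _] := cle r; exact: A.
  - apply: loclip_shift; apply: loclip_C1 => r.
      by have [dx _] := has_deriv_mid _ (Qz (- (1/2)) (- next a b x1 y)) r P0; exact: dx.
    exact: (continuous_at_cubic _ _ r (ccx r) (ccy r)).
  - by rewrite subrr le1 cs1.
apply: (loclip_glue (left_y a b x1 y) (fun s => cross_y (next a b x1 y) (s - pi / b))).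
- apply: loclip_C1 => r; first by have [_ dy] := has_deriv_left a b x1 y r; exact: dy.
  by have [_ A] := cle r; exact: A.
- apply: loclip_shift; apply: loclip_C1 => r.
    by have [_ dy] := has_deriv_mid _ (Qz (- (1/2)) (- next a b x1 y)) r P0; exact: dy.
  exact: (continuous_at_cubic _ _ r (ccy r) (ccx r)).
- by rewrite subrr le2 cs2.
Qed.

Lemma turn_avoids {R : realType} (a b c d x0 x1 y s : R) :
  0 < b -> 0 < d -> 0 < x0 -> 3 < x0 * x0 -> 0 < x1 -> 3 < x1 * x1 -> x0/2 < y ->
  0 <= s <= turnT a b c d x0 x1 y ->
  x0/2 < next c d x0 (next a b x1 y) ->
  ~ (- (1/2) <= turn_x a b c d x0 x1 y s <= 1/2 /\ - (x1/2) <= turn_y a b c d x0 x1 y s <= x0/2).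
Proof.
move=> b0 d0 x00 x03 x10 x13 yx sT ret.
have y0 : 0 < y by lra.
have nx1 : x1/2 < next a b x1 y by exact: next_gt.
have n0 : 0 < next a b x1 y by lra.
rewrite /turn_x /turn_y; case: (leP s (halfT a b x1 y)) => sh [X Y].
  have s1 : 0 <= s <= halfT a b x1 y by have /andP[-> _] := sT.
  by case: (half_pos a b x1 y s b0 x10 x13 y0 s1) => [[? ? ?]|[? ?]|[? ? ?]|[[? ? ?]|[? ? ?]]]; lra.
have s1 : 0 <= s - halfT a b x1 y <= halfT c d x0 (next a b x1 y) by move: sT; rewrite /turnT; lra.
by case: (half_pos c d x0 _ _ d0 x00 x03 n0 s1) => [[? ? ?]|[? ?]|[? ? ?]|[[? ? ?]|[? ? ?]]]; lra.
Qed.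

Lemma turn_lines {R : realType} (a b c d x0 x1 y s : R) :
  0 < b -> 0 < d -> 0 < x0 -> 3 < x0 * x0 -> 0 < x1 -> 3 < x1 * x1 -> 0 < y ->
  0 <= s <= turnT a b c d x0 x1 y ->
  turn_x a b c d x0 x1 y s = - (1/2) \/ turn_x a b c d x0 x1 y s = 1/2 ->
  s \in [:: 0; pi / b; halfT a b x1 y; halfT a b x1 y + pi / d; turnT a b c d x0 x1 y].
Proof.
move=> b0 d0 x00 x03 x10 x13 y0 sT.
have nx1 : x1/2 < next a b x1 y by exact: next_gt.
have n0 : 0 < next a b x1 y by lra.
rewrite /turn_x !inE; case: (leP s (halfT a b x1 y)) => sh X.
  have s1 : 0 <= s <= halfT a b x1 y by have /andP[-> _] := sT.
  case: (half_pos a b x1 y s b0 x10 x13 y0 s1) => [[-> _ _]|[_ ?]|[-> _ _]|[[_ ? _]|[-> _ _]]].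
  - by rewrite eqxx.
  - by exfalso; lra.
  - by rewrite eqxx !orbT.
  - by exfalso; lra.
  - by rewrite eqxx !orbT.
have s1 : 0 <= s - halfT a b x1 y <= halfT c d x0 (next a b x1 y) by move: sT; rewrite /turnT; lra.
case: (half_pos c d x0 _ _ d0 x00 x03 n0 s1) => [[E _ _]|[_ ?]|[E _ _]|[[_ ? _]|[E _ _]]].
- by rewrite (_ : s = halfT a b x1 y) ?eqxx ?orbT//; lra.
- by exfalso; lra.
- by rewrite (_ : s = halfT a b x1 y + pi / d) ?eqxx ?orbT//; lra.
- by exfalso; lra.
- by rewrite (_ : s = turnT a b c d x0 x1 y) ?eqxx ?orbT//; rewrite /turnT; lra.
Qed.

Lemma turn_sol {R : realType} (a b c d x0 x1 y s : R) :
  0 < b -> 0 < d -> 0 < x0 -> 3 < x0 * x0 -> 0 < x1 -> 3 < x1 * x1 -> 0 < y ->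
  0 < s < turnT a b c d x0 x1 y ->
  zsol a b c d x0 x1 (turn_x a b c d x0 x1 y) (turn_y a b c d x0 x1 y) s.
Proof.
move=> b0 d0 x00 x03 x10 x13 y0 /andP[s0 sT].
have nx1 : x1/2 < next a b x1 y by exact: next_gt.
have n0 : 0 < next a b x1 y by lra.
have [sh|sh|sh] := ltgtP s (halfT a b x1 y).
- apply: (zsol_near _ _ _ _ _ _ _ _ (half_x a b x1 y) (half_y a b x1 y)).
    have := cvg_lt_near _ _ _ (continuous_at_id s) sh; apply: filterS => r rp.
    by rewrite /turn_x /turn_y ltW.
  by apply: half_sol => //; [lra|rewrite gt_eqF|rewrite lt_eqF].
- pose T1 := halfT a b x1 y.
  apply: (zsol_near _ _ _ _ _ _ _ _
    (fun r => - half_x c d x0 (next a b x1 y) (r - T1)) (fun r => - half_y c d x0 (next a b x1 y) (r - T1))).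
    have := cvg_gt_near _ _ _ (continuous_at_id s) sh; apply: filterS => r rp.
    by rewrite /turn_x /turn_y leNgt rp.
  apply: zsolN; apply: zsol_shift; move: sT; rewrite /turnT -/T1 => sT; rewrite -/T1 in sh.
  apply: half_sol => //; first by lra.
    by rewrite subr_eq0 gt_eqF.
  by rewrite lt_eqF//; lra.
apply: zsol_line; right; rewrite /turn_x sh lexx.
by have [] := half_end a b x1 y n0.
Qed.

Lemma turn_lip {R : realType} (a b c d x0 x1 y : R) :
  0 < b -> 0 < d -> 0 < x0 -> 3 < x0 * x0 -> 0 < x1 -> 3 < x1 * x1 -> 0 < y ->
  loclip (turn_x a b c d x0 x1 y) /\ loclip (turn_y a b c d x0 x1 y).
Proof.
move=> b0 d0 x00 x03 x10 x13 y0.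
have nx1 : x1/2 < next a b x1 y by exact: next_gt.
have n0 : 0 < next a b x1 y by lra.
have [lx1 ly1] := half_lip a b x1 y b0 x10 x13 y0.
have [lx2 ly2] := half_lip c d x0 (next a b x1 y) d0 x00 x03 n0.
have [e1 e2] := half_end a b x1 y n0.
have [s1 s2] := half_start c d x0 (next a b x1 y) d0.
split.
  apply: (loclip_glue (half_x a b x1 y)
    (fun s => - half_x c d x0 (next a b x1 y) (s - halfT a b x1 y))) => //.
    by apply: loclipN; apply: loclip_shift.
  by rewrite subrr e1 s1 opprK.
apply: (loclip_glue (half_y a b x1 y)
    (fun s => - half_y c d x0 (next a b x1 y) (s - halfT a b x1 y))) => //.
  by apply: loclipN; apply: loclip_shift.
by rewrite subrr e2 s2.
Qed.

Lemma turn_ends {R : realType} (a b c d x0 x1 y : R) :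
  0 < b -> 0 < d -> 0 < x0 -> 0 < x1 -> 0 < y ->
  [/\ 0 < turnT a b c d x0 x1 y,
     turn_x a b c d x0 x1 y 0 = - (1/2), turn_y a b c d x0 x1 y 0 = y,
     turn_x a b c d x0 x1 y (turnT a b c d x0 x1 y) = - (1/2) &
     turn_y a b c d x0 x1 y (turnT a b c d x0 x1 y) = next c d x0 (next a b x1 y)].
Proof.
move=> b0 d0 x00 x10 y0.
have nx1 : x1/2 < next a b x1 y by exact: next_gt.
have n0 : 0 < next a b x1 y by lra.
have T1 := halfT_gt0 a b x1 y b0 x10 y0.
have T2 := halfT_gt0 c d x0 _ d0 x00 n0.
have m0 : 0 < next c d x0 (next a b x1 y) by have := next_gt c d x0 _ n0 x00; lra.
have [s1 s2] := half_start a b x1 y b0.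
have [e1 e2] := half_end c d x0 (next a b x1 y) m0.
rewrite /turn_x /turn_y (ltW T1) s1 s2 /turnT.
rewrite leNgt ltrDl T2 /=.
by rewrite [X in half_x c d x0 _ X]addrC [X in half_y c d x0 _ X]addrC addKr e1 e2 opprK; split => //; exact: addr_gt0.
Qed.

Definition cyc_x {R : realType} (a b c d x0 x1 : R) : R -> R :=
  let y := ystar a b c d x0 x1 in perext (turnT a b c d x0 x1 y) (turn_x a b c d x0 x1 y).
Definition cyc_y {R : realType} (a b c d x0 x1 : R) : R -> R :=
  let y := ystar a b c d x0 x1 in perext (turnT a b c d x0 x1 y) (turn_y a b c d x0 x1 y).

(** The index [n] depends on [t] but serves every [r] of the same period, so near an interior time
    the cycle is a shifted turn and derivatives transfer. *)
Lemma cycE {R : realType} (a b c d x0 x1 t : R) :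
  a < 0 -> 0 < b -> c < 0 -> 0 < d -> 0 < x0 -> 0 < x1 ->
  let ys := ystar a b c d x0 x1 in let T0 := turnT a b c d x0 x1 ys in
  exists2 n : int, 0 <= t - n%:~R * T0 < T0 &
   forall r, 0 <= r - n%:~R * T0 < T0 ->
   cyc_x a b c d x0 x1 r = turn_x a b c d x0 x1 ys (r - n%:~R * T0) /\
   cyc_y a b c d x0 x1 r = turn_y a b c d x0 x1 ys (r - n%:~R * T0).
Proof.
move=> a0 b0 c0 d0 x00 x10 ys T0.
have ysx : x0/2 < ys by exact: ystar_gt.
have [T00 _ _ _ _] := turn_ends a b c d x0 x1 ys b0 d0 x00 x10 (lt_trans (divr_gt0 x00 (ltr0Sn _ 1)) ysx).
have [n tn _] := floor_mod T0 t T00; exists n => // r rn.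
by rewrite /cyc_x /cyc_y -/ys -/T0 !(perextE _ _ _ n).
Qed.

Lemma cyc_sol {R : realType} (a b c d x0 x1 t : R) :
  a < 0 -> 0 < b -> c < 0 -> 0 < d -> 0 < x0 -> 3 < x0 * x0 -> 0 < x1 -> 3 < x1 * x1 ->
  zsol a b c d x0 x1 (cyc_x a b c d x0 x1) (cyc_y a b c d x0 x1) t.
Proof.
move=> a0 b0 c0 d0 x00 x03 x10 x13.
have ysx := ystar_gt a b c d x0 x1 a0 b0 c0 d0 x00 x10.
have ys0 : 0 < ystar a b c d x0 x1 by lra.
have [T00 s1 s2 _ _] := turn_ends a b c d x0 x1 _ b0 d0 x00 x10 ys0.
have [n tn nE] := cycE a b c d x0 x1 t a0 b0 c0 d0 x00 x10.
(* At the seam between two periods the cycle is on the left line, where [zsol] is void. *)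
have [t0|tn0] := eqVneq (t - n%:~R * turnT a b c d x0 x1 (ystar a b c d x0 x1)) 0.
  by apply: zsol_line; left; have [-> _] := nE t tn; rewrite t0.
set T0 := turnT _ _ _ _ _ _ _ in T00 s1 s2 tn nE tn0.
have t0 : 0 < t - n%:~R * T0 by rewrite lt_neqAle eq_sym tn0; lra.
apply: (zsol_near _ _ _ _ _ _ _ _ (fun r => turn_x a b c d x0 x1 (ystar a b c d x0 x1) (r - n%:~R * T0))
   (fun r => turn_y a b c d x0 x1 (ystar a b c d x0 x1) (r - n%:~R * T0))).
  have l1 : n%:~R * T0 < t by lra.
  have l2 : t < n%:~R * T0 + T0 by lra.
  apply: filterS2 (cvg_gt_near _ _ _ (continuous_at_id t) l1) (cvg_lt_near _ _ _ (continuous_at_id t) l2) => r r1 r2.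
  by apply: nE; lra.
apply: zsol_shift; apply: turn_sol => //; rewrite -/T0; lra.
Qed.

Lemma cyc_avoids {R : realType} (a b c d x0 x1 : R) :
  a < 0 -> 0 < b -> c < 0 -> 0 < d -> 0 < x0 -> 3 < x0 * x0 -> 0 < x1 -> 3 < x1 * x1 ->
  avoids x0 x1 (cyc_x a b c d x0 x1) (cyc_y a b c d x0 x1).
Proof.
move=> a0 b0 c0 d0 x00 x03 x10 x13 t.
have ysx := ystar_gt a b c d x0 x1 a0 b0 c0 d0 x00 x10.
have [n tn nE] := cycE a b c d x0 x1 t a0 b0 c0 d0 x00 x10.
have [-> ->] := nE t tn; apply: turn_avoids => //; first by lra.
have rm := return_map a b c d x0 x1 (ystar a b c d x0 x1) a0 b0 c0 d0.
by rewrite subrr mulr0 in rm; lra.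
Qed.

Lemma cyc_lip {R : realType} (a b c d x0 x1 : R) :
  a < 0 -> 0 < b -> c < 0 -> 0 < d -> 0 < x0 -> 3 < x0 * x0 -> 0 < x1 -> 3 < x1 * x1 ->
  (exists2 L, 0 <= L & forall u v, u <= v -> `|cyc_x a b c d x0 x1 v - cyc_x a b c d x0 x1 u| <= L * (v - u)) /\
  (exists2 L, 0 <= L & forall u v, u <= v -> `|cyc_y a b c d x0 x1 v - cyc_y a b c d x0 x1 u| <= L * (v - u)).
Proof.
move=> a0 b0 c0 d0 x00 x03 x10 x13.
have ysx := ystar_gt a b c d x0 x1 a0 b0 c0 d0 x00 x10.
have ys0 : 0 < ystar a b c d x0 x1 by lra.
have [T00 s1 s2 e1 e2] := turn_ends a b c d x0 x1 _ b0 d0 x00 x10 ys0.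
have [lx ly] := turn_lip a b c d x0 x1 _ b0 d0 x00 x03 x10 x13 ys0.
have rm := return_map a b c d x0 x1 (ystar a b c d x0 x1) a0 b0 c0 d0.
rewrite subrr mulr0 in rm.
by split; apply: perext_lip => //; [rewrite s1 e1|rewrite s2 e2; lra].
Qed.

Lemma cyc_periodic {R : realType} (a b c d x0 x1 : R) :
  a < 0 -> 0 < b -> c < 0 -> 0 < d -> 0 < x0 -> 0 < x1 ->
  let T0 := turnT a b c d x0 x1 (ystar a b c d x0 x1) in
  [/\ 0 < T0, periodic T0 (cyc_x a b c d x0 x1) & periodic T0 (cyc_y a b c d x0 x1)].
Proof.
move=> a0 b0 c0 d0 x00 x10.
have ysx := ystar_gt a b c d x0 x1 a0 b0 c0 d0 x00 x10.
have ys0 : 0 < ystar a b c d x0 x1 by lra.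
have [T00 _ _ _ _] := turn_ends a b c d x0 x1 _ b0 d0 x00 x10 ys0.
by split => //; exact: perext_periodic.
Qed.

Lemma cyc_start {R : realType} (a b c d x0 x1 : R) :
  a < 0 -> 0 < b -> c < 0 -> 0 < d -> 0 < x0 -> 0 < x1 ->
  cyc_x a b c d x0 x1 0 = - (1/2) /\ cyc_y a b c d x0 x1 0 = ystar a b c d x0 x1.
Proof.
move=> a0 b0 c0 d0 x00 x10.
have ysx := ystar_gt a b c d x0 x1 a0 b0 c0 d0 x00 x10.
have ys0 : 0 < ystar a b c d x0 x1 by lra.
have [T00 s1 s2 _ _] := turn_ends a b c d x0 x1 _ b0 d0 x00 x10 ys0.
rewrite /cyc_x /cyc_y !(perextE _ _ _ 0)// ?mul0r ?subrr ?T00 ?lexx//.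
Qed.

Lemma cyc_null {R : realType} (a b c d x0 x1 : R) :
  a < 0 -> 0 < b -> c < 0 -> 0 < d -> 0 < x0 -> 3 < x0 * x0 -> 0 < x1 -> 3 < x1 * x1 ->
  {ae (@lebesgue_measure R), forall t, cyc_x a b c d x0 x1 t != - (1/2) /\ cyc_x a b c d x0 x1 t != 1/2}.
Proof.
move=> a0 b0 c0 d0 x00 x03 x10 x13.
have ysx := ystar_gt a b c d x0 x1 a0 b0 c0 d0 x00 x10.
have ys0 : 0 < ystar a b c d x0 x1 by lra.
set ys := ystar _ _ _ _ _ _ in ysx ys0.
pose T0 := turnT a b c d x0 x1 ys.
(* Within one turn the lines are met only at these five times, by [turn_lines]; their translates by
   multiples of [T0] form a countable set. *)
pose brk := [:: 0; pi / b; halfT a b x1 ys; halfT a b x1 ys + pi / d; T0].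
pose N := \bigcup_(k in [set: int * 'I_5]) [set brk`_k.2 + k.1%:~R * T0].
have cN : countable N.
  by apply: bigcup_countable => // k _; exact: countable1.
exists N; split.
- by apply: countable_measurable => // t; exact: measurable_set1.
- exact: countable_lebesgue_measure0.
move=> t /= nt.
have [n tn nE] := cycE a b c d x0 x1 t a0 b0 c0 d0 x00 x10.
have [xE _] := nE t tn.
have X : cyc_x a b c d x0 x1 t = - (1/2) \/ cyc_x a b c d x0 x1 t = 1/2.
  apply: contrapT => no; apply: nt; split; apply/eqP => E; apply: no; by [left|right].
rewrite xE in X.
have tn' : 0 <= t - n%:~R * T0 <= T0 by move: tn => /andP[-> /ltW].
have mem := turn_lines a b c d x0 x1 ys _ b0 d0 x00 x03 x10 x13 ys0 tn' X.
have im : (index (t - n%:~R * T0)%R brk < 5)%N by rewrite -[5%N]/(size brk) index_mem.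
exists (n, Ordinal im) => //=.
by rewrite nth_index// subrK.
Qed.

(** * The Riemann sphere *)

Lemma normc_ge_coord {R : realType} (w z : R[i]) :
  `|complex.Re w - complex.Re z|%:C <= `|w - z| /\ `|complex.Im w - complex.Im z|%:C <= `|w - z|.
Proof.
case: w z => [p q] [r s] /=; rewrite normc_def /= !lecR -!sqrtr_sqr.
by split; rewrite ler_wsqrtr// ?lerDl ?lerDr sqr_ge0.
Qed.

Lemma Re_continuous {R : realType} : continuous (@complex.Re R : (R[i])^o -> R).
Proof.
move=> w A /nbhs_ballP[e /= e0 eA].
have e0' : (0 : R[i]) < e%:C by rewrite ltcR.
apply/nbhs_ballP; exists e%:C => // z; rewrite -ball_normE /= => wz; apply: eA.
rewrite /ball/= -ltcR; apply: le_lt_trans wz; exact: (normc_ge_coord _ _).1.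
Qed.

Lemma Im_continuous {R : realType} : continuous (@complex.Im R : (R[i])^o -> R).
Proof.
move=> w A /nbhs_ballP[e /= e0 eA].
have e0' : (0 : R[i]) < e%:C by rewrite ltcR.
apply/nbhs_ballP; exists e%:C => // z; rewrite -ball_normE /= => wz; apply: eA.
rewrite /ball/= -ltcR; apply: le_lt_trans wz; exact: (normc_ge_coord _ _).2.
Qed.

Lemma mkC_continuous {R : realType} (T : topologicalType) (f g : T -> R) (t : T) :
  {for t, continuous f} -> {for t, continuous g} ->
  {for t, continuous ((fun r => (f r +i* g r)%C) : T -> (R[i])^o)}.
Proof.
move=> cf cg A /nbhs_ballP[[e e']]; rewrite /= ltcE/= => /andP[/eqP -> e0 eA].
have e20 : 0 < e / 2 by rewrite divr_gt0.
move/cvgrPdist_lt/(_ _ e20): cf => cf; move/cvgrPdist_lt/(_ _ e20): cg => cg.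
apply: filterS2 cf cg => r fr gr /=; apply: eA; rewrite -ball_normE /=.
rewrite normc_def ltcR/=.
rewrite -[e]ger0_norm ?ltW// -sqrtr_sqr ltr_sqrt ?exprn_gt0//.
move: fr gr; set u := f t - f r; set v := g t - g r.
rewrite !ltr_norml => /andP[u1 u2] /andP[v1 v2].
have : 0 < (e / 2 - u) * (e / 2 + u) by rewrite mulr_gt0//; lra.
have : 0 < (e / 2 - v) * (e / 2 + v) by rewrite mulr_gt0//; lra.
have : 0 < e * e by rewrite mulr_gt0.
by clear; lra.
Qed.

(** [nsq w] is [|w - 1|^2], and [zx k w + i zy w] is [k + 1 / (w - 1)]. [zxo] and [zyo] extend this
    chart by sending infinity to [z = k], and [psi] is its inverse; the point [w = 1] corresponds to
    no finite [z]. *)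
Definition nsq {R : realType} (w : R[i]) :=
  (complex.Re w - 1) * (complex.Re w - 1) + complex.Im w * complex.Im w.
Definition zx {R : realType} (k : R) (w : R[i]) := k + (complex.Re w - 1) * (nsq w)^-1.
Definition zy {R : realType} (w : R[i]) := - (complex.Im w * (nsq w)^-1).
Definition zxo {R : realType} (k : R) (p : riemann_sphere R) := if p is Some w then zx k w else k.
Definition zyo {R : realType} (p : riemann_sphere R) := if p is Some w then zy w else 0.
Definition psi {R : realType} (k x y : R) : riemann_sphere R :=
  if (x == k) && (y == 0) then None else
  Some ((1 + (x - k) * ((x - k) * (x - k) + y * y)^-1) +i*
        (- (y * ((x - k) * (x - k) + y * y)^-1)))%C.

Lemma nsq_gt0 {R : realType} (w : R[i]) : w != 1 -> 0 < nsq w.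
Proof.
rewrite eq_complex /= negb_and => /orP[u|v].
  by rewrite /nsq addrC sumsq_gt0// subr_eq0.
by rewrite /nsq sumsq_gt0.
Qed.

Lemma den_gt0 {R : realType} (k x y : R) : ~~ ((x == k) && (y == 0)) ->
  0 < (x - k) * (x - k) + y * y.
Proof.
rewrite negb_and => /orP[u|v].
  by rewrite addrC sumsq_gt0// subr_eq0.
by rewrite sumsq_gt0.
Qed.

Lemma zxo_psi {R : realType} (k x y : R) : zxo k (psi k x y) = x /\ zyo (psi k x y) = y.
Proof.
rewrite /psi; case: ifPn => [/andP[/eqP -> /eqP ->]//|/den_gt0 D0] /=.
have Dn0 : (x - k) * (x - k) + y * y != 0 by rewrite gt_eqF.
have nE : nsq ((1 + (x - k) * ((x - k) * (x - k) + y * y)^-1) +i*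
        (- (y * ((x - k) * (x - k) + y * y)^-1)))%C = ((x - k) * (x - k) + y * y)^-1.
  by rewrite /nsq /=; field.
by rewrite /zx /zy nE /= invrK; split; field.
Qed.

Lemma psi_zxo {R : realType} (k : R) (p : riemann_sphere R) : p <> Some 1 ->
  psi k (zxo k p) (zyo p) = p.
Proof.
case: p => [w|] w1; last by rewrite /psi /= !eqxx.
have {}w1 : w != 1 by apply/eqP => E; apply: w1; rewrite E.
have N0 := nsq_gt0 w w1; have Nn0 : nsq w != 0 by rewrite gt_eqF.
have DE : (zx k w - k) * (zx k w - k) + zy w * zy w = (nsq w)^-1.
  have E : nsq w = (complex.Re w - 1) * (complex.Re w - 1) + complex.Im w * complex.Im w by [].
  transitivity (((complex.Re w - 1) * (complex.Re w - 1) + complex.Im w * complex.Im w) / (nsq w * nsq w)).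
    by rewrite /zx /zy; field.
  by rewrite -E; field.
rewrite /psi /= DE ifF.
  congr Some; apply/eqP; rewrite eq_complex /zx /zy /=; apply/andP; split; apply/eqP; by field.
apply/negbTE; rewrite negb_and -!(subr_eq0 _ k) -negb_and; apply/negP => /andP[/eqP u /eqP v].
move: DE; rewrite u v !mul0r addr0 => /esym/eqP; by rewrite invr_eq0 gt_eqF.
Qed.

Lemma psi_neq1 {R : realType} (k x y : R) : psi k x y <> Some 1.
Proof.
rewrite /psi; case: ifPn => // /den_gt0 D0 [] /eqP; rewrite eq_sym addrC -subr_eq subrr eq_sym.
rewrite mulf_eq0 invr_eq0 (gt_eqF D0) orbF => /eqP u /eqP.
rewrite oppr_eq0 mulf_eq0 invr_eq0 (gt_eqF D0) orbF => /eqP v.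
by move: D0; rewrite u v !mul0r addr0 ltxx.
Qed.

Lemma nsq_continuous {R : realType} : continuous (nsq : (R[i])^o -> R).
Proof.
move=> w; have cr := Re_continuous w; have ci := Im_continuous w.
have {}cr : {for (w : (R[i])^o), continuous (fun z : (R[i])^o => complex.Re z)} by [].
have {}ci : {for (w : (R[i])^o), continuous (fun z : (R[i])^o => complex.Im z)} by [].
change {for w, continuous (fun z : (R[i])^o => (complex.Re z - 1) * (complex.Re z - 1) + complex.Im z * complex.Im z)}.
by conti.
Qed.

Lemma zx_continuous {R : realType} (k : R) (w : R[i]) : w != 1 ->
  {for (w : (R[i])^o), continuous (zx k : (R[i])^o -> R)}.
Proof.
move=> w1; have N0 : nsq w != 0 by rewrite gt_eqF// nsq_gt0.
have cr : {for (w : (R[i])^o), continuous (fun z : (R[i])^o => complex.Re z)} by exact: Re_continuous.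
have cn : {for (w : (R[i])^o), continuous (fun z : (R[i])^o => nsq z)} by exact: nsq_continuous.
change {for (w : (R[i])^o), continuous (fun z : (R[i])^o => k + (complex.Re z - 1) * (nsq z)^-1)}.
by conti.
Qed.

Lemma zy_continuous {R : realType} (w : R[i]) : w != 1 ->
  {for (w : (R[i])^o), continuous (zy : (R[i])^o -> R)}.
Proof.
move=> w1; have N0 : nsq w != 0 by rewrite gt_eqF// nsq_gt0.
have ci : {for (w : (R[i])^o), continuous (fun z : (R[i])^o => complex.Im z)} by exact: Im_continuous.
have cn : {for (w : (R[i])^o), continuous (fun z : (R[i])^o => nsq z)} by exact: nsq_continuous.
change {for (w : (R[i])^o), continuous (fun z : (R[i])^o => - (complex.Im z * (nsq z)^-1))}.
by conti.
Qed.

Definition box {R : realType} (M : R) : set (R[i])^o :=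
  [set w | - M <= complex.Re w <= M /\ - M <= complex.Im w <= M].

(** The complements of these boxes, with infinity added, are the neighborhoods of infinity used for
    the continuity of the chart. *)
Lemma box_compact {R : realType} (M : R) : compact (@box R M) /\ closed (@box R M).
Proof.
have c : closed (@box R M).
  rewrite (_ : box M = (@complex.Re R : (R[i])^o -> R) @^-1` `[- M, M]%classic `&`
     (@complex.Im R : (R[i])^o -> R) @^-1` `[- M, M]%classic).
    apply: closedI; apply: closed_comp => //.
    + by move=> w _; exact: Re_continuous.
    + exact: itv_closed.
    + by move=> w _; exact: Im_continuous.
    + exact: itv_closed.
  by apply/seteqP; split => w /=; rewrite /box /= !in_itv/=.
split => //.
pose f (p : R * R) : (R[i])^o := (p.1 +i* p.2)%C.
have cf : continuous f.
  move=> p; apply: mkC_continuous; [exact: cvg_fst|exact: cvg_snd].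
have -> : box M = f @` (`[- M, M]%classic `*` `[- M, M]%classic).
  apply/seteqP; split => [w [A B]|w [[p q] /= [A B] <-]].
    exists (complex.Re w, complex.Im w); first by split; rewrite /= in_itv.
    by rewrite /f/=; case: (w).
  by move: A B; rewrite !in_itv.
apply: continuous_compact; first exact: continuous_subspaceT.
by apply: compact_setX; exact: segment_compact.
Qed.

(* Inversion z = k + 1 / (w - 1) is an involution up to translation, so one
   formula gives its differential in both directions. *)
Definition inv_d1 {R : realType} (p q u v : R) :=
  ((q * q - p * p) * u - 2 * p * q * v) * ((p * p + q * q) * (p * p + q * q))^-1.
Definition inv_d2 {R : realType} (p q u v : R) :=
  (2 * p * q * u + (q * q - p * p) * v) * ((p * p + q * q) * (p * p + q * q))^-1.

Definition pull1 {R : realType} (w v : R[i]) :=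
  inv_d1 (complex.Re w - 1) (complex.Im w) (complex.Re v) (complex.Im v).
Definition pull2 {R : realType} (w v : R[i]) :=
  inv_d2 (complex.Re w - 1) (complex.Im w) (complex.Re v) (complex.Im v).

(** [pull1] and [pull2] are the components of [- v / (w - 1)^2], the velocity of [z]. Of the two
    zone clauses, the one on closures carries Filippov velocities from w to z; the one on open zones
    carries them back, off the lines. *)
Definition conj_sys {R : realType} (k a b c d x0 x1 : R) (S : pw_system R) :=
  forall w : R[i], w != 1 ->
  let x := zx k w in let y := zy w in
  [/\ [/\ closure (zone_p S : set (R[i])^o) w -> x <= - (1/2),
          closure (zone_c S : set (R[i])^o) w -> - (1/2) <= x <= 1/2
        & closure (zone_m S : set (R[i])^o) w -> 1/2 <= x],
      [/\ x < - (1/2) -> zone_p S w, - (1/2) < x < 1/2 -> zone_c S w & 1/2 < x -> zone_m S w],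
      pull1 w (field_p S w) = a * (x + 1/2) - b * (y + x1/2) /\
      pull2 w (field_p S w) = b * (x + 1/2) + a * (y + x1/2),
      pull1 w (field_c S w) = 4 * y * (3 * x * x - y * y) /\
      pull2 w (field_c S w) = 4 * x * (3 * y * y - x * x)
    & pull1 w (field_m S w) = c * (x - 1/2) - d * (y - x0/2) /\
      pull2 w (field_m S w) = d * (x - 1/2) + c * (y - x0/2)].

(** At infinity: outside the box of half side [1 + 1/e] one has [|w - 1| > 1/e], so both coordinates
    of [z - k] are smaller than [e]. *)
Lemma zxo_continuous {R : realType} (k : R) (p : riemann_sphere R) : p <> Some 1 ->
  {for p, continuous (zxo k)} /\ {for p, continuous (@zyo R)}.
Proof.
case: p => [w|] w1.
  have {}w1 : w != 1 by apply/eqP => E; apply: w1; rewrite E.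
  by split=> A nA; [exact: (zx_continuous k w w1 A nA)|exact: (zy_continuous w w1 A nA)].
have far e (w : R[i]) : 0 < e -> ~ box (1 + e^-1) w ->
    `|k - zx k w| < e /\ `|0 - zy w| < e.
  move=> e0 nb; pose p := complex.Re w - 1; pose q := complex.Im w.
  have ie0 : 0 < e^-1 by rewrite invr_gt0.
  have N0 : e^-1 * e^-1 < p * p + q * q.
    rewrite ltNge; apply/negP => H; apply: nb.
    have pp : 0 <= p * p by rewrite -expr2 sqr_ge0.
    have qq : 0 <= q * q by rewrite -expr2 sqr_ge0.
    have P : - e^-1 <= p <= e^-1 by apply/andP; split; move: ie0 pp qq H; clear; nra.
    have Q : - e^-1 <= q <= e^-1 by apply/andP; split; move: ie0 pp qq H; clear; nra.
    by move: P Q ie0; rewrite /box /= /p /q; clear; lra.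
  have NE : nsq w = p * p + q * q by [].
  have N1 : 0 < nsq w by rewrite NE; apply: lt_trans N0; rewrite mulr_gt0.
  have Nn : nsq w != 0 by rewrite gt_eqF.
  have eN : nsq w < e * e * (nsq w * nsq w).
    rewrite mulrA -[X in X < _]mul1r ltr_pM2r//.
    have := N0; rewrite -NE -(ltr_pM2l (mulr_gt0 e0 e0)) (_ : e * e * (e^-1 * e^-1) = 1)//.
    by field; rewrite gt_eqF.
  have X : (p / nsq w) ^+ 2 < e ^+ 2 /\ (q / nsq w) ^+ 2 < e ^+ 2.
    rewrite !expr_div_n !ltr_pdivrMr ?exprn_gt0// !expr2.
    have pp : 0 <= p * p by rewrite -expr2 sqr_ge0.
    have qq : 0 <= q * q by rewrite -expr2 sqr_ge0.
    by move: pp qq eN NE; clear; split; lra.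
  have sqlt (u : R) : u ^+ 2 < e ^+ 2 -> `|u| < e.
    by move=> H; rewrite -[e]gtr0_norm// -!sqrtr_sqr ltr_sqrt// exprn_gt0.
  have e1 : k - zx k w = - (p / nsq w) by rewrite /zx -/p; ring.
  have e2 : 0 - zy w = q / nsq w by rewrite /zy -/q; ring.
  by rewrite e1 e2 normrN; have [/sqlt X1 /sqlt X2] := X.
split => A /nbhs_ballP[e /= e0 eA].
  exists (box (1 + e^-1)); first exact: box_compact.
  move=> _ [[w nb <-]|->]; apply: eA; rewrite /ball/=; last by rewrite subrr normr0.
  exact: (far e w e0 nb).1.
exists (box (1 + e^-1)); first exact: box_compact.
move=> _ [[w nb <-]|->]; apply: eA; rewrite /ball/=; last by rewrite subrr normr0.
exact: (far e w e0 nb).2.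
Qed.

Lemma isolated_near {R : realType} (bad : R -> Prop) (t : R) : isolated bad -> ~ bad t ->
  \forall r \near t, ~ bad r.
Proof.
move=> /(_ t)/near_dnbhs[d d0 dP] nt; apply/nbhs_ballP; exists d => // r; rewrite /ball/= distrC => rt.
by have [->|/dP] := eqVneq r t; last exact.
Qed.

Lemma has_deriv_inv {R : realType} (u v : R -> R) (k t u' v' : R) : 0 < (u t - 1) * (u t - 1) + v t * v t ->
  has_deriv u t u' -> has_deriv v t v' ->
  has_deriv (fun r => k + (u r - 1) * ((u r - 1) * (u r - 1) + v r * v r)^-1) t
    (inv_d1 (u t - 1) (v t) u' v') /\
  has_deriv (fun r => - (v r * ((u r - 1) * (u r - 1) + v r * v r)^-1)) t
    (inv_d2 (u t - 1) (v t) u' v').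
Proof.
move=> N0 du dv; have Nn : (u t - 1) * (u t - 1) + v t * v t != 0 by rewrite gt_eqF.
by split; (apply: has_deriv_eq; first by der); cbn beta; rewrite /inv_d1 /inv_d2; field.
Qed.

(** Off infinity the chart is rational with nonvanishing denominator, so absolute continuity and
    derivatives transfer. Its differential is linear, so the convex weights are unchanged. *)
Lemma to_z {R : realType} (k a b c d x0 x1 : R) (S : pw_system R) (g : R -> riemann_sphere R) :
  conj_sys k a b c d x0 x1 S -> trajectory S g ->
  ztraj a b c d x0 x1 (fun t => g t = None) (fun t => zxo k (g t)) (fun t => zyo (g t)).
Proof.
move=> cS [cg isg g1 acg aeg]; split.
- by move=> t; apply: continuous_comp; [exact: cg|exact: (zxo_continuous k _ (g1 t)).1].
- by move=> t; apply: continuous_comp; [exact: cg|exact: (zxo_continuous k _ (g1 t)).2].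
- exact: isg.
- have nsqE r : g r <> None -> (re_curve g r - 1) * (re_curve g r - 1) + im_curve g r * im_curve g r != 0.
    rewrite /re_curve /im_curve; have := g1 r; case: (g r) => [w|//] w1 _ /=.
    by rewrite -/(nsq w) gt_eqF// nsq_gt0//; apply/eqP => E; apply: w1; rewrite E.
  move=> s t; split=> p q sp qt nb.
    have [acr aci] := acg p q nb.
    apply: (@AC_eq R (fun r => k + (re_curve g r - 1) *
      ((re_curve g r - 1) * (re_curve g r - 1) + im_curve g r * im_curve g r)^-1)).
      by move=> r rr; rewrite /re_curve /im_curve; have := nb r rr; case: (g r).
    by acs => r rr; apply: nsqE; exact: nb.
  have [acr aci] := acg p q nb.
  apply: (@AC_eq R (fun r => - (im_curve g r *
      ((re_curve g r - 1) * (re_curve g r - 1) + im_curve g r * im_curve g r)^-1))).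
    by move=> r rr; rewrite /re_curve /im_curve; have := nb r rr; case: (g r).
  by acs => r rr; apply: nsqE; exact: nb.
- apply: ae_imp aeg => t [w [v [gt [[[k1 k2] k3] [k0 ks kz vE]] du dv]]].
  have w1 : w != 1 by apply/eqP => E; apply: (g1 t); rewrite gt E.
  have [[z1 z2 z3] _ [p1 p2] [c1 c2] [m1 m2]] := cS w w1.
  have rE : re_curve g t = complex.Re w by rewrite /re_curve gt.
  have iE : im_curve g t = complex.Im w by rewrite /im_curve gt.
  have N0 := nsq_gt0 w w1.
  have [|dx dy] := has_deriv_inv (re_curve g) (im_curve g) k t _ _ _ du dv; first by rewrite rE iE.
  rewrite rE iE in dx dy.
  have nb : \forall r \near t, g r <> None by apply: isolated_near => //; rewrite gt.
  exists (pull1 w v), (pull2 w v); split.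
  + exists k1, k2, k3; rewrite gt /=; split => //.
    * by case: kz => K1 K2 K3; split => [/K1/z1|/K2/z2|/K3/z3].
    * rewrite -p1 -c1 -m1 vE /pull1 /inv_d1.
      case: (field_p S w) (field_c S w) (field_m S w) => [f1 f2] [f3 f4] [f5 f6] /=.
      by clear; ring.
    * rewrite -p2 -c2 -m2 vE /pull2 /inv_d2.
      case: (field_p S w) (field_c S w) (field_m S w) => [f1 f2] [f3 f4] [f5 f6] /=.
      by clear; ring.
  + apply: has_deriv_near dx; apply: filterS nb => r.
    by rewrite /re_curve /im_curve /zxo; case: (g r).
  + apply: has_deriv_near dy; apply: filterS nb => r.
    by rewrite /re_curve /im_curve /zyo; case: (g r).
Qed.

Lemma inv_invol {R : realType} (X Y v1 v2 : R) : X * X + Y * Y != 0 ->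
  let p := X * (X * X + Y * Y)^-1 in let q := - (Y * (X * X + Y * Y)^-1) in
  inv_d1 X Y (inv_d1 p q v1 v2) (inv_d2 p q v1 v2) = v1 /\
  inv_d2 X Y (inv_d1 p q v1 v2) (inv_d2 p q v1 v2) = v2.
Proof.
move=> D0 p q.
have pq : p * p + q * q = (X * X + Y * Y)^-1 by rewrite /p /q; field.
rewrite /inv_d1 /inv_d2 pq /p /q; move: D0; clear => D0.
by split; field.
Qed.

Lemma psi_None {R : realType} (k x y : R) : psi k x y = None <-> (x = k /\ y = 0).
Proof.
rewrite /psi; case: ifPn => [/andP[/eqP -> /eqP ->]//|nb]; split => // -[xk y0].
by move: nb; rewrite xk y0 !eqxx.
Qed.

(** A neighborhood of infinity contains the complement of a compact [K], on which [|w - 1|^2] is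
    bounded. Being the inverse of [|z - k|^2], it exceeds that bound once [z] is close to [k]. *)
Lemma psi_cvg_None {R : realType} (k : R) (x y : R -> R) (t : R) :
  {for t, continuous x} -> {for t, continuous y} -> x t = k -> y t = 0 ->
  {for t, continuous (fun r => psi k (x r) (y r))}.
Proof.
move=> cx cy xt yt; have g0 : psi k (x t) (y t) = None by apply/psi_None.
move=> A nA; have {nA} [K [cK clK] KA] : nbhs (None : riemann_sphere R) A by rewrite -g0.
have [B BP] : exists B, forall w, K w -> nsq w <= B.
  have [->|/set0P K0] := eqVneq K set0; first by exists 0.
  have cn : {within K, continuous (nsq : (R[i])^o -> R)}.
    by apply: continuous_subspaceT => w; exact: nsq_continuous.
  have [w Kw wP] := compact_EVT_max K0 cK cn.
  by exists (nsq w) => z Kz; apply: wP; rewrite inE.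
pose D r := (x r - k) * (x r - k) + y r * y r.
have cD : {for t, continuous D} by rewrite /D; conti.
have B1 : 0 < `|B| + 1 by rewrite ltr_wpDl.
have Dt : D t < (`|B| + 1)^-1 by rewrite /D xt yt subrr !mul0r addr0 invr_gt0.
apply: filterS (cvg_lt_near _ _ _ cD Dt) => r Dr; apply: KA => /=.
rewrite /psi; case: ifPn => nb; first by right.
left; eexists; last by reflexivity.
move=> /BP; have D0 := den_gt0 _ _ _ nb.
have -> : nsq ((1 + (x r - k) * ((x r - k) * (x r - k) + y r * y r)^-1) +i*
        (- (y r * ((x r - k) * (x r - k) + y r * y r)^-1)))%C = (D r)^-1.
  by rewrite /nsq /= /D; field; rewrite gt_eqF.
apply/negP; rewrite -ltNge; apply: le_lt_trans (ler_norm B) _.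
apply: (@lt_trans _ _ (`|B| + 1)); first by rewrite ltrDl.
by rewrite -[`|B| + 1]invrK ltf_pV2 ?posrE// invr_gt0.
Qed.

Lemma psi_Some {R : realType} (k x y : R) : ~ (x = k /\ y = 0) ->
  psi k x y = Some ((1 + (x - k) * ((x - k) * (x - k) + y * y)^-1) +i*
        (- (y * ((x - k) * (x - k) + y * y)^-1)))%C /\ 0 < (x - k) * (x - k) + y * y.
Proof.
move=> nb; have nb' : ~~ ((x == k) && (y == 0)) by apply/negP => /andP[/eqP ? /eqP ?]; exact: nb.
by split; [rewrite /psi (negbTE nb')|exact: den_gt0].
Qed.

(** Off the two lines a nonzero weight identifies the zone containing the point, and a zone lies in
    its closure; hence the assumption that the lines are met only on a null set of times. *)
Lemma from_z {R : realType} (k a b c d x0 x1 : R) (S : pw_system R) (x y : R -> R) :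
  let bad t := x t = k /\ y t = 0 in
  conj_sys k a b c d x0 x1 S -> ztraj a b c d x0 x1 bad x y ->
  {ae (@lebesgue_measure R), forall t, x t != - (1/2) /\ x t != 1/2} ->
  {ae (@lebesgue_measure R), forall t, ~ bad t} ->
  trajectory S (fun t => psi k (x t) (y t)).
Proof.
move=> bad cS [cx cy isb acxy aexy] ael aeb; split.
- move=> t; have [[xt yt]|nb] := pselect (bad t).
    by apply: psi_cvg_None => //; [exact: cx|exact: cy].
  have [gt D0] := psi_Some _ _ _ nb.
  pose h r : (R[i])^o := ((1 + (x r - k) * ((x r - k) * (x r - k) + y r * y r)^-1) +i*
        (- (y r * ((x r - k) * (x r - k) + y r * y r)^-1)))%C.
  have cxt := cx t; have cyt := cy t.
  have Dn : (x t - k) * (x t - k) + y t * y t != 0 by rewrite gt_eqF.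
  have ch : {for t, continuous h}.
    by apply: mkC_continuous; conti.
  move=> A nA; have nA0 : nbhs (Some (h t) : riemann_sphere R) A by rewrite -gt.
  have nA' : nbhs (h t) (fun w => A (Some w)) by exact: nA0.
  have nh : \forall r \near t, A (Some (h r)) by exact: ch _ nA'.
  apply: filterS2 (isolated_near _ _ isb nb) nh => r /psi_Some[E _] /= H.
  by rewrite E.
- by move=> t; apply: filterS (isb t) => r nb /psi_None.
- by move=> t; exact: psi_neq1.
- move=> s t nb.
  have nb' r : s <= r <= t -> ~ bad r by move=> rr br; apply: (nb r rr); apply/psi_None.
  have [acx _] := acxy s t; have [_ acy] := acxy s t.
  have {}acx := acx s t (lexx s) (lexx t) nb'; have {}acy := acy s t (lexx s) (lexx t) nb'.
  split.
    apply: (@AC_eq R (fun r => 1 + (x r - k) * ((x r - k) * (x r - k) + y r * y r)^-1)).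
      by move=> r /nb'/psi_Some[E _]; rewrite /re_curve E.
    by acs => r /nb'/psi_Some[_ D0]; rewrite gt_eqF.
  apply: (@AC_eq R (fun r => - (y r * ((x r - k) * (x r - k) + y r * y r)^-1))).
    by move=> r /nb'/psi_Some[E _]; rewrite /im_curve E.
  by acs => r /nb'/psi_Some[_ D0]; rewrite gt_eqF.
- have ae2 : {ae (@lebesgue_measure R), forall t, (x t != - (1/2) /\ x t != 1/2) /\ ~ bad t}.
    move: ael aeb => [N1 [mN1 N10 NP1]] [N2 [mN2 N20 NP2]].
    exists (N1 `|` N2); split; first exact: measurableU.
      by apply: null_set_setU.
    move=> t nt; have [l|nl] := pselect (x t != - (1/2) /\ x t != 1/2).
      by right; apply: NP2 => nb; apply: nt.
    by left; apply: NP1.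
  have {}ae2 : {ae (@lebesgue_measure R), forall t, ((x t != - (1/2) /\ x t != 1/2) /\ ~ bad t) /\
     exists vx vy : R,
        [/\ zfil a b c d x0 x1 (x t) (y t) vx vy, has_deriv x t vx & has_deriv y t vy]}.
    move: ae2 aexy => [N1 [mN1 N10 NP1]] [N2 [mN2 N20 NP2]].
    exists (N1 `|` N2); split; first exact: measurableU.
      by apply: null_set_setU.
    move=> t /= /not_andP[nt|nt]; [left; exact: NP1|right; exact: NP2].
  apply: ae_imp ae2 => t [[[/eqP l1 /eqP l2] nb] [vx [vy [[k1 [k2 [k3 [k0 ks [i1 i2 i3] vxE vyE]]]] dx dy]]]].
  have [gt D0] := psi_Some _ _ _ nb; have Dn : (x t - k) * (x t - k) + y t * y t != 0 by rewrite gt_eqF.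
  set w := (_ +i* _)%C in gt.
  have [zxE zyE] := zxo_psi k (x t) (y t); rewrite gt /= in zxE zyE.
  have w1 : w != 1 by apply/eqP => E; apply: (psi_neq1 k (x t) (y t)); rewrite gt E.
  have [_ [z1 z2 z3] [p1 p2] [c1 c2] [m1 m2]] := cS w w1.
  rewrite zxE zyE in z1 z2 z3 p1 p2 c1 c2 m1 m2.
  pose v : R[i] := k1%:C * field_p S w + k2%:C * field_c S w + k3%:C * field_m S w.
  exists w, v.
  have v1 : vx = pull1 w v.
    rewrite vxE -p1 -c1 -m1 /v /pull1 /inv_d1.
    case: (field_p S w) (field_c S w) (field_m S w) => [f1 f2] [f3 f4] [f5 f6] /=.
    by clear; ring.
  have v2 : vy = pull2 w v.
    rewrite vyE -p2 -c2 -m2 /v /pull2 /inv_d2.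
    case: (field_p S w) (field_c S w) (field_m S w) => [f1 f2] [f3 f4] [f5 f6] /=.
    by clear; ring.
  have du : has_deriv (fun r => x r - k + 1) t vx by apply: has_deriv_eq; [der|ring].
  (* [has_deriv_inv] inverts about 1, so [z] is shifted by [1 - k]; with base 1 the result is
     [w = 1 + 1 / (z - k)]. *)
  have [|dU dV0] := has_deriv_inv (fun r => x r - k + 1) y 1 t vx vy _ du dy; first by rewrite addrK.
  have [V1 V2] := inv_invol (x t - k) (y t) (complex.Re v) (complex.Im v) Dn.
  have wE1 : complex.Re w - 1 = (x t - k) * ((x t - k) * (x t - k) + y t * y t)^-1.
    by rewrite /w /= addrC addKr.
  have nrb : \forall r \near t, ~ bad r by exact: isolated_near.
  split => //.
  + exists (k1, k2, k3); split => //; split => K.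
    * by apply: subset_closure; apply: z1; rewrite lt_neqAle i1// andbT; exact/eqP.
    * by apply: subset_closure; apply: z2; have /andP[i21 i22] := i2 K; rewrite !lt_neqAle i21 i22 !andbT eq_sym; apply/andP; split; exact/eqP.
    * by apply: subset_closure; apply: z3; rewrite lt_neqAle i3// andbT eq_sym; exact/eqP.
  + have : has_deriv (re_curve (fun r => psi k (x r) (y r))) t (complex.Re v).
      rewrite -V1 -wE1 -/(pull1 w v) -/(pull2 w v) -v1 -v2.
      rewrite addrK in dU; apply: has_deriv_near dU.
      by apply: filterS nrb => r /psi_Some[E _]; rewrite /re_curve E /= !addrK.
    by [].
  + have : has_deriv (im_curve (fun r => psi k (x r) (y r))) t (complex.Im v).
      rewrite -V2 -wE1 -/(pull1 w v) -/(pull2 w v) -v1 -v2.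
      rewrite addrK in dV0; apply: has_deriv_near dV0.
      by apply: filterS nrb => r /psi_Some[E _]; rewrite /im_curve E /= !addrK.
    by [].
Qed.

(** The pole [z = 1] lies to the right of the strip, hence on the arc around the right focus,
    computed for [- z]. With [E] the distance to that focus, the coordinates read [E sin = 1/2] and
    [E cos = x0 / 2]: the quotient gives the time, the sum of squares the relation. *)
Lemma cyc_pole {R : realType} (a b c d x0 x1 t : R) :
  a < 0 -> 0 < b -> c < 0 -> 0 < d -> 0 < x0 -> 3 < x0 * x0 -> 0 < x1 -> 3 < x1 * x1 ->
  let ys := ystar a b c d x0 x1 in let T0 := turnT a b c d x0 x1 ys in
  cyc_x a b c d x0 x1 t = 1 -> cyc_y a b c d x0 x1 t = 0 ->
  cycle_meets_infinity a b c d x0 x1 /\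
  exists n : int, t = n%:~R * T0 + (halfT a b x1 ys + atan (1 / x0) / d).
Proof.
move=> a0 b0 c0 d0 x00 x03 x10 x13 ys T0.
have ysx : x0 / 2 < ys by exact: ystar_gt.
have ys0 : 0 < ys by move: ysx x00; clear; lra.
pose n := next a b x1 ys.
have nx1 : x1/2 < n by exact: next_gt.
have n0 : 0 < n by move: nx1 x10; clear; lra.
have [m tm mE] := cycE a b c d x0 x1 t a0 b0 c0 d0 x00 x10.
have [-> ->] := mE t tm; rewrite -/ys -/T0 in tm *; set s := t - m%:~R * T0 in tm *.
rewrite /turn_x /turn_y; case: (leP s (halfT a b x1 ys)) => sT.
  have s1 : 0 <= s <= halfT a b x1 ys by have /andP[-> _] := tm.
  by case: (half_pos a b x1 ys s b0 x10 x13 ys0 s1) => [[_ ? _]|[_ ?]|[_ ? _]|[[_ ? _]|[_ ? _]]]; lra.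
rewrite -/n; set r := s - halfT a b x1 ys => X Y.
have s1 : 0 <= r <= halfT c d x0 n.
  by move: tm sT; rewrite /T0 /turnT -/n /r; clear; lra.
have [/andP[r0 rd] _] : 0 < r < pi / d /\ half_x c d x0 n r < - (1/2).
  by case: (half_pos c d x0 n r d0 x00 x03 n0 s1) => [[_ ? _]|//|[_ ? _]|[[_ ? _]|[_ ? _]]]; exfalso; lra.
move: X Y; rewrite /half_x /half_y (ltW rd) /left_x /left_y.
set E := (n + x0 / 2) * expR (c * r) => X Y.
have E0 : 0 < E by rewrite mulr_gt0 ?expR_gt0// addr_gt0// divr_gt0.
have Es : E * sin (d * r) = 1/2 by move: X; clear; lra.
have Ec : E * cos (d * r) = x0 / 2 by move: Y; clear; lra.
have dr0 : 0 < d * r by exact: mulr_gt0.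
have drp : d * r < pi by rewrite mulrC -ltr_pdivlMr.
have cos0 : 0 < cos (d * r) by rewrite -(pmulr_rgt0 _ E0) Ec divr_gt0.
(* The positive cosine confines the angle to the first quadrant, where [atan] inverts the
   tangent. *)
have dr2 : d * r < pi / 2.
  rewrite -ltr_cos ?cos_pihalf// in_itv/=; first by rewrite ltW// ltW.
  by rewrite divr_ge0 ?pi_ge0//= ler_pdivrMr// ler_peMr ?pi_ge0// ler1n.
have cn0 : cos (d * r) != 0 by rewrite gt_eqF.
have En0 : E != 0 by rewrite gt_eqF.
have x0n : x0 != 0 by rewrite gt_eqF.
have tanE : tan (d * r) = 1 / x0.
  rewrite /tan (_ : sin (d * r) = 1 / 2 / E); last by rewrite -Es; field.
  rewrite (_ : cos (d * r) = x0 / 2 / E); last by rewrite -Ec; field.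
  by field; rewrite En0 x0n.
have at_ : atan (1 / x0) = d * r.
  rewrite -tanE tanK// in_itv/= dr2 andbT; apply: lt_trans dr0.
  by rewrite oppr_lt0 divr_gt0// pi_gt0.
have dn0 : d != 0 by rewrite gt_eqF.
split; last first.
  exists m; rewrite at_ (_ : d * r / d = r); last by field.
  by rewrite /r /s; ring.
rewrite /cycle_meets_infinity at_ (_ : c / d * (d * r) = c * r); last by field.
rewrite expRD.
have /andP[_ AB] := AB_lt1 a b c d a0 b0 c0 d0.
have ABn : 1 - expR (pi * a / b) * expR (pi * c / d) != 0 by rewrite gt_eqF// subr_gt0.
have -> : (x0 + x1) * (1 + expR (pi * a / b)) / (1 - expR (pi * a / b) * expR (pi * c / d)) *
   expR (c * r) = 2 * E.
  rewrite /E /n /next /ys /ystar; move: ABn; clear.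
  move: (expR (pi * a / b)) (expR (pi * c / d)) (expR (c * r)) => A B C ABn.
  by field.
have -> : 1 + x0 ^+ 2 = (2 * E) ^+ 2.
  have -> : (2 * E) ^+ 2 = (2 * (E * cos (d * r))) ^+ 2 + (2 * (E * sin (d * r))) ^+ 2.
    rewrite -[LHS]mulr1 -(cos2Dsin2 (d * r)); ring.
  by rewrite Es Ec; field.
by rewrite sqrtr_sqr gtr0_norm// mulr_gt0.
Qed.

Lemma ae_countable {R : realType} (A : set R) : countable A ->
  {ae (@lebesgue_measure R), forall t, ~ A t}.
Proof.
move=> cA; exists A; split; last by move=> t /contrapT.
- by apply: countable_measurable => // t; exact: measurable_set1.
- exact: countable_lebesgue_measure0.
Qed.

Lemma lattice_isolated {R : realType} (T C : R) : 0 < T ->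
  isolated (fun t => exists n : int, t = n%:~R * T + C).
Proof.
move=> T0 t; have [m mE _] := floor_mod T (t - C) T0; pose e := t - C - m%:~R * T; have eE : e = t - C - m%:~R * T by [].
rewrite -eE in mE; clearbody e.
(* [e] is the offset of [t] from the lattice point before it. [dd] is the distance to the nearest
   lattice point other than [t], hence [T] when [t] is on the lattice. *)
pose dd := if e == 0 then T else Num.min e (T - e).
have /andP[e0 eT] := mE.
have d0 : 0 < dd.
  rewrite /dd; case: eqVneq => // en0.
  by rewrite lt_min subr_gt0 eT andbT lt_neqAle eq_sym en0.
have dd1 : dd <= T - e.
  by rewrite /dd; case: eqVneq => [->|_]; rewrite ?subr0// ge_min lexx orbT.
have dd2 : e != 0 -> dd <= e by rewrite /dd; case: eqVneq => // _ _; rewrite ge_min lexx.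
clearbody dd; apply/nbhs_ballP; exists dd => // r; rewrite /ball/= => tr rt [n rE].
have tE : t - r = (m - n)%:~R * T + e by rewrite eE rE intrB; ring.
have [k0|k0|k0] := ltgtP (m - n) 0.
- have : (m - n)%:~R * T <= - T.
    have : (m - n)%:~R + 1 <= 0 :> R by rewrite -intrD1 lerz0 lezD1.
    by move=> H; rewrite -[- T]mulN1r ler_pM2r//; move: H; clear; lra.
  by move: tr; rewrite tE ltr_norml; move: dd1; clear; lra.
- have : T <= (m - n)%:~R * T.
    have : 1 <= (m - n)%:~R :> R by rewrite ler1z -gtz0_ge1.
    by move=> H; rewrite -[X in X <= _]mul1r ler_pM2r.
  by move: tr; rewrite tE ltr_norml; move: e0 eT dd1; clear; lra.
- move: tr; rewrite tE k0 mul0r add0r ger0_norm// => edd.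
  have [e00|/dd2] := eqVneq e 0; last by rewrite leNgt edd.
  by move/eqP: rt; apply; apply/eqP; rewrite eq_sym -subr_eq0 tE k0 e00 mul0r addr0.
Qed.

(** For [k = 0] the pole is the origin, inside the rectangle, and is never met. For [k = 1] all
    passages have the offset found in [cyc_pole], so they lie in one lattice, which is isolated and
    countable. *)
Lemma cyc_bad {R : realType} (k a b c d x0 x1 : R) :
  a < 0 -> 0 < b -> c < 0 -> 0 < d -> 0 < x0 -> 3 < x0 * x0 -> 0 < x1 -> 3 < x1 * x1 ->
  k = 0 \/ k = 1 ->
  let bad t := cyc_x a b c d x0 x1 t = k /\ cyc_y a b c d x0 x1 t = 0 in
  [/\ isolated bad, {ae (@lebesgue_measure R), forall t, ~ bad t} & k = 0 -> forall t, ~ bad t].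
Proof.
move=> a0 b0 c0 d0 x00 x03 x10 x13 k01 bad.
have nb0 : k = 0 -> forall t, ~ bad t.
  move=> k0 t [xt yt]; apply: (cyc_avoids a b c d x0 x1 a0 b0 c0 d0 x00 x03 x10 x13 t).
  by rewrite xt yt k0; move: x00 x10; clear; split; lra.
have [T00 _ _] := cyc_periodic a b c d x0 x1 a0 b0 c0 d0 x00 x10.
set T0 := turnT _ _ _ _ _ _ _ in T00.
have [C CP] : exists C, forall t, bad t -> exists n : int, t = n%:~R * T0 + C.
  case: k01 => k_; first by exists 0 => t /(nb0 k_).
  eexists => t [xt yt]; rewrite k_ in xt.
  by have [_ H] := cyc_pole a b c d x0 x1 t a0 b0 c0 d0 x00 x03 x10 x13 xt yt; exact: H.
split => //.
  by move=> t; apply: filterS (lattice_isolated T0 C T00 t) => r nr /CP.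
pose A := \bigcup_(n in [set: int]) [set n%:~R * T0 + C].
have cA : countable A by apply: bigcup_countable => // n _; exact: countable1.
apply: ae_imp (ae_countable A cA) => t nA /CP[n tE]; apply: nA.
by exists n.
Qed.

Lemma cyc_ztraj {R : realType} (a b c d x0 x1 : R) (bad : R -> Prop) :
  a < 0 -> 0 < b -> c < 0 -> 0 < d -> 0 < x0 -> 3 < x0 * x0 -> 0 < x1 -> 3 < x1 * x1 ->
  isolated bad -> ztraj a b c d x0 x1 bad (cyc_x a b c d x0 x1) (cyc_y a b c d x0 x1).
Proof.
move=> a0 b0 c0 d0 x00 x03 x10 x13 isb.
have [[L L0 xL] [K K0 yK]] := cyc_lip a b c d x0 x1 a0 b0 c0 d0 x00 x03 x10 x13.
have lipc (f : R -> R) (M : R) : 0 <= M ->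
    (forall u v, u <= v -> `|f v - f u| <= M * (v - u)) -> continuous f.
  move=> M0 fM t; apply/cvgrPdist_lt => e e0.
  have M1 : 0 < M + 1 by rewrite ltr_wpDl.
  have d1 : 0 < e / (M + 1) by rewrite divr_gt0.
  apply/nbhs_ballP; exists (e / (M + 1)) => // r; rewrite /ball/= => tr.
  apply: (@le_lt_trans _ _ (M * `|t - r|)).
    case: (leP t r) => rt.
      have E : `|t - r| = r - t by rewrite distrC ger0_norm// subr_ge0.
      by rewrite E distrC; exact: fM.
    have E : `|t - r| = t - r by rewrite ger0_norm// subr_ge0 ltW.
    by rewrite E; apply: fM; exact: ltW.
  apply: (@le_lt_trans _ _ ((M + 1) * `|t - r|)); first by rewrite ler_wpM2r// lerDl.
  by move: tr; rewrite ltr_pdivlMr// mulrC.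
split => //.
- exact: lipc xL.
- exact: lipc yK.
- by move=> s t; split=> u v su vt _; [apply: (@AC_lip R _ u v L)|apply: (@AC_lip R _ u v K)] => *; [exact: xL|exact: yK].
- apply: ae_imp (cyc_null a b c d x0 x1 a0 b0 c0 d0 x00 x03 x10 x13) => t [l1 l2].
  have [A B C] := cyc_sol a b c d x0 x1 t a0 b0 c0 d0 x00 x03 x10 x13.
  have [lt|gt|eq] := ltgtP (cyc_x a b c d x0 x1 t) (- (1/2)); last by rewrite eq eqxx in l1.
    have [dx dy] := A lt; do 2 eexists; split; [|exact: dx|exact: dy].
    exists 1, 0, 0; split; rewrite ?eqxx//; [by clear; lra|by split => // _; exact: ltW| |]; by clear; ring.
  have [lt'|gt'|eq] := ltgtP (cyc_x a b c d x0 x1 t) (1/2); last by rewrite eq eqxx in l2.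
    have [|dx dy] := B; first by rewrite gt.
    do 2 eexists; split; [|exact: dx|exact: dy].
    exists 0, 1, 0; split; rewrite ?eqxx//; [by clear; lra|by split => // _; rewrite !ltW| |]; by clear; ring.
  have [dx dy] := C gt'; do 2 eexists; split; [|exact: dx|exact: dy].
  exists 0, 0, 1; split; rewrite ?eqxx//; [by clear; lra|by split => // _; exact: ltW| |]; by clear; ring.
Qed.

(* The preimage of the rectangle in the w-plane, with denominators cleared; it
   contains w = 1. *)
Definition rect {R : realType} (k x0 x1 : R) : set (R[i])^o := [set w |
  [/\ 0 <= complex.Re w - 1 + k * nsq w + nsq w / 2,
      0 <= nsq w / 2 - (complex.Re w - 1 + k * nsq w),
      0 <= x1 / 2 * nsq w - complex.Im w & 0 <= x0 / 2 * nsq w + complex.Im w]].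

Lemma rectP {R : realType} (k x0 x1 : R) (w : R[i]) : w != 1 ->
  rect k x0 x1 w <-> - (1/2) <= zx k w <= 1/2 /\ - (x1/2) <= zy w <= x0/2.
Proof.
move=> w1; have N0 := nsq_gt0 w w1; have Nn : nsq w != 0 by rewrite gt_eqF.
have e1 : complex.Re w - 1 + k * nsq w + nsq w / 2 = (zx k w + 1/2) * nsq w by rewrite /zx; field.
have e2 : nsq w / 2 - (complex.Re w - 1 + k * nsq w) = (1/2 - zx k w) * nsq w by rewrite /zx; field.
have e3 : x1 / 2 * nsq w - complex.Im w = (zy w + x1/2) * nsq w by rewrite /zy; field.
have e4 : x0 / 2 * nsq w + complex.Im w = (x0/2 - zy w) * nsq w by rewrite /zy; field.
rewrite /rect /= e1 e2 e3 e4 !pmulr_lge0//; clear.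
by split => [[]|[]]; [split|split]; lra.
Qed.

Lemma rect_closed {R : realType} (k x0 x1 : R) : closed (@rect R k x0 x1).
Proof.
have ge0 (f : (R[i])^o -> R) : continuous f -> closed [set w | 0 <= f w].
  move=> cf; rewrite (_ : [set w | 0 <= f w] = f @^-1` [set x | 0 <= x]) //.
  by apply: closed_comp; [move=> w _; exact: cf|exact: closed_ge].
have cr (w : (R[i])^o) : {for w, continuous (fun z : (R[i])^o => complex.Re z)} by exact: Re_continuous.
have ci (w : (R[i])^o) : {for w, continuous (fun z : (R[i])^o => complex.Im z)} by exact: Im_continuous.
have cn (w : (R[i])^o) : {for w, continuous (fun z : (R[i])^o => nsq z)} by exact: nsq_continuous.
rewrite (_ : rect k x0 x1 =
  ([set w : (R[i])^o | 0 <= complex.Re w - 1 + k * nsq w + nsq w / 2] `&`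
   [set w : (R[i])^o | 0 <= nsq w / 2 - (complex.Re w - 1 + k * nsq w)]) `&`
  ([set w : (R[i])^o | 0 <= x1 / 2 * nsq w - complex.Im w] `&`
   [set w : (R[i])^o | 0 <= x0 / 2 * nsq w + complex.Im w])); last first.
  by apply/seteqP; split => [w [A B C D]|w [[A B] [C D]]].
apply: closedI; apply: closedI; apply: ge0 => w; have A := cr w; have B := ci w; have C := cn w.
- change {for w, continuous (fun z : (R[i])^o => complex.Re z - 1 + k * nsq z + nsq z * 2^-1)}.
  by conti.
- change {for w, continuous (fun z : (R[i])^o => nsq z * 2^-1 - (complex.Re z - 1 + k * nsq z))}.
  by conti.
- change {for w, continuous (fun z : (R[i])^o => x1 / 2 * nsq z - complex.Im z)}.
  by conti.
- change {for w, continuous (fun z : (R[i])^o => x0 / 2 * nsq z + complex.Im z)}.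
  by conti.
Qed.

(** For [k = 1] the condition [x <= 1/2] becomes [|w| <= 1], so the preimage of the rectangle is
    bounded. *)
Lemma rect_compact {R : realType} (x0 x1 : R) : compact (@rect R 1 x0 x1).
Proof.
apply: (subclosed_compact (@rect_closed R 1 x0 x1) (box_compact 1).1) => w [_ A _ _].
move: A; rewrite /box /nsq /=.
move: (complex.Re w) (complex.Im w) => u v A.
have {}A : u * u + v * v <= 1 by move: A; clear; lra.
have uu : 0 <= u * u by rewrite -expr2 sqr_ge0.
have vv : 0 <= v * v by rewrite -expr2 sqr_ge0.
by split; apply/andP; split; nra.
Qed.

(** The isolating neighborhood. Infinity is [z = k], which for [k = 0] is inside the rectangle and
    left out, and for [k = 1] is outside and kept, since the cycle may reach it. *)
Definition off_rect {R : realType} (k x0 x1 : R) : set (riemann_sphere R) :=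
  [set p | if p is Some w then ~ rect k x0 x1 w else k = 1].

Lemma off_rect_open {R : realType} (k x0 x1 : R) : k = 0 \/ k = 1 -> open (off_rect k x0 x1).
Proof.
move=> k01; rewrite openE => -[w|] /= nw.
  have : nbhs w (~` rect k x0 x1).
    by apply: open_nbhs_nbhs; split => //; exact: closed_openC (rect_closed k x0 x1).
  by [].
exists (rect k x0 x1).
  split; last exact: rect_closed.
  by move: nw; rewrite /off_rect /= => ->; exact: rect_compact.
by move=> _ [[w nb <-]|->].
Qed.

Lemma limit_cycle_conj {R : realType} (k a b c d x0 x1 : R) (S : pw_system R) :
  a < 0 -> 0 < b -> c < 0 -> 0 < d -> 0 < x0 -> 3 < x0 * x0 -> 0 < x1 -> 3 < x1 * x1 ->
  k = 0 \/ k = 1 -> conj_sys k a b c d x0 x1 S ->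
  exists C, [/\ limit_cycle S C, k = 0 -> ~ C None & k = 1 -> C None -> cycle_meets_infinity a b c d x0 x1].
Proof.
move=> a0 b0 c0 d0 x00 x03 x10 x13 k01 cS.
set X := cyc_x a b c d x0 x1; set Y := cyc_y a b c d x0 x1.
pose g t := psi k (X t) (Y t).
pose ys := ystar a b c d x0 x1; pose T0 := turnT a b c d x0 x1 ys.
have [isb aeb nb0] := cyc_bad k a b c d x0 x1 a0 b0 c0 d0 x00 x03 x10 x13 k01.
have zt := cyc_ztraj a b c d x0 x1 _ a0 b0 c0 d0 x00 x03 x10 x13 isb.
have tg : trajectory S g.
  by apply: from_z cS zt _ aeb; exact: cyc_null.
have [T00 pX pY] := cyc_periodic a b c d x0 x1 a0 b0 c0 d0 x00 x10.
have [sX sY] : X 0 = - (1/2) /\ Y 0 = ys := cyc_start a b c d x0 x1 a0 b0 c0 d0 x00 x10.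
have avX := cyc_avoids a b c d x0 x1 a0 b0 c0 d0 x00 x03 x10 x13.
have ysx : x0 / 2 < ys by exact: ystar_gt.
have ys0 : 0 < ys by move: ysx x00; clear; lra.
have nx1 : x1/2 < next a b x1 ys by exact: next_gt.
have n0 : 0 < next a b x1 ys by move: nx1 x10; clear; lra.
exists (range g); split; last 2 first.
- by move=> k0 [t _ /psi_None]; exact: nb0.
- move=> k1 [t _ /psi_None[xt yt]]; rewrite k1 in xt.
  by have [] := cyc_pole a b c d x0 x1 t a0 b0 c0 d0 x00 x03 x10 x13 xt yt.
have pg : periodic_orbit S (range g).
  exists g, T0; split => //.
    by move=> t; congr psi; [exact: pX|exact: pY].
  (* Half a turn later the cycle is on the other line, so it is not constant. *)
  pose t1 := halfT a b x1 ys; exists t1 => /(congr1 (zxo k)).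
  rewrite /g (zxo_psi k (X t1) (Y t1)).1 (zxo_psi k (X 0) (Y 0)).1 sX.
  have T1 := halfT_gt0 a b x1 ys b0 x10 ys0.
  have T2 := halfT_gt0 c d x0 _ d0 x00 n0.
  rewrite /X /cyc_x (perextE _ _ _ 0) ?mul0r ?subr0//; last first.
    by rewrite (ltW T1) /= /turnT ltrDl.
  rewrite /turn_x lexx; have [-> _] := half_end a b x1 ys n0.
  by clear; lra.
split => //; exists (off_rect k x0 x1); split; first exact: off_rect_open.
  move=> p [t _ <-]; rewrite /off_rect /= /g.
  have [bt|nb] := pselect (X t = k /\ Y t = 0).
    by rewrite (psi_None k (X t) (Y t)).2//; case: k01 => // k0; have := nb0 k0 t bt.
  have [E _] := psi_Some k (X t) (Y t) nb; have [zX zY] := zxo_psi k (X t) (Y t).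
  have n1 := psi_neq1 k (X t) (Y t).
  rewrite E in zX zY n1 *; move: zX zY n1; set w := (_ +i* _)%C => /= zX zY n1.
  have w1 : w != 1 by apply/eqP => e; apply: n1; rewrite e.
  move=> /(rectP k x0 x1 w w1); rewrite zX zY; exact: avX.
move=> C' [h [T [th Tp ph _ ->]]] hU.
have zh := to_z k a b c d x0 x1 S h cS th.
have [ch ish h1 _ _] := th.
have avh : avoids x0 x1 (fun t => zxo k (h t)) (fun t => zyo (h t)).
  move=> t; have : off_rect k x0 x1 (h t) by apply: hU; exists t.
  rewrite /off_rect /=; have := h1 t; case: (h t) => [w|_ k1] /=.
    by move=> n1 nr [A B]; apply: nr; apply/rectP => //; apply/eqP => e; apply: n1; rewrite e.
  by rewrite k1 => -[]; clear; lra.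
have ph1 : periodic T (fun t => zxo k (h t)) by move=> t; rewrite ph.
have ph2 : periodic T (fun t => zyo (h t)) by move=> t; rewrite ph.
have [t0 [xt0 yt0]] := reach_cycle a b c d x0 x1 _ _ _ T a0 b0 c0 d0 x00 x03 x10 x13 zh avh Tp ph1 ph2.
have [H1 H2] := range_cycle a b c d x0 x1 _ _ _ T t0 a0 b0 c0 d0 x00 x03 x10 x13 zh avh Tp ph1 ph2 xt0 yt0.
have [G1 G2] := range_cycle a b c d x0 x1 _ _ _ T0 0 a0 b0 c0 d0 x00 x03 x10 x13 zt avX T00 pX pY sX sY.
(* Both orbits trace the same arc in [z], and [psi] carries it back to the sphere. *)
apply/seteqP; split => p [t _ <-].
  have [s sT [A B]] := H2 t; have [A' B'] := G1 s sT.
  exists (0 + s) => //; rewrite -(psi_zxo k (h t) (h1 t)) /g /X /Y A' B'.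
  by move: A B => /= -> ->.
have [s sT [A B]] := G2 t; have [A' B'] := H1 s sT.
exists (t0 + s) => //; rewrite -(psi_zxo k (h (t0 + s)) (h1 _)) /g /X /Y A B.
by move: A' B' => /= -> ->.
Qed.

(** * The two systems *)

Lemma complex_ratE {R : realType} (m n : nat) : (m%:R / n%:R : R[i]) = ((m%:R / n%:R : R) +i* 0)%C.
Proof. by rewrite -[RHS]/((m%:R / n%:R : R)%:C) rmorphM fmorphV !rmorph_nat. Qed.

Lemma complex_natE {R : realType} (m : nat) : (m%:R : R[i]) = ((m%:R : R) +i* 0)%C.
Proof. by rewrite -[RHS]/((m%:R : R)%:C) rmorph_nat. Qed.

Lemma complex1E {R : realType} : (1 : R[i]) = ((1 : R) +i* 0)%C.
Proof. by []. Qed.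

Lemma normC_cmp {R : realType} (w : R[i]) (r : R) : 0 < r ->
  (`|w| < (r +i* 0)%C) = (complex.Re w ^+ 2 + complex.Im w ^+ 2 < r ^+ 2) /\
  ((r +i* 0)%C < `|w|) = (r ^+ 2 < complex.Re w ^+ 2 + complex.Im w ^+ 2).
Proof.
move=> r0; rewrite -[(r +i* 0)%C]/(r%:C) normc_def !ltcR.
have r2 : r = Num.sqrt (r ^+ 2) by rewrite sqrtr_sqr gtr0_norm.
have r20 : 0 < r ^+ 2 by rewrite exprn_gt0.
have s0 : 0 <= complex.Re w ^+ 2 + complex.Im w ^+ 2 by rewrite addr_ge0// sqr_ge0.
split; first by rewrite {1}r2 ltr_sqrt.
apply/idP/idP => H.
  rewrite ltNge; apply/negP => H'; move: H; rewrite ltNge => /negP; apply.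
  by rewrite r2 ler_wsqrtr.
by rewrite {1}r2 ltr_sqrt// (lt_trans r20).
Qed.

Lemma complex_invE {R : realType} (w : R[i]) : w != 1 ->
  (w - 1)^-1 = (((complex.Re w - 1) * (nsq w)^-1) +i* (- (complex.Im w * (nsq w)^-1)))%C.
Proof.
move=> w1; have Nn : nsq w != 0 by rewrite gt_eqF// nsq_gt0.
have w10 : w - 1 != 0 by rewrite subr_eq0.
apply: (mulIf w10); rewrite mulVf//; move: Nn; clear; rewrite /nsq; case: w => [u v] /= Nn.
by apply/eqP; rewrite eq_complex /=; apply/andP; split; apply/eqP; field.
Qed.

Lemma closure_ge0 {R : realType} (f : (R[i])^o -> R) (A : set (R[i])^o) w : continuous f ->
  (forall z, A z -> 0 <= f z) -> closure A w -> 0 <= f w.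
Proof.
move=> cf Af; have cl : closed (f @^-1` [set x | 0 <= x]).
  by apply: closed_comp; [move=> z _; exact: cf|exact: closed_ge].
by move=> /(closure_subset (B := f @^-1` [set x | 0 <= x]) Af); rewrite -(closure_id _).1.
Qed.

(** Off [w = 1] these are [x + 1/2] and [1/2 - x] times [nsq w]. As polynomials they are, up to
    nonzero constants, the equations of the circles: [|w| = 1] and [|w - 2| = 1] for [k = 0],
    [|w - 2/3| = 1/3] and [|w| = 1] for [k = 1]. *)
Definition zside1 {R : realType} (k : R) (w : R[i]) := complex.Re w - 1 + k * nsq w + nsq w * 2^-1.
Definition zside2 {R : realType} (k : R) (w : R[i]) := nsq w * 2^-1 - (complex.Re w - 1 + k * nsq w).

Lemma zside_continuous {R : realType} (k : R) :
  continuous (zside1 k : (R[i])^o -> R) /\ continuous (zside2 k : (R[i])^o -> R).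
Proof.
have cr (w : (R[i])^o) : {for w, continuous (fun z : (R[i])^o => complex.Re z)} by exact: Re_continuous.
have cn (w : (R[i])^o) : {for w, continuous (fun z : (R[i])^o => nsq z)} by exact: nsq_continuous.
split=> w; have A := cr w; have B := cn w.
  change {for w, continuous (fun z : (R[i])^o => complex.Re z - 1 + k * nsq z + nsq z * 2^-1)}.
  by conti.
change {for w, continuous (fun z : (R[i])^o => nsq z * 2^-1 - (complex.Re z - 1 + k * nsq z))}.
by conti.
Qed.

(** Continuity of the two polynomials weakens the strict inequalities on closures; division by the
    positive [nsq w] then gives the bounds on [x]. *)
Lemma zone_conj {R : realType} (k : R) (S : pw_system R) (w : R[i]) : w != 1 ->
  (forall z, zone_p S z <-> zside1 k z < 0) ->
  (forall z, zone_c S z <-> 0 < zside1 k z /\ 0 < zside2 k z) ->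
  (forall z, zone_m S z <-> zside2 k z < 0) ->
  let x := zx k w in
  [/\ closure (zone_p S : set (R[i])^o) w -> x <= - (1/2),
      closure (zone_c S : set (R[i])^o) w -> - (1/2) <= x <= 1/2
    & closure (zone_m S : set (R[i])^o) w -> 1/2 <= x] /\
  [/\ x < - (1/2) -> zone_p S w, - (1/2) < x < 1/2 -> zone_c S w & 1/2 < x -> zone_m S w].
Proof.
move=> w1 Zp Zc Zm x; have N0 := nsq_gt0 w w1; have Nn : nsq w != 0 by rewrite gt_eqF.
have e1 : zside1 k w = (x + 1/2) * nsq w by rewrite /zside1 /x /zx; field.
have e2 : zside2 k w = (1/2 - x) * nsq w by rewrite /zside2 /x /zx; field.
have [c1 c2] := @zside_continuous R k.
have c1' : continuous (fun z : (R[i])^o => - zside1 k z) by move=> z; apply: continuous_atN; exact: c1.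
have c2' : continuous (fun z : (R[i])^o => - zside2 k z) by move=> z; apply: continuous_atN; exact: c2.
split; split.
- move=> cl; have : 0 <= - zside1 k w.
    by apply: closure_ge0 c1' _ cl => z /Zp; clear; lra.
  by rewrite e1 -mulNr pmulr_lge0//; clear; lra.
- move=> cl; have : 0 <= zside1 k w.
    by apply: closure_ge0 c1 _ cl => z /Zc[/ltW].
  have : 0 <= zside2 k w.
    by apply: closure_ge0 c2 _ cl => z /Zc[_ /ltW].
  by rewrite e1 e2 !pmulr_lge0//; clear; lra.
- move=> cl; have : 0 <= - zside2 k w.
    by apply: closure_ge0 c2' _ cl => z /Zm; clear; lra.
  by rewrite e2 -mulNr pmulr_lge0//; clear; lra.
- by move=> xl; apply/Zp; rewrite e1 pmulr_llt0//; move: xl; clear; lra.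
- by move=> /andP[xl xr]; apply/Zc; rewrite e1 e2 !pmulr_lgt0//; move: xl xr; clear; lra.
- by move=> xl; apply/Zm; rewrite e2 pmulr_llt0//; move: xl; clear; lra.
Qed.

(** Here [z = 1 / (w - 1)], and the factor [- 1 / (w - 1)^2] turns [4 i / (w - 1)] into
    [- 4 i z^3]. *)
Lemma external_conj {R : realType} (a b c d x0 x1 : R) :
  conj_sys 0 a b c d x0 x1 (external_system a b c d x0 x1).
Proof.
move=> w w1.
have [||| Z1 Z2] := zone_conj 0 (external_system a b c d x0 x1) w w1.
- move=> z /=; rewrite complex1E (normC_cmp z 1 ltr01).1 /zside1 /nsq; case: z => [u v] /=.
  by clear; split; lra.
- move=> z /=; rewrite (complex_natE 2) complex1E (normC_cmp z 1 ltr01).2 (normC_cmp (z - _) 1 ltr01).2.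
  rewrite /zside1 /zside2 /nsq; case: z => [u v] /=.
  by clear; split => -[]; split; lra.
- move=> z /=; rewrite (complex_natE 2) complex1E (normC_cmp (z - _) 1 ltr01).1.
  rewrite /zside2 /nsq; case: z => [u v] /=.
  by clear; split; lra.
have Nn : nsq w != 0 by rewrite gt_eqF// nsq_gt0.
have h2 : (2 : R[i])^-1 = ((2^-1 : R) +i* 0)%C by rewrite -[RHS]/((2^-1 : R)%:C) fmorphV rmorph_nat.
split => //.
- rewrite /zx /zy /pull1 /pull2 /inv_d1 /inv_d2 -/(nsq w) /external_system /= h2 (complex_natE 2).
  move: Nn; rewrite /nsq; case: (w) => [u v] /= Nn.
  by clear -Nn; split; field.
- rewrite /zx /zy /pull1 /pull2 /inv_d1 /inv_d2 -/(nsq w) /external_system /= (complex_natE 4) (complex_invE w w1).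
  move: Nn; rewrite /nsq; case: (w) => [u v] /= Nn.
  by clear -Nn; split; field.
- rewrite /zx /zy /pull1 /pull2 /inv_d1 /inv_d2 -/(nsq w) /external_system /= h2 (complex_natE 2).
  move: Nn; rewrite /nsq; case: (w) => [u v] /= Nn.
  by clear -Nn; split; field.
Qed.

(** Here [z = w / (w - 1)]: the factor [w^3] of the middle field produces [- 4 i z^3], and the
    factor [w] in the outer fields makes them affine in [z]. *)
Lemma internal_conj {R : realType} (a b c d x0 x1 : R) :
  conj_sys 1 a b c d x0 x1 (internal_system a b c d x0 x1).
Proof.
move=> w w1; have i3 : 0 < 1 / 3 :> R by rewrite divr_gt0.
have [||| Z1 Z2] := zone_conj 1 (internal_system a b c d x0 x1) w w1.
- move=> z /=; rewrite (complex_ratE 2 3) (complex_ratE 1 3) (normC_cmp (z - _) (1 / 3) i3).1 /zside1 /nsq; case: z => [u v] /=.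
  by clear; split; lra.
- move=> z /=; rewrite (complex_ratE 2 3) (complex_ratE 1 3) complex1E (normC_cmp z 1 ltr01).1 (normC_cmp (z - _) (1 / 3) i3).2.
  rewrite /zside1 /zside2 /nsq; case: z => [u v] /=.
  by clear; split => -[]; split; lra.
- move=> z /=; rewrite complex1E (normC_cmp z 1 ltr01).2.
  rewrite /zside2 /nsq; case: z => [u v] /=.
  by clear; split; lra.
have Nn : nsq w != 0 by rewrite gt_eqF// nsq_gt0.
have h2 : (2 : R[i])^-1 = ((2^-1 : R) +i* 0)%C by rewrite -[RHS]/((2^-1 : R)%:C) fmorphV rmorph_nat.
split => //.
- rewrite /zx /zy /pull1 /pull2 /inv_d1 /inv_d2 -/(nsq w) /external_system /= h2 (complex_natE 2).
  move: Nn; rewrite /nsq; case: (w) => [u v] /= Nn.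
  by clear -Nn; split; field.
- rewrite /zx /zy /pull1 /pull2 /inv_d1 /inv_d2 -/(nsq w) /external_system /= (complex_natE 4) (complex_invE w w1) !exprS expr0.
  move: Nn; rewrite /nsq; case: (w) => [u v] /= Nn.
  by clear -Nn; split; field.
- rewrite /zx /zy /pull1 /pull2 /inv_d1 /inv_d2 -/(nsq w) /external_system /= h2 (complex_natE 2).
  move: Nn; rewrite /nsq; case: (w) => [u v] /= Nn.
  by clear -Nn; split; field.
Qed.

Lemma sqrt3_lt {R : realType} (x : R) : Num.sqrt 3 < x -> 0 < x /\ 3 < x * x.
Proof.
move=> hx; have s0 : 0 <= Num.sqrt 3 :> R by exact: sqrtr_ge0.
have x0 : 0 < x by exact: le_lt_trans hx.
by split => //; rewrite -expr2 -[X in X < _](@sqr_sqrtr R 3)// ltr_pXn2r// nnegrE ltW.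
Qed.

Theorem corollary2 (R : realType) (a b c d x0 x1 : R)
    (ha : a < 0) (hc : c < 0) (hb : 0 < b) (hd : 0 < d)
    (hx0 : Num.sqrt 3 < x0) (hx1 : Num.sqrt 3 < x1) :
  (exists C : set R[i],
     limit_cycle (external_system a b c d x0 x1) (Some @` C)) /\
  (exists C : set (riemann_sphere R),
     limit_cycle (internal_system a b c d x0 x1) C /\
     (C None -> cycle_meets_infinity a b c d x0 x1)).
Proof.
have [x00 x03] := sqrt3_lt x0 hx0; have [x10 x13] := sqrt3_lt x1 hx1.
split.
  have [C [lC nC _]] := limit_cycle_conj 0 a b c d x0 x1 _ ha hb hc hd x00 x03 x10 x13
    (or_introl erefl) (external_conj a b c d x0 x1).
  (* The external cycle misses infinity, so it is the image of a subset of the plane. *)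
  exists [set w | C (Some w)].
  rewrite (_ : Some @` _ = C)//; apply/seteqP; split => [_ [w Cw <-]//|[w|] Cw].
    by exists w.
  by have := nC erefl Cw.
have [C [lC _ mC]] := limit_cycle_conj 1 a b c d x0 x1 _ ha hb hc hd x00 x03 x10 x13
  (or_intror erefl) (internal_conj a b c d x0 x1).
by exists C; split => //; exact: mC.
Qed.
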